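(* Let $b>0$, let $q:[0,b]\to\mathbb{C}$ be continuous, let $f$ be a non-vanishing solution of $f''-qf=0$ on $[0,b]$ with $f(0)=1$, $h:=f'(0)$, and let $c(\omega,x)$, $s(\omega,x)$, $\gamma_n$ be as defined in the context. The derivatives with respect to $x$ of the solutions $c(\omega,x)$ and $s(\omega,x)$ of the equation $-y''+q(x)y=\omega^2y$ admit the representations $$c'(\omega,x)=-\omega\sin\omega x+\left(h+\frac12\int_0^xq(s)\,ds\right)\cos\omega x+2\sum_{n=0}^\infty(-1)^n\gamma_{2n}(x)j_{2n}(\omega x)$$ and $$s'(\omega,x)=\omega\cos\omega x+\frac12\left(\int_0^xq(s)\,ds\right)\sin\omega x+2\sum_{n=0}^\infty(-1)^n\gamma_{2n+1}(x)j_{2n+1}(\omega x).$$ The series converge uniformly with respect to $x$ on $[0,b]$ and converge uniformly with respect to $\omega$ on any compact subset of the complex plane of the variable $\omega$.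
   Context: $P_n(x)=\sum_{k=0}^nl_{k,n}x^k$ is the Legendre polynomial of degree $n$; $j_k(z)=\sqrt{\pi/(2z)}\,J_{k+1/2}(z)$ is the spherical Bessel function of order $k$. Transmutation kernel: $K$ is the (unique continuous) function on $\{(x,t):0\le x\le b,\ |t|\le x\}$ satisfying $$K(x,t)=\frac h2+\frac12\int_0^{\frac{x+t}{2}}q(s)\,ds+\int_0^{\frac{x+t}{2}}\int_0^{\frac{x-t}{2}}q(\alpha+\beta)K(\alpha+\beta,\alpha-\beta)\,d\beta\,d\alpha .$$ It is the $C^1$ kernel of the transmutation operator $Tu(x)=u(x)+\int_{-x}^{x}K(x,t)u(t)\,dt$, which satisfies $\left(-\frac{d^2}{dx^2}+q\right)T[u]=T[-u'']$ for $u\in C^2$ and $T[1]=f$. Solutions: $c(\omega,x):=\cos\omega x+\int_{-x}^xK(x,t)\cos\omega t\,dt$ and $s(\omega,x):=\sin\omega x+\int_{-x}^xK(x,t)\sin\omega t\,dt$. Formal powers: $X^{(0)}\equiv\widetilde X^{(0)}\equiv1$ and, for $n\ge1$, $$X^{(n)}(x)=n\int_0^xX^{(n-1)}(s)\,(f^2(s))^{(-1)^n}ds,\qquad \widetilde X^{(n)}(x)=n\int_0^x\widetilde X^{(n-1)}(s)\,(f^2(s))^{(-1)^{n-1}}ds;$$ $\varphi_k=fX^{(k)}$ for odd $k$ and $\varphi_k=f\widetilde X^{(k)}$ for even $k$. Coefficients, for $x\in(0,b]$ (extended to $x=0$ by continuity): $$\gamma_n(x)=\frac{2n+1}{2}\left(\sum_{k=0}^n\frac{l_{k,n}\varphi_k'(x)}{x^k}-\frac{n(n+1)}{2x}-\frac12\int_0^xq(s)\,ds-\frac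 h2\bigl(1+(-1)^n\bigr)\right).$$ *)

(* Defs.v *)
From Stdlib Require Import Reals Factorial List.
From Coquelicot Require Import Coquelicot.

Open Scope C_scope.

(* As [RInt], [RInt_gen] and [lim] in Coquelicot: total operators, meaningful
   when the object being selected exists (it is then unique). *)
Definition Ciota (P : C -> Prop) : C := iota (T := C_R_CompleteNormedModule) P.

Definition Clim (g : R -> C) (F : (R -> Prop) -> Prop) : C :=
  Ciota (fun l => filterlim g F (locally l)).

Definition Csum (a : nat -> C) (n : nat) : C := sum_n (G := C_AbelianMonoid) a n.

Definition CSeries (a : nat -> C) : C :=
  Ciota (fun l => is_series (K := C_AbsRing) (V := C_NormedModule) a l).

Definition CInt (g : R -> C) (a b : R) : C :=
  RInt (V := C_R_CompleteNormedModule) g a b.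

Definition seg (b x : R) : Prop := (0 <= x <= b)%R.

(* Derivative relative to the segment [0,b]: one-sided at the endpoints. *)
Definition is_deriv (b : R) (u : R -> C) (x : R) (l : C) : Prop :=
  filterdiff (K := R_AbsRing) (U := R_NormedModule) (V := C_R_NormedModule)
    u (within (seg b) (locally x)) (fun y : R => scal y l).

Definition deriv (b : R) (u : R -> C) (x : R) : C := Ciota (is_deriv b u x).

Definition compactC (S : C -> Prop) : Prop :=
  forall (I : Type) (U : I -> C -> Prop),
    (forall i, open (U i)) ->
    (forall z, S z -> exists i, U i z) ->
    exists l : list I, forall z, S z -> exists i, In i l /\ U i z.

Definition Cexp (z : C) : C := (exp (Re z) * cos (Im z), exp (Re z) * sin (Im z))%R.
Definition Ccos (z : C) : C := (Cexp (Ci * z) + Cexp (- (Ci * z))) / 2.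
Definition Csin (z : C) : C := (Cexp (Ci * z) - Cexp (- (Ci * z))) / (2 * Ci).

(* Principal argument, in (-PI, PI], and principal real powers, for z <> 0. *)
Definition Carg (z : C) : R :=
  (if Rle_dec 0 (Im z) then acos (Re z / Cmod z) else - acos (Re z / Cmod z))%R.

Definition Cpower (z : C) (a : R) : C :=
  Rpower (Cmod z) a * (cos (a * Carg z), sin (a * Carg z))%R.

Definition Gamma (x : R) : R :=
  RInt_gen (fun t => Rpower t (x - 1) * exp (- t))%R
    (at_right 0) (Rbar_locally p_infty).

Definition BesselJ (nu : R) (z : C) : C :=
  Cpower (z / 2) nu *
  CSeries (fun m => (- (z ^ 2 / 4)) ^ m / (INR (fact m) * Gamma (nu + INR m + 1))%R).

(* sqrt (PI / (2 z)) is read as (2 z / PI)^(-1/2), on the same branch as the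
   power in [BesselJ]: taking the principal root of PI / (2 z) instead would flip
   the sign on the negative real axis, where j_k has to be analytic.
   At z = 0 the value is the limit. *)
Definition sphj (k : nat) (z : C) : C :=
  if Ceq_dec z 0 then (if Nat.eqb k 0 then 1 else 0)
  else Cpower (2 * z / PI) (- / 2) * BesselJ (INR k + / 2) z.

(* P_n(x) = 2^(-n) sum_j (-1)^j binom(n,j) binom(2n-2j,n) x^(n-2j); below
   k = n - 2j, so that 2n - 2j = n + k.  Meant for k <= n. *)
Definition legendre_coef (k n : nat) : R :=
  (if Nat.even (n - k) then
     let j := Nat.div (n - k) 2 in
     (-1) ^ j * Binomial.C n j * Binomial.C (n + k) n / 2 ^ n
   else 0)%R.

Definition is_solution (b : R) (q f : R -> C) : Prop :=
  exists df : R -> C,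
    (forall x, seg b x -> is_deriv b f x (df x)) /\
    (forall x, seg b x -> is_deriv b df x (q x * f x)).

Definition triangle (b : R) (p : R * R) : Prop :=
  (0 <= fst p <= b /\ Rabs (snd p) <= fst p)%R.

Definition is_kernel (b : R) (q : R -> C) (h : C) (K : R -> R -> C) : Prop :=
  continuous_on (triangle b) (fun p : R * R => K (fst p) (snd p)) /\
  forall x t, triangle b (x, t) ->
    K x t =
      h / 2 + / 2 * CInt q 0 ((x + t) / 2)
      + CInt (fun alpha =>
          CInt (fun beta => q (alpha + beta)%R * K (alpha + beta)%R (alpha - beta)%R)
            0 ((x - t) / 2))
          0 ((x + t) / 2).

Definition csol (K : R -> R -> C) (w : C) (x : R) : C :=
  Ccos (w * x) + CInt (fun t => K x t * Ccos (w * t)) (- x) x.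

Definition ssol (K : R -> R -> C) (w : C) (x : R) : C :=
  Csin (w * x) + CInt (fun t => K x t * Csin (w * t)) (- x) x.

(* z^((-1)^n) *)
Definition alt_pow (z : C) (n : nat) : C := if Nat.even n then z else / z.

Fixpoint Xpow (f : R -> C) (n : nat) (x : R) : C :=
  match n with
  | O => 1
  | S m => INR n * CInt (fun s => Xpow f m s * alt_pow (f s ^ 2) n) 0 x
  end.

Fixpoint Xtpow (f : R -> C) (n : nat) (x : R) : C :=
  match n with
  | O => 1
  | S m => INR n * CInt (fun s => Xtpow f m s * alt_pow (f s ^ 2) m) 0 x
  end.

Definition phi (f : R -> C) (k : nat) (x : R) : C :=
  f x * (if Nat.odd k then Xpow f k x else Xtpow f k x).

Definition gamma_formula (b : R) (q f : R -> C) (n : nat) (x : R) : C :=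
  (2 * INR n + 1) / 2 *
  (Csum (fun k => legendre_coef k n * deriv b (phi f k) x / x ^ k) n
   - INR n * (INR n + 1) / (2 * x)
   - / 2 * CInt q 0 x
   - deriv b f 0 / 2 * (1 + (-1) ^ n)).

Definition gamma (b : R) (q f : R -> C) (n : nat) (x : R) : C :=
  if Req_EM_T x 0 then Clim (gamma_formula b q f n) (at_right 0)
  else gamma_formula b q f n x.

Definition series_cv_unif (S : C -> Prop) (b : R) (a : C -> R -> nat -> C) : Prop :=
  forall eps : R, (0 < eps)%R ->
    exists N : nat, forall (n : nat) (w : C) (x : R), (N <= n)%nat ->
      S w -> seg b x ->
      (Cmod (Csum (a w x) n - CSeries (a w x)) < eps)%R.

Definition cterm (b : R) (q f : R -> C) (w : C) (x : R) (n : nat) : C :=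
  (-1) ^ n * gamma b q f (2 * n) x * sphj (2 * n) (w * x).

Definition sterm (b : R) (q f : R -> C) (w : C) (x : R) (n : nat) : C :=
  (-1) ^ n * gamma b q f (2 * n + 1) x * sphj (2 * n + 1) (w * x).

(* Main.v *)
Require Import Defs.
From Stdlib Require Import Reals Lra Lia FunctionalExtensionality.
From Coquelicot Require Import Coquelicot.

(** Write [K_x] for the derivative of the kernel in its first variable.  In the
    characteristic coordinates [u = (x+t)/2], [v = (x-t)/2] the kernel is the
    sum of a function of [u] and of the double integral of the continuous
    function [W(u,v) = q(u+v) K(u+v,u-v)]; hence it is continuously
    differentiable although [q] is only continuous.  With [K(x,x) = h/2 + 1/2
    int_0^x q] and [K(x,-x) = h/2], Leibniz' rule gives
    [c' = - w sin wx + (h + 1/2 int_0^x q) cos wx + int_(-x)^x K_x(x,t) cos wt dt]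
    and the analogous formula for [s'] ([is_Cderive_transmute]).  The series of
    the theorem has to be identified with one half of the last integral.

    The number [gamma_n(x)] is [(2n+1)/2] times the moment
    [int_(-x)^x K_x(x,t) P_n(t/x) dt] ([gamma_formula_leg_moment]).  This holds
    because the transmutation operator [T] sends [x^k] to [phi_k]
    ([transmute_pow]): one has [T[g]'' = q T[g] + T[g'']]
    ([is_Cderive_transmute_d]), and reduction of order by means of [f] turns
    this equation into the recursion that defines the formal powers
    ([reduction_of_order]).  The derivative of [T[x^k]] is then known from
    Leibniz' rule, and the terms subtracted in the definition of [gamma_n] are
    the contributions of [P_n'(1) = n(n+1)/2], [P_n(1) = 1] and
    [P_n(-1) = (-1)^n].

    The integral is expanded by replacing the trigonometric factor by its Taylor
    polynomial, since a power [t^m] is a finite combination of Legendre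
    polynomials ([pow_expansion]).  The coefficients of that combination are
    nonnegative with sum 1, hence at most 1, and, divided by [m!], they are up to
    sign the coefficients of the power series of [(2n+1) j_n] ([sphj_series]).  So the
    partial sum of index [N] of the series differs from one half of the integral
    only by tails of Taylor and Bessel series.  These decay faster than any
    geometric sequence, which absorbs the bound [|P_n| <= 3^n]; the result is an
    error [O(4^(-N))] that is uniform for [x] in the segment and [w] bounded
    ([neumann_bound], [neumann_term_bound]).  It gives the value of the sum and
    the uniform convergence at the same time.

    The power series of [j_n] requires the values of the Gamma function at
    half-integers, which come from the Gaussian integral by repeated integration
    by parts ([Gamma_half]). *)

Open Scope R_scope.

(** * Legendre polynomials *)

Notation rfact n := (INR (Factorial.fact n)).

Lemma rfact_S (n : nat) : rfact (S n) = (INR n + 1) * rfact n.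
Proof. rewrite fact_simpl, mult_INR, S_INR. reflexivity. Qed.

Lemma rfact_neq_0 (n : nat) : rfact n <> 0.
Proof. apply INR_fact_neq_0. Qed.

Lemma legendre_coef_even (k j : nat) :
  legendre_coef k (k + 2 * j) =
  (-1) ^ j * rfact (2 * k + 2 * j)
   / (2 ^ (k + 2 * j) * rfact j * rfact (k + j) * rfact k).
Proof.
  unfold legendre_coef.
  replace (k + 2 * j - k)%nat with (2 * j)%nat by lia.
  assert (E : Nat.even (2 * j) = true) by (apply Nat.even_spec; exists j; reflexivity).
  rewrite E. cbv zeta.
  replace (Nat.div (2 * j) 2) with j by (rewrite Nat.mul_comm, Nat.div_mul; lia).
  unfold Binomial.C.
  replace (k + 2 * j - j)%nat with (k + j)%nat by lia.
  replace (k + 2 * j + k - (k + 2 * j))%nat with k by lia.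
  replace (k + 2 * j + k)%nat with (2 * k + 2 * j)%nat by lia.
  field. repeat split; try apply rfact_neq_0. apply pow_nonzero; lra.
Qed.

Lemma legendre_coef_odd (k j : nat) : legendre_coef k (k + S (2 * j)) = 0.
Proof.
  unfold legendre_coef. replace (k + S (2 * j) - k)%nat with (S (2 * j)) by lia.
  rewrite Nat.even_succ, Nat.odd_mul. reflexivity.
Qed.

(** Extension by zero beyond the degree lets the recurrence hold for all [k]
    and sums be taken up to any common bound. *)
Definition leg_coef (k n : nat) : R := if Nat.leb k n then legendre_coef k n else 0.

Lemma leg_coef_le (k n : nat) : (k <= n)%nat -> leg_coef k n = legendre_coef k n.
Proof. intros H. unfold leg_coef. apply Nat.leb_le in H. rewrite H. reflexivity. Qed.

Lemma leg_coef_gt (k n : nat) : (n < k)%nat -> leg_coef k n = 0.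
Proof. intros H. unfold leg_coef. apply Nat.leb_gt in H. rewrite H. reflexivity. Qed.

Lemma leg_coef_odd (k n j : nat) : n = (k + S (2 * j))%nat -> leg_coef k n = 0.
Proof. intros ->. rewrite leg_coef_le by lia. apply legendre_coef_odd. Qed.

Lemma leg_coef_even (k n j : nat) : n = (k + 2 * j)%nat -> leg_coef k n =
  (-1) ^ j * rfact (2 * k + 2 * j)
   / (2 ^ (k + 2 * j) * rfact j * rfact (k + j) * rfact k).
Proof. intros ->. rewrite leg_coef_le by lia. apply legendre_coef_even. Qed.

(** Bonnet's recurrence, coefficient by coefficient.  The parity of [n + 2 - k]
    decides whether all three terms vanish; otherwise the closed form reduces the
    claim to an identity between polynomials in [k] and [j]. *)
Lemma leg_coef_bonnet (k n : nat) :
  (INR n + 2) * leg_coef k (S (S n)) =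
  (2 * INR n + 3) * (match k with O => 0 | S k' => leg_coef k' (S n) end)
  - (INR n + 1) * leg_coef k n.
Proof.
  destruct (Compare_dec.le_lt_dec k (S (S n))) as [H|H].
  2:{ rewrite !(leg_coef_gt k) by lia. destruct k as [|k]; [lia|].
      rewrite leg_coef_gt by lia. ring. }
  destruct (Nat.Even_or_Odd (S (S n) - k)) as [[j Hj]|[j Hj]].
  2:{ rewrite (leg_coef_odd k (S (S n)) j) by lia.
      assert (E : leg_coef k n = 0).
      { destruct j as [|j]; [apply leg_coef_gt; lia | apply (leg_coef_odd k n j); lia]. }
      rewrite E. destruct k as [|k]; [ring|].
      rewrite (leg_coef_odd k (S n) j) by lia. ring. }
  rewrite (leg_coef_even k (S (S n)) j) by lia.
  assert (En : INR n = INR k + 2 * INR j - 2).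
  { assert (E : (n + 2 = k + 2 * j)%nat) by lia.
    apply (f_equal INR) in E. rewrite !plus_INR, mult_INR in E. simpl in E. lra. }
  assert (P2 : forall i, 2 ^ i <> 0) by (intros; apply pow_nonzero; lra).
  destruct j as [|j].
  - rewrite (leg_coef_gt k n) by lia. destruct k as [|k]; [lia|].
    rewrite (leg_coef_even k (S n) 0) by lia.
    replace (2 * S k + 2 * 0)%nat with (S (S (2 * k))) by lia.
    replace (2 * k + 2 * 0)%nat with (2 * k)%nat by lia.
    replace (S k + 2 * 0)%nat with (S k) by lia. replace (S k + 0)%nat with (S k) by lia.
    replace (k + 2 * 0)%nat with k by lia. replace (k + 0)%nat with k by lia.
    rewrite En, !rfact_S, !S_INR, mult_INR. simpl. field.
    repeat split; try apply rfact_neq_0; try apply P2. pose proof (pos_INR k). lra.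
  - rewrite (leg_coef_even k n j) by lia. destruct k as [|k].
    + replace (2 * 0 + 2 * S j)%nat with (S (S (2 * j))) by lia.
      replace (0 + 2 * S j)%nat with (S (S (2 * j))) by lia.
      replace (0 + S j)%nat with (S j) by lia.
      replace (2 * 0 + 2 * j)%nat with (2 * j)%nat by lia.
      replace (0 + 2 * j)%nat with (2 * j)%nat by lia. replace (0 + j)%nat with j by lia.
      rewrite En, !rfact_S, !S_INR, mult_INR. simpl. field.
      repeat split; try apply rfact_neq_0; try apply P2. pose proof (pos_INR j). lra.
    + rewrite (leg_coef_even k (S n) (S j)) by lia.
      replace (2 * S k + 2 * S j)%nat with (S (S (S (S (2 * k + 2 * j))))) by lia.
      replace (S k + 2 * S j)%nat with (S (S (S (k + 2 * j)))) by lia.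
      replace (S k + S j)%nat with (S (S (k + j))) by lia.
      replace (2 * k + 2 * S j)%nat with (S (S (2 * k + 2 * j))) by lia.
      replace (k + 2 * S j)%nat with (S (S (k + 2 * j))) by lia.
      replace (k + S j)%nat with (S (k + j)) by lia.
      replace (2 * S k + 2 * j)%nat with (S (S (2 * k + 2 * j))) by lia.
      replace (S k + 2 * j)%nat with (S (k + 2 * j)) by lia.
      replace (S k + j)%nat with (S (k + j)) by lia.
      rewrite En, !rfact_S, !S_INR, !plus_INR, !mult_INR. simpl. field.
      pose proof (pos_INR j). pose proof (pos_INR k).
      repeat split; try apply rfact_neq_0; try apply P2; lra.
Qed.

(** The value on [P_n] of the linear form that sends [t^k] to [g k].  Evaluation at
    a point and the derivative at 1 are both of this kind, so that one
    recurrence serves for both. *)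
Definition leg_form (g : nat -> R) (n : nat) : R :=
  sum_f_R0 (fun k => leg_coef k n * g k) n.

Lemma leg_form_extend (g : nat -> R) (n M : nat) : (n <= M)%nat ->
  sum_f_R0 (fun k => leg_coef k n * g k) M = leg_form g n.
Proof.
  intros H. induction H as [|M H IH]; [reflexivity|].
  simpl. rewrite IH, leg_coef_gt by lia. ring.
Qed.

Lemma leg_form_bonnet (g : nat -> R) (n : nat) :
  (INR n + 2) * leg_form g (S (S n)) =
  (2 * INR n + 3) * leg_form (fun k => g (S k)) (S n) - (INR n + 1) * leg_form g n.
Proof.
  rewrite <- (leg_form_extend g n (S (S n))) by lia.
  unfold leg_form at 1 2. rewrite !scal_sum.
  rewrite (sum_eq _ (fun k => (2 * INR n + 3) * ((match k with O => 0 | S k' => leg_coef k' (S n) end) * g k)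
    - leg_coef k n * g k * (INR n + 1))).
  - rewrite minus_sum. f_equal. rewrite (decomp_sum _ (S (S n))) by lia.
    simpl pred. cbv beta iota. rewrite Rmult_0_l, Rmult_0_r, Rplus_0_l.
    apply sum_eq. intros; ring.
  - intros k _. pose proof (leg_coef_bonnet k n) as E.
    replace (leg_coef k (S (S n)) * g k * (INR n + 2))
      with ((INR n + 2) * leg_coef k (S (S n)) * g k) by ring.
    rewrite E. ring.
Qed.

Definition leg (n : nat) (t : R) : R := leg_form (fun k => t ^ k) n.

Lemma leg_form_0 (g : nat -> R) : leg_form g 0 = g 0%nat.
Proof.
  unfold leg_form. simpl. rewrite (leg_coef_even 0 0 0) by lia. simpl. field.
Qed.

Lemma leg_form_1 (g : nat -> R) : leg_form g 1 = g 1%nat.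
Proof.
  unfold leg_form. simpl. rewrite (leg_coef_even 1 1 0), (leg_coef_odd 0 1 0) by lia.
  simpl. field.
Qed.

Lemma leg_form_scal (c : R) (g : nat -> R) (n : nat) :
  leg_form (fun k => c * g k) n = c * leg_form g n.
Proof. unfold leg_form. rewrite scal_sum. apply sum_eq. intros; ring. Qed.

Lemma leg_bonnet (n : nat) (t : R) :
  (INR n + 2) * leg (S (S n)) t =
  (2 * INR n + 3) * (t * leg (S n) t) - (INR n + 1) * leg n t.
Proof.
  unfold leg at 1. rewrite leg_form_bonnet.
  replace (leg_form (fun k => t ^ S k) (S n)) with (t * leg (S n) t).
  - reflexivity.
  - unfold leg. rewrite <- leg_form_scal. reflexivity.
Qed.

Lemma two_step_ind (P : nat -> Prop) :
  P 0%nat -> P 1%nat -> (forall n, P n -> P (S n) -> P (S (S n))) -> forall n, P n.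
Proof.
  intros H0 H1 HS n. assert (H : P n /\ P (S n)); [|apply H].
  induction n as [|n [IH1 IH2]]; auto.
Qed.

Lemma leg_1 (n : nat) : leg n 1 = 1.
Proof.
  induction n as [| |n IH1 IH2] using two_step_ind.
  - unfold leg. rewrite leg_form_0. reflexivity.
  - unfold leg. rewrite leg_form_1. ring.
  - pose proof (leg_bonnet n 1) as E. rewrite IH1, IH2 in E.
    pose proof (pos_INR n). apply (Rmult_eq_reg_l (INR n + 2)); lra.
Qed.

(** This is [P_n'(1)]: differentiation at 1 sends [t^k] to [k]. *)
Lemma leg_deriv_1 (n : nat) : leg_form INR n = INR n * (INR n + 1) / 2.
Proof.
  induction n as [| |n IH1 IH2] using two_step_ind.
  - rewrite leg_form_0. simpl. field.
  - rewrite leg_form_1. simpl. field.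
  - pose proof (leg_form_bonnet INR n) as E.
    assert (E2 : leg_form (fun k => INR (S k)) (S n) = leg_form INR (S n) + leg (S n) 1).
    { unfold leg, leg_form. rewrite <- plus_sum. apply sum_eq. intros k _.
      rewrite S_INR, pow1. ring. }
    rewrite E2, leg_1, IH1, IH2, S_INR in E. rewrite !S_INR.
    pose proof (pos_INR n). apply (Rmult_eq_reg_l (INR n + 2)); [|lra].
    rewrite E. field.
Qed.

(** A crude bound, sufficient because the coefficients that multiply it decay
    faster than any geometric sequence. *)
Lemma leg_bound (n : nat) (t : R) : Rabs t <= 1 -> Rabs (leg n t) <= 3 ^ n.
Proof.
  intros Ht. induction n as [| |n IH1 IH2] using two_step_ind.
  - unfold leg. rewrite leg_form_0. simpl. rewrite Rabs_R1. lra.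
  - unfold leg. rewrite leg_form_1. simpl. rewrite !Rmult_1_r. lra.
  - pose proof (pos_INR n) as Hn.
    apply (Rmult_le_reg_l (INR n + 2)); [lra|].
    rewrite <- (Rabs_pos_eq (INR n + 2)) at 1 by lra.
    rewrite <- Rabs_mult, leg_bonnet.
    eapply Rle_trans; [apply Rabs_triang|].
    rewrite Rabs_Ropp, !Rabs_mult, !Rabs_pos_eq by lra.
    assert (0 <= 3 ^ n) by (apply pow_le; lra).
    assert (Rabs t * Rabs (leg (S n) t) <= 1 * 3 ^ S n)
      by (apply Rmult_le_compat; auto using Rabs_pos).
    simpl pow in *.
    assert ((2 * INR n + 3) * (Rabs t * Rabs (leg (S n) t)) <= (2 * INR n + 3) * (3 * 3 ^ n))
      by (apply Rmult_le_compat_l; lra).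
    assert ((INR n + 1) * Rabs (leg n t) <= (INR n + 1) * 3 ^ n)
      by (apply Rmult_le_compat_l; lra).
    assert (0 <= INR n * 3 ^ n) by (apply Rmult_le_pos; assumption). 
    rewrite (Rabs_pos_eq (INR n + 1)) by lra. lra.
Qed.

(** The coefficient of [P_n] in the expansion of [t^(n+2m)]. *)
Definition expand_coef (n m : nat) : R :=
  (2 * INR n + 1) * 2 ^ n * rfact (n + m) * rfact (n + 2 * m)
   / (rfact (2 * n + 2 * m + 1) * rfact m).

(** The coefficient of [P_n] in the expansion of [t^M], for arbitrary [M] and [n]. *)
Definition expand_coef_at (M n : nat) : R :=
  if andb (Nat.leb n M) (Nat.even (M - n)) then expand_coef n (Nat.div (M - n) 2) else 0.

Lemma expand_coef_at_even (M n m : nat) : M = (n + 2 * m)%nat -> expand_coef_at M n = expand_coef n m.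
Proof.
  intros ->. unfold expand_coef_at. replace (n + 2 * m - n)%nat with (2 * m)%nat by lia.
  replace (Nat.leb n (n + 2 * m)) with true by (symmetry; apply Nat.leb_le; lia).
  replace (Nat.even (2 * m)) with true
    by (symmetry; apply Nat.even_spec; exists m; reflexivity).
  simpl andb. cbv iota. f_equal. rewrite Nat.mul_comm, Nat.div_mul; lia.
Qed.

Lemma expand_coef_at_gt (M n : nat) : (M < n)%nat -> expand_coef_at M n = 0.
Proof.
  intros H. unfold expand_coef_at. apply Nat.leb_gt in H. rewrite H. reflexivity.
Qed.

Lemma expand_coef_at_odd (M n m : nat) : M = (n + S (2 * m))%nat -> expand_coef_at M n = 0.
Proof.
  intros ->. unfold expand_coef_at. replace (n + S (2 * m) - n)%nat with (S (2 * m)) by lia.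
  rewrite Nat.even_succ, Nat.odd_mul, Bool.andb_false_r. reflexivity.
Qed.

Lemma expand_coef_at_nonneg (M n : nat) : 0 <= expand_coef_at M n.
Proof.
  unfold expand_coef_at. destruct (andb _ _); [|lra]. unfold expand_coef.
  pose proof (pos_INR n).
  apply Rdiv_le_0_compat.
  - repeat apply Rmult_le_pos; try apply pos_INR; try lra. apply pow_le; lra.
  - apply Rmult_lt_0_compat; apply INR_fact_lt_0.
Qed.

Lemma expand_coef_rec_0 (m : nat) : expand_coef 0 (S m) = expand_coef 1 m / 3.
Proof.
  unfold expand_coef.
  replace (0 + 2 * S m)%nat with (S (S (2 * m))) by lia.
  replace (0 + S m)%nat with (S m) by lia.
  replace (2 * 0 + 2 * S m + 1)%nat with (S (S (S (2 * m)))) by lia.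
  replace (1 + m)%nat with (S m) by lia. replace (1 + 2 * m)%nat with (S (2 * m)) by lia.
  replace (2 * 1 + 2 * m + 1)%nat with (S (S (S (2 * m)))) by lia.
  rewrite !rfact_S, !S_INR, !mult_INR. simpl. field.
  pose proof (pos_INR m). repeat split; try apply rfact_neq_0; lra.
Qed.

Lemma expand_coef_rec_S0 (n : nat) :
  expand_coef (S n) 0 = expand_coef n 0 * (INR n + 1) / (2 * INR n + 1).
Proof.
  unfold expand_coef.
  replace (2 * S n + 2 * 0 + 1)%nat with (S (S (S (2 * n)))) by lia.
  replace (2 * n + 2 * 0 + 1)%nat with (S (2 * n)) by lia.
  replace (S n + 0)%nat with (S n) by lia. replace (n + 0)%nat with n by lia.
  replace (S n + 2 * 0)%nat with (S n) by lia. replace (n + 2 * 0)%nat with n by lia.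
  rewrite !rfact_S, !S_INR, !mult_INR. simpl. field.
  pose proof (pos_INR n). repeat split; try apply rfact_neq_0; lra.
Qed.

Lemma expand_coef_rec_SS (n m : nat) :
  expand_coef (S n) (S m) = expand_coef n (S m) * (INR n + 1) / (2 * INR n + 1)
    + expand_coef (S (S n)) m * (INR n + 2) / (2 * INR n + 5).
Proof.
  unfold expand_coef.
  replace (2 * S n + 2 * S m + 1)%nat with (S (S (S (S (S (2 * n + 2 * m)))))) by lia.
  replace (2 * n + 2 * S m + 1)%nat with (S (S (S (2 * n + 2 * m)))) by lia.
  replace (2 * S (S n) + 2 * m + 1)%nat with (S (S (S (S (S (2 * n + 2 * m)))))) by lia.
  replace (S n + S m)%nat with (S (S (n + m))) by lia.
  replace (n + S m)%nat with (S (n + m)) by lia.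
  replace (S (S n) + m)%nat with (S (S (n + m))) by lia.
  replace (S n + 2 * S m)%nat with (S (S (S (n + 2 * m)))) by lia.
  replace (n + 2 * S m)%nat with (S (S (n + 2 * m))) by lia.
  replace (S (S n) + 2 * m)%nat with (S (S (n + 2 * m))) by lia.
  rewrite !rfact_S, !S_INR, !plus_INR, !mult_INR. simpl. field.
  pose proof (pos_INR m). pose proof (pos_INR n).
  repeat split; try apply rfact_neq_0; lra.
Qed.

Lemma expand_coef_at_rec_0 (M : nat) : expand_coef_at (S M) 0 = expand_coef_at M 1 / 3.
Proof.
  destruct (Nat.Even_or_Odd (S M)) as [[m Hm]|[m Hm]].
  - destruct m as [|m]; [lia|].
    rewrite (expand_coef_at_even (S M) 0 (S m)), (expand_coef_at_even M 1 m) by lia. apply expand_coef_rec_0.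
  - rewrite (expand_coef_at_odd (S M) 0 m) by lia.
    destruct m as [|m]; [rewrite expand_coef_at_gt by lia | rewrite (expand_coef_at_odd M 1 m) by lia]; field.
Qed.

(** Multiplication by [t] acts on Legendre expansions through Bonnet's recurrence. *)
Lemma expand_coef_at_rec_S (M n : nat) :
  expand_coef_at (S M) (S n) = expand_coef_at M n * (INR n + 1) / (2 * INR n + 1)
    + expand_coef_at M (S (S n)) * (INR n + 2) / (2 * INR n + 5).
Proof.
  pose proof (pos_INR n) as Hn.
  destruct (Compare_dec.le_lt_dec n M) as [H|H].
  2:{ rewrite !expand_coef_at_gt by lia. field. split; lra. }
  destruct (Nat.Even_or_Odd (M - n)) as [[m Hm]|[m Hm]].
  - rewrite (expand_coef_at_even (S M) (S n) m), (expand_coef_at_even M n m) by lia.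
    destruct m as [|m].
    + rewrite expand_coef_at_gt, expand_coef_rec_S0 by lia. field. split; lra.
    + rewrite (expand_coef_at_even M (S (S n)) m) by lia. apply expand_coef_rec_SS.
  - rewrite (expand_coef_at_odd (S M) (S n) m), (expand_coef_at_odd M n m) by lia.
    destruct m as [|m]; [rewrite expand_coef_at_gt by lia | rewrite (expand_coef_at_odd M (S (S n)) m) by lia];
      field; split; lra.
Qed.

Lemma sum_shift (g : nat -> R) (M : nat) :
  sum_f_R0 g (S M) = g 0%nat + sum_f_R0 (fun n => g (S n)) M.
Proof. rewrite decomp_sum by lia. reflexivity. Qed.

Lemma leg_bonnet_0 (t : R) : t * leg 0 t = leg 1 t.
Proof. unfold leg. rewrite leg_form_0, leg_form_1. simpl. ring. Qed.

Lemma pow_expansion' (M : nat) (t : R) :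
  t ^ M = sum_f_R0 (fun n => expand_coef_at M n * leg n t) M.
Proof.
  induction M as [|M IH].
  - simpl. rewrite (expand_coef_at_even 0 0 0) by lia. unfold leg. rewrite leg_form_0.
    unfold expand_coef. simpl. field.
  - simpl pow. rewrite IH.
    (* t P_n is replaced by ((n+1) P_(n+1) + n P_(n-1)) / (2n+1); for n = 0 the
       second term has the factor 0, which makes the index pred n harmless *)
    assert (E1 : t * sum_f_R0 (fun n => expand_coef_at M n * leg n t) M =
      sum_f_R0 (fun n => expand_coef_at M n * (INR n + 1) / (2 * INR n + 1) * leg (S n) t) M
      + sum_f_R0 (fun n => expand_coef_at M n * INR n / (2 * INR n + 1) * leg (pred n) t) M).
    { rewrite scal_sum, <- plus_sum. apply sum_eq. intros n _.
      pose proof (pos_INR n).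
      destruct n as [|n].
      - replace (expand_coef_at M 0 * leg 0 t * t) with (expand_coef_at M 0 * (t * leg 0 t)) by ring.
        rewrite leg_bonnet_0. simpl. field.
      - simpl pred. rewrite S_INR.
        assert (E : t * leg (S n) t
          = ((INR n + 2) * leg (S (S n)) t + (INR n + 1) * leg n t) / (2 * INR n + 3)).
        { rewrite leg_bonnet. field. rewrite S_INR in H. lra. }
        replace (expand_coef_at M (S n) * leg (S n) t * t)
          with (expand_coef_at M (S n) * (t * leg (S n) t)) by ring.
        rewrite E. field. rewrite S_INR in H. lra. }
    rewrite E1.
    assert (E2 : sum_f_R0 (fun n => expand_coef_at M n * INR n / (2 * INR n + 1) * leg (pred n) t) M
      = sum_f_R0 (fun n => expand_coef_at M (S n) * (INR n + 1) / (2 * INR n + 3) * leg n t) (S M)).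
    { transitivity (sum_f_R0 (fun n => expand_coef_at M n * INR n / (2 * INR n + 1) * leg (pred n) t)
        (S (S M))).
      - simpl sum_f_R0. rewrite !(expand_coef_at_gt M) by lia.
        unfold Rdiv. ring.
      - rewrite sum_shift. simpl (INR 0). rewrite Rmult_0_r. unfold Rdiv at 1.
        rewrite !Rmult_0_l, Rplus_0_l. apply sum_eq. intros n _. simpl pred.
        rewrite S_INR. pose proof (pos_INR n). field. lra. }
    rewrite E2, !(sum_shift _ M), expand_coef_at_rec_0. simpl (INR 0).
    replace (sum_f_R0 (fun n => expand_coef_at (S M) (S n) * leg (S n) t) M) with
      (sum_f_R0 (fun n => expand_coef_at M n * (INR n + 1) / (2 * INR n + 1) * leg (S n) t) M
       + sum_f_R0 (fun n => expand_coef_at M (S (S n)) * (INR (S n) + 1) / (2 * INR (S n) + 3)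
            * leg (S n) t) M).
    + field.
    + rewrite <- plus_sum. apply sum_eq. intros n _.
      rewrite expand_coef_at_rec_S, !S_INR.
      pose proof (pos_INR n). field. split; lra.
Qed.

Lemma expand_coef_nonneg (n m : nat) : 0 <= expand_coef n m.
Proof. rewrite <- (expand_coef_at_even (n + 2 * m) n m) by reflexivity. apply expand_coef_at_nonneg. Qed.

(** The coefficients are nonnegative and add up to the value 1 of the power at 1. *)
Lemma expand_coef_le_1 (n m : nat) : expand_coef n m <= 1.
Proof.
  rewrite <- (expand_coef_at_even (n + 2 * m) n m) by reflexivity.
  set (M := (n + 2 * m)%nat).
  assert (E := pow_expansion' M 1). rewrite pow1 in E. rewrite E.
  assert (H : forall N, (n <= N)%nat -> expand_coef_at M n <= sum_f_R0 (fun k => expand_coef_at M k * leg k 1) N).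
  { assert (P : forall k, 0 <= expand_coef_at M k * leg k 1).
    { intros k. rewrite leg_1, Rmult_1_r. apply expand_coef_at_nonneg. }
    intros N HN. induction HN as [|N HN IH].
    - destruct n as [|n']; simpl; rewrite leg_1; [lra|].
      pose proof (cond_pos_sum _ n' P). lra.
    - simpl. pose proof (P (S N)). lra. }
  apply H. unfold M. lia.
Qed.

(** The expansion of a power of parity [p] contains only Legendre polynomials of
    that parity; this is the corresponding change of index. *)
Lemma sum_parity (g : nat -> R) (p m : nat) : (p <= 1)%nat ->
  (forall j, Nat.Odd (j + p) -> g j = 0) ->
  sum_f_R0 g (2 * m + p) = sum_f_R0 (fun n => g (2 * n + p)%nat) m.
Proof.
  intros Hp Hg. induction m as [|m IH].
  - destruct p as [|[|p]]; [reflexivity| |lia].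
    simpl. rewrite Hg by (exists 0%nat; reflexivity). ring.
  - replace (2 * S m + p)%nat with (S (S (2 * m + p))) by lia.
    rewrite !tech5, IH, (Hg (S (2 * m + p))) by (exists (m + p)%nat; lia).
    replace (2 * S m + p)%nat with (S (S (2 * m + p))) by lia. ring.
Qed.

Lemma pow_expansion (p m : nat) (t : R) : (p <= 1)%nat ->
  t ^ (2 * m + p) =
  sum_f_R0 (fun n => expand_coef (2 * n + p) (m - n) * leg (2 * n + p) t) m.
Proof.
  intros Hp. rewrite pow_expansion', (sum_parity _ p m Hp).
  - apply sum_eq. intros n Hn.
    rewrite (expand_coef_at_even (2 * m + p) (2 * n + p) (m - n)) by lia. reflexivity.
  - intros j [i Hi]. destruct (Compare_dec.le_lt_dec j (2 * m + p)) as [H|H].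
    + rewrite (expand_coef_at_odd _ j (m + p - i - 1)) by lia. ring.
    + rewrite expand_coef_at_gt by lia. ring.
Qed.

Open Scope C_scope.

(** * Calculus of complex-valued functions of real variables *)

Notation Ccont g x := (@continuous R_UniformSpace C_UniformSpace g x).
Definition is_Cderive (u : R -> C) (x : R) (l : C) : Prop :=
  @is_derive R_AbsRing C_R_NormedModule u x l.

Lemma ex_derive_continuous_R (g : R -> R) (x : R) : ex_derive g x -> continuous g x.
Proof. exact (ex_derive_continuous (K := R_AbsRing) (V := R_NormedModule) g x). Qed.

Lemma ex_RInt_continuous_R (g : R -> R) (a c : R) :
  (forall x, (Rmin a c <= x <= Rmax a c)%R -> continuous g x) -> ex_RInt g a c.
Proof. exact (ex_RInt_continuous (V := R_CompleteNormedModule) g a c). Qed.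

Lemma RtoC_neq_0 (x : R) : x <> 0%R -> RtoC x <> 0.
Proof. intros H E. apply H, RtoC_inj, E. Qed.

Lemma exp_le (x y : R) : (x <= y)%R -> (exp x <= exp y)%R.
Proof. intros [H|<-]; [left; apply exp_increasing, H | apply Rle_refl]. Qed.

Lemma continuous_pair {T : UniformSpace} (u : T -> C) (x : T) :
  continuous (fun y => Re (u y)) x -> continuous (fun y => Im (u y)) x ->
  @continuous T C_UniformSpace u x.
Proof.
  intros H1 H2 P [eps HP].
  assert (K1 := H1 (ball (Re (u x)) eps) (locally_ball _ eps)).
  assert (K2 := H2 (ball (Im (u x)) eps) (locally_ball _ eps)).
  unfold filtermap in *.
  generalize (filter_and _ _ K1 K2). apply filter_imp.
  intros y [Y1 Y2]. apply HP. split; assumption.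
Qed.

Lemma continuous_Re {T : UniformSpace} (u : T -> C) (x : T) :
  @continuous T C_UniformSpace u x -> continuous (fun y => Re (u y)) x.
Proof. intros H. apply (continuous_comp u Re x H). apply continuous_fst. Qed.

Lemma continuous_Im {T : UniformSpace} (u : T -> C) (x : T) :
  @continuous T C_UniformSpace u x -> continuous (fun y => Im (u y)) x.
Proof. intros H. apply (continuous_comp u Im x H). apply continuous_snd. Qed.

Lemma continuous_Cplus {T : UniformSpace} (u v : T -> C) (x : T) :
  @continuous T C_UniformSpace u x -> @continuous T C_UniformSpace v x ->
  @continuous T C_UniformSpace (fun y => u y + v y) x.
Proof.
  exact (@continuous_plus T R_AbsRing C_R_NormedModule u v x).
Qed.

Lemma continuous_Copp {T : UniformSpace} (u : T -> C) (x : T) :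
  @continuous T C_UniformSpace u x ->
  @continuous T C_UniformSpace (fun y => - u y) x.
Proof. exact (@continuous_opp T R_AbsRing C_R_NormedModule u x). Qed.

Lemma continuous_Cminus {T : UniformSpace} (u v : T -> C) (x : T) :
  @continuous T C_UniformSpace u x -> @continuous T C_UniformSpace v x ->
  @continuous T C_UniformSpace (fun y => u y - v y) x.
Proof.
  intros Hu Hv. apply continuous_Cplus; [|apply continuous_Copp]; assumption.
Qed.

Lemma continuous_Cmult {T : UniformSpace} (u v : T -> C) (x : T) :
  @continuous T C_UniformSpace u x -> @continuous T C_UniformSpace v x ->
  @continuous T C_UniformSpace (fun y => u y * v y) x.
Proof.
  intros Hu Hv.
  pose proof (continuous_Re _ _ Hu). pose proof (continuous_Im _ _ Hu).
  pose proof (continuous_Re _ _ Hv). pose proof (continuous_Im _ _ Hv).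
  apply continuous_pair.
  - apply (continuous_minus (V := R_NormedModule)
      (fun y => Re (u y) * Re (v y))%R (fun y => Im (u y) * Im (v y))%R);
      apply (continuous_mult (K := R_AbsRing)); assumption.
  - apply (continuous_plus (V := R_NormedModule)
      (fun y => Re (u y) * Im (v y))%R (fun y => Im (u y) * Re (v y))%R);
      apply (continuous_mult (K := R_AbsRing)); assumption.
Qed.

Lemma continuous_RtoC {T : UniformSpace} (u : T -> R) (x : T) :
  continuous u x -> @continuous T C_UniformSpace (fun y => RtoC (u y)) x.
Proof.
  intros H. apply continuous_pair; simpl.
  - exact H.
  - apply continuous_const.
Qed.

Lemma continuous_Cpow {T : UniformSpace} (u : T -> C) (n : nat) (x : T) :
  @continuous T C_UniformSpace u x ->
  @continuous T C_UniformSpace (fun y => u y ^ n) x.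
Proof.
  intros H. induction n as [|n IH]; simpl.
  - apply continuous_const.
  - apply continuous_Cmult; assumption.
Qed.

Lemma continuous_Cinv {T : UniformSpace} (u : T -> C) (x : T) :
  @continuous T C_UniformSpace u x -> u x <> 0 ->
  @continuous T C_UniformSpace (fun y => / u y) x.
Proof.
  intros H H0.
  pose proof (continuous_Re _ _ H) as H1. pose proof (continuous_Im _ _ H) as H2.
  assert (N : (Re (u x) ^ 2 + Im (u x) ^ 2)%R <> 0%R).
  { intros E. apply H0.
    assert (Re (u x) = 0%R) by nra. assert (Im (u x) = 0%R) by nra.
    apply injective_projections; assumption. }
  assert (D : continuous (fun y => Re (u y) ^ 2 + Im (u y) ^ 2)%R x).
  { simpl. apply (continuous_plus (V := R_NormedModule));
    (apply (continuous_mult (K := R_AbsRing));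
      [assumption | apply (continuous_mult (K := R_AbsRing));
        [assumption | apply continuous_const]]). }
  assert (D' := continuous_comp _ Rinv x D (continuous_Rinv _ N)).
  apply continuous_pair; unfold Cinv; simpl.
  - apply (continuous_mult (K := R_AbsRing)); assumption.
  - apply (continuous_mult (K := R_AbsRing)); [|assumption].
    apply (continuous_opp (V := R_NormedModule)); assumption.
Qed.

Lemma is_Cderive_pair (u : R -> C) (x : R) (l : C) :
  is_derive (fun y => Re (u y)) x (Re l) ->
  is_derive (fun y => Im (u y)) x (Im l) -> is_Cderive u x l.
Proof.
  intros H1 H2.
  apply (is_derive_ext (fun y => plus
     (scal (Re (u y)) ((1, 0)%R : C_R_NormedModule))
     (scal (Im (u y)) ((0, 1)%R : C_R_NormedModule)))).
  { intros t. apply injective_projections; cbn; unfold mult, Re, Im; simpl; ring. }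
  replace l with (plus
     (scal (Re l) ((1, 0)%R : C_R_NormedModule))
     (scal (Im l) ((0, 1)%R : C_R_NormedModule)) : C)
   by (apply injective_projections; cbn; unfold mult, Re, Im; simpl; ring).
  apply (is_derive_plus (V := C_R_NormedModule)).
  - apply (is_derive_scal_l (V := C_R_NormedModule)); exact H1.
  - apply (is_derive_scal_l (V := C_R_NormedModule)); exact H2.
Qed.

Lemma is_Cderive_Re (u : R -> C) (x : R) (l : C) :
  is_Cderive u x l -> is_derive (fun y => Re (u y)) x (Re l).
Proof.
  intros H.
  apply (filterdiff_comp (K := R_AbsRing) (U := R_NormedModule)
    (V := C_R_NormedModule) (W := R_NormedModule) u (fun z : C => fst z)
    (fun y : R => scal y l) (fun z : C => fst z)); [exact H|].
  apply filterdiff_linear, is_linear_fst.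
Qed.

Lemma is_Cderive_Im (u : R -> C) (x : R) (l : C) :
  is_Cderive u x l -> is_derive (fun y => Im (u y)) x (Im l).
Proof.
  intros H.
  apply (filterdiff_comp (K := R_AbsRing) (U := R_NormedModule)
    (V := C_R_NormedModule) (W := R_NormedModule) u (fun z : C => snd z)
    (fun y : R => scal y l) (fun z : C => snd z)); [exact H|].
  apply filterdiff_linear, is_linear_snd.
Qed.

Lemma is_Cderive_continuous (u : R -> C) (x : R) (l : C) :
  is_Cderive u x l -> Ccont u x.
Proof.
  intros H. apply (ex_derive_continuous (V := C_R_NormedModule)).
  exists l. exact H.
Qed.

Lemma is_Cderive_const (c : C) (x : R) : is_Cderive (fun _ => c) x 0.
Proof. exact (is_derive_const (V := C_R_NormedModule) c x). Qed.

Lemma is_Cderive_plus (u v : R -> C) (x : R) (l m : C) :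
  is_Cderive u x l -> is_Cderive v x m ->
  is_Cderive (fun y => u y + v y) x (l + m).
Proof.
  exact (is_derive_plus (V := C_R_NormedModule) u v x l m).
Qed.

Lemma is_Cderive_minus (u v : R -> C) (x : R) (l m : C) :
  is_Cderive u x l -> is_Cderive v x m ->
  is_Cderive (fun y => u y - v y) x (l - m).
Proof.
  exact (is_derive_minus (V := C_R_NormedModule) u v x l m).
Qed.

Lemma is_Cderive_mult (u v : R -> C) (x : R) (l m : C) :
  is_Cderive u x l -> is_Cderive v x m ->
  is_Cderive (fun y => u y * v y) x (l * v x + u x * m).
Proof.
  intros Hu Hv.
  pose proof (is_Cderive_Re _ _ _ Hu). pose proof (is_Cderive_Im _ _ _ Hu).
  pose proof (is_Cderive_Re _ _ _ Hv). pose proof (is_Cderive_Im _ _ _ Hv).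
  apply is_Cderive_pair.
  - replace (Re (l * v x + u x * m)) with
      ((Re l * Re (v x) + Re (u x) * Re m) - (Im l * Im (v x) + Im (u x) * Im m))%R
      by (unfold Re, Im; cbn; ring).
    apply (is_derive_minus (K := R_AbsRing) (V := R_NormedModule)
      (fun y => Re (u y) * Re (v y))%R (fun y => Im (u y) * Im (v y))%R);
      apply (is_derive_mult (K := R_AbsRing)); auto; intros; apply Rmult_comm.
  - replace (Im (l * v x + u x * m)) with
      ((Re l * Im (v x) + Re (u x) * Im m) + (Im l * Re (v x) + Im (u x) * Re m))%R
      by (unfold Re, Im; cbn; ring).
    apply (is_derive_plus (K := R_AbsRing) (V := R_NormedModule)
      (fun y => Re (u y) * Im (v y))%R (fun y => Im (u y) * Re (v y))%R);
      apply (is_derive_mult (K := R_AbsRing)); auto; intros; apply Rmult_comm.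
Qed.

Lemma is_Cderive_scal (c : C) (u : R -> C) (x : R) (l : C) :
  is_Cderive u x l -> is_Cderive (fun y => c * u y) x (c * l).
Proof.
  intros H. replace (c * l) with (0 * u x + c * l) by ring.
  apply (is_Cderive_mult (fun _ => c)); [apply is_Cderive_const | exact H].
Qed.

Lemma is_Cderive_RtoC (u : R -> R) (x l : R) :
  is_derive u x l -> is_Cderive (fun y => RtoC (u y)) x (RtoC l).
Proof.
  intros H. apply is_Cderive_pair; simpl; [exact H|].
  exact (is_derive_const (K := R_AbsRing) (V := R_NormedModule) 0%R x).
Qed.

Lemma is_Cderive_comp (u : R -> C) (a : R -> R) (x da : R) (l : C) :
  is_Cderive u (a x) l -> is_derive a x da ->
  is_Cderive (fun y => u (a y)) x (da * l).
Proof.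
  intros Hu Ha.
  replace (da * l) with (scal da (l : C_R_NormedModule) : C)
    by (apply injective_projections; cbn; unfold mult, Re, Im; simpl; ring).
  apply (is_derive_comp (V := C_R_NormedModule)); assumption.
Qed.

Lemma is_Cderive_pow (n : nat) (x : R) :
  is_Cderive (fun y => RtoC y ^ n) x (INR n * RtoC x ^ (pred n)).
Proof.
  induction n as [|n IH].
  - simpl Cpow. replace (RtoC (INR 0) * 1) with (RtoC 0) by (simpl; ring).
    apply is_Cderive_const.
  - replace (INR (S n) * RtoC x ^ pred (S n))
      with (1 * RtoC x ^ n + RtoC x * (INR n * RtoC x ^ pred n)).
    + simpl Cpow. apply is_Cderive_mult; [|exact IH].
      apply (is_Cderive_RtoC (fun y => y)), (is_derive_id (K := R_AbsRing)).
    + rewrite S_INR, RtoC_plus. destruct n; simpl; ring.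
Qed.

Lemma is_Cderive_zero_const (u : R -> C) (a c : R) :
  (a <= c)%R -> (forall t, (a <= t <= c)%R -> is_Cderive u t 0) -> u c = u a.
Proof.
  intros [H|<-] Hu; [|reflexivity].
  symmetry. exact (eq_is_derive (V := C_R_NormedModule) u a c Hu H).
Qed.

(** ** Integrals *)

Lemma ex_CInt (g : R -> C) (a c : R) :
  (forall x, Ccont g x) -> ex_RInt (V := C_R_CompleteNormedModule) g a c.
Proof.
  intros H. apply ex_RInt_continuous. intros z _. apply H.
Qed.

Lemma CInt_point (g : R -> C) (a : R) : CInt g a a = 0.
Proof. exact (RInt_point (V := C_R_CompleteNormedModule) a g). Qed.

Lemma CInt_ext (g k : R -> C) (a c : R) :
  (forall x, (Rmin a c < x < Rmax a c)%R -> g x = k x) -> CInt g a c = CInt k a c.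
Proof. exact (RInt_ext (V := C_R_CompleteNormedModule) g k a c). Qed.

Lemma CInt_plus (g k : R -> C) (a c : R) :
  (forall x, Ccont g x) -> (forall x, Ccont k x) ->
  CInt (fun x => g x + k x) a c = CInt g a c + CInt k a c.
Proof.
  intros Hg Hk.
  exact (RInt_plus (V := C_R_CompleteNormedModule) g k a c
    (ex_CInt g a c Hg) (ex_CInt k a c Hk)).
Qed.

Lemma CInt_minus (g k : R -> C) (a c : R) :
  (forall x, Ccont g x) -> (forall x, Ccont k x) ->
  CInt (fun x => g x - k x) a c = CInt g a c - CInt k a c.
Proof.
  intros Hg Hk.
  exact (RInt_minus (V := C_R_CompleteNormedModule) g k a c
    (ex_CInt g a c Hg) (ex_CInt k a c Hk)).
Qed.

Lemma CInt_Chasles (g : R -> C) (a c d : R) :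
  (forall x, Ccont g x) -> CInt g a c + CInt g c d = CInt g a d.
Proof.
  intros Hg.
  exact (RInt_Chasles (V := C_R_CompleteNormedModule) g a c d
    (ex_CInt g a c Hg) (ex_CInt g c d Hg)).
Qed.

Lemma CInt_opp_bounds (g : R -> C) (a c : R) :
  (forall x, Ccont g x) -> CInt g c a = - CInt g a c.
Proof.
  intros Hg. replace (- CInt g a c) with (CInt g c a - (CInt g a c + CInt g c a)) by ring.
  rewrite CInt_Chasles, CInt_point by exact Hg. ring.
Qed.

Lemma CInt_pair (g : R -> C) (a c : R) :
  (forall x, Ccont g x) ->
  CInt g a c = (RInt (fun x => Re (g x)) a c, RInt (fun x => Im (g x)) a c).
Proof.
  intros Hg. symmetry.
  apply (RInt_fct_extend_pair (U := R_NormedModule) (V := R_NormedModule)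
    (fun f a b => RInt f a b) (fun f a b => RInt f a b)).
  - intros. apply is_RInt_unique. assumption.
  - intros. apply is_RInt_unique. assumption.
  - apply (RInt_correct (V := C_R_CompleteNormedModule)). apply ex_CInt, Hg.
Qed.

Lemma is_Cderive_CInt (g : R -> C) (a x : R) :
  (forall y, Ccont g y) -> is_Cderive (fun y => CInt g a y) x (g x).
Proof.
  intros Hg.
  apply (is_derive_RInt (V := C_R_NormedModule) g (fun y => CInt g a y) a x).
  - apply filter_forall. intros y.
    apply (RInt_correct (V := C_R_CompleteNormedModule)). apply ex_CInt, Hg.
  - apply Hg.
Qed.

Lemma CInt_derive (u du : R -> C) (a c : R) :
  (forall x, is_Cderive u x (du x)) -> (forall x, Ccont du x) ->
  CInt du a c = u c - u a.
Proof.
  intros H1 H2.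
  apply (is_RInt_unique (V := C_R_CompleteNormedModule)).
  apply (is_RInt_derive (V := C_R_CompleteNormedModule) u du a c); intros; [apply H1 | apply H2].
Qed.

(** The scalar is complex, so this is not the linearity over the reals; both sides
    are antiderivatives of the same function. *)
Lemma CInt_scal (z : C) (g : R -> C) (a c : R) :
  (forall x, Ccont g x) -> CInt (fun x => z * g x) a c = z * CInt g a c.
Proof.
  intros Hg.
  replace (z * CInt g a c) with (z * CInt g a c - z * CInt g a a)
    by (rewrite CInt_point; ring).
  apply (CInt_derive (fun y => z * CInt g a y)).
  - intros x. apply is_Cderive_scal, is_Cderive_CInt, Hg.
  - intros x. apply continuous_Cmult; [apply continuous_const | apply Hg].
Qed.

Lemma CInt_affine (g : R -> C) (m p a c : R) :
  (forall x, Ccont g x) ->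
  CInt (fun s => m * g (m * s + p)%R) a c = CInt g (m * a + p) (m * c + p).
Proof.
  intros Hg.
  assert (E : CInt g (m * a + p) (m * c + p)
    = CInt g (m * a + p) (m * c + p) - CInt g (m * a + p) (m * a + p))
    by (rewrite CInt_point; ring).
  rewrite E.
  assert (D : forall x : R, is_derive (fun y : R => m * y + p)%R x m).
  { intros x. auto_derive; [exact I | ring]. }
  apply (CInt_derive (fun y => CInt g (m * a + p) (m * y + p))).
  - intros x. apply (is_Cderive_comp (fun y => CInt g (m * a + p) y)
      (fun y => m * y + p)%R); [apply is_Cderive_CInt, Hg | apply D].
  - intros x. apply continuous_Cmult; [apply continuous_const|].
    apply (continuous_comp (fun y => m * y + p)%R g); [|apply Hg].
    apply ex_derive_continuous_R.
    exists m. apply D.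
Qed.

Lemma Cmod_CInt_le (g : R -> C) (M a c : R) :
  (a <= c)%R -> (forall x, Ccont g x) ->
  (forall x, (a <= x <= c)%R -> (Cmod (g x) <= M)%R) ->
  (Cmod (CInt g a c) <= M * (c - a))%R.
Proof.
  intros Hac Hg HM.
  rewrite Cmod_norm.
  replace (M * (c - a))%R with (scal (c - a)%R M : R) by (cbn; unfold mult, Re, Im; simpl; ring).
  apply (norm_RInt_le (V := C_R_NormedModule) g (fun _ => M) a c).
  - exact Hac.
  - intros x Hx. rewrite <- Cmod_norm. apply HM, Hx.
  - apply (RInt_correct (V := C_R_CompleteNormedModule)). apply ex_CInt, Hg.
  - apply (is_RInt_const (V := R_NormedModule)).
Qed.

Lemma Cmod_CInt_le_fun (g : R -> C) (k : R -> R) (a c : R) (I : R) :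
  (a <= c)%R -> (forall x, Ccont g x) ->
  (forall x, (a <= x <= c)%R -> (Cmod (g x) <= k x)%R) ->
  is_RInt k a c I -> (Cmod (CInt g a c) <= I)%R.
Proof.
  intros Hac Hg HM HI.
  rewrite Cmod_norm.
  apply (norm_RInt_le (V := C_R_NormedModule) g k a c).
  - exact Hac.
  - intros x Hx. rewrite <- Cmod_norm. apply HM, Hx.
  - apply (RInt_correct (V := C_R_CompleteNormedModule)). apply ex_CInt, Hg.
  - exact HI.
Qed.

(** ** Integrals depending on a second variable *)

Definition joint_continuous (F : R -> R -> C) : Prop :=
  forall x t, @continuous (prod_UniformSpace R_UniformSpace R_UniformSpace)
    C_UniformSpace (fun p : R * R => F (fst p) (snd p)) (x, t).

Lemma joint_continuous_comp {T : UniformSpace} (F : R -> R -> C) (a c : T -> R) (x : T) :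
  joint_continuous F -> continuous a x -> continuous c x ->
  @continuous T C_UniformSpace (fun y => F (a y) (c y)) x.
Proof.
  intros HF Ha Hc.
  apply (continuous_comp_2 a c F x Ha Hc). apply HF.
Qed.

Lemma joint_continuous_Re (F : R -> R -> C) (x t : R) :
  joint_continuous F -> continuity_2d_pt (fun u v => Re (F u v)) x t.
Proof.
  intros H. apply continuity_2d_pt_filterlim.
  exact (continuous_Re _ _ (H x t)).
Qed.

Lemma joint_continuous_Im (F : R -> R -> C) (x t : R) :
  joint_continuous F -> continuity_2d_pt (fun u v => Im (F u v)) x t.
Proof.
  intros H. apply continuity_2d_pt_filterlim.
  exact (continuous_Im _ _ (H x t)).
Qed.

Lemma joint_continuous_r (F : R -> R -> C) (x t : R) : joint_continuous F -> Ccont (fun s => F x s) t.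
Proof.
  intros H. apply (joint_continuous_comp F (fun _ => x) (fun s => s)).
  - exact H.
  - apply continuous_const.
  - apply continuous_id.
Qed.

Lemma is_derive_RInt_param_bound_r (F dF : R -> R -> R) (c : R -> R) (x dc : R) :
  (forall x t, is_derive (fun y => F y t) x (dF x t)) ->
  (forall x t, continuity_2d_pt dF x t) ->
  (forall x t, continuous (fun s => F x s) t) ->
  is_derive c x dc ->
  is_derive (fun y => RInt (fun t => F y t) 0 (c y)) x
    (RInt (fun t => dF x t) 0 (c x) + dc * F x (c x))%R.
Proof.
  intros HD HC HF Hc.
  assert (E : forall y t, Derive (fun z => F z t) y = dF y t).
  { intros. apply is_derive_unique, HD. }
  assert (EI : forall y a d, ex_RInt (fun t => F y t) a d).
  { intros. apply ex_RInt_continuous_R. auto. }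
  assert (EC : forall x t,
     continuity_2d_pt (fun u v => Derive (fun z => F z v) u) x t).
  { intros. apply continuity_2d_pt_ext with dF; auto. }
  replace (RInt (fun t => dF x t) 0 (c x) + dc * F x (c x))%R with
    (RInt (fun t : R => Derive (fun u : R => F u t) x) 0 (c x)
      + - F x 0 * 0 + F x (c x) * dc)%R.
  2:{ rewrite (RInt_ext _ (fun t => dF x t)) by auto. ring. }
  apply (is_derive_RInt_param_bound_comp F (fun _ => 0%R) c x 0 dc).
  - apply filter_forall. intros. apply EI.
  - exists (mkposreal 1 Rlt_0_1). apply filter_forall. intros. apply EI.
  - exists (mkposreal 1 Rlt_0_1). apply filter_forall. intros. apply EI.
  - exact (is_derive_const (K := R_AbsRing) (V := R_NormedModule) 0%R x).
  - exact Hc.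
  - exists (mkposreal 1 Rlt_0_1). apply filter_forall. intros y t _. exists (dF y t). apply HD.
  - intros. apply EC.
  - exists (mkposreal 1 Rlt_0_1). intros. apply EC.
  - exists (mkposreal 1 Rlt_0_1). intros. apply EC.
  - apply continuity_pt_filterlim. apply HF.
  - apply continuity_pt_filterlim. apply HF.
Qed.

(** Leibniz' rule with a moving upper end, read off from the real case applied to
    the real and imaginary parts. *)
Lemma is_Cderive_CInt_param (F dF : R -> R -> C) (c : R -> R) (x dc : R) :
  (forall x t, is_Cderive (fun y => F y t) x (dF x t)) ->
  joint_continuous dF -> (forall x t, Ccont (fun s => F x s) t) ->
  is_derive c x dc ->
  is_Cderive (fun y => CInt (fun t => F y t) 0 (c y)) x
    (CInt (fun t => dF x t) 0 (c x) + dc * F x (c x)).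
Proof.
  intros HD HC HF Hc.
  apply is_Cderive_pair.
  - apply (is_derive_ext (fun y => RInt (fun t => Re (F y t)) 0 (c y))).
    { intros y. rewrite CInt_pair by auto. reflexivity. }
    replace (Re (CInt (fun t => dF x t) 0 (c x) + dc * F x (c x)))
      with (RInt (fun t => Re (dF x t)) 0 (c x) + dc * Re (F x (c x)))%R.
    + apply (is_derive_RInt_param_bound_r
        (fun y t => Re (F y t)) (fun y t => Re (dF y t))); auto.
      * intros. apply is_Cderive_Re, HD.
      * intros. apply joint_continuous_Re, HC.
      * intros. apply continuous_Re, HF.
    + rewrite CInt_pair by (intros; apply joint_continuous_r, HC). unfold Re, Im; cbn. ring.
  - apply (is_derive_ext (fun y => RInt (fun t => Im (F y t)) 0 (c y))).
    { intros y. rewrite CInt_pair by auto. reflexivity. }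
    replace (Im (CInt (fun t => dF x t) 0 (c x) + dc * F x (c x)))
      with (RInt (fun t => Im (dF x t)) 0 (c x) + dc * Im (F x (c x)))%R.
    + apply (is_derive_RInt_param_bound_r
        (fun y t => Im (F y t)) (fun y t => Im (dF y t))); auto.
      * intros. apply is_Cderive_Im, HD.
      * intros. apply joint_continuous_Im, HC.
      * intros. apply continuous_Im, HF.
    + rewrite CInt_pair by (intros; apply joint_continuous_r, HC). unfold Re, Im; cbn. ring.
Qed.

(** Uniform continuity on a rectangle controls the change of the integrand, the
    continuity of an antiderivative the change of the end point. *)
Lemma continuous_RInt_param_bound (F : R -> R -> R) (u0 v0 : R) :
  (forall x t, continuity_2d_pt F x t) ->
  continuity_2d_pt (fun u v => RInt (fun s => F s v) 0 u) u0 v0.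
Proof.
  intros HF eps.
  assert (HF1 : forall v s, continuous (fun s => F s v) s).
  { intros v s.
    apply (continuous_comp_2 (fun s => s) (fun _ => v) F).
    - apply continuous_id.
    - apply continuous_const.
    - apply continuity_2d_pt_filterlim, HF. }
  assert (EI : forall v a d, ex_RInt (fun s => F s v) a d).
  { intros. apply ex_RInt_continuous_R. auto. }
  set (A := (Rabs u0 + 1)%R).
  assert (HA : (0 < A)%R) by (unfold A; pose proof (Rabs_pos u0); lra).
  pose proof (cond_pos eps) as He.
  assert (He1 : (0 < eps / (2 * A))%R).
  { apply Rdiv_lt_0_compat; lra. }
  destruct (uniform_continuity_2d F (- A) A (v0 - 1) (v0 + 1)
     (fun x y _ _ => HF x y) (mkposreal _ He1)) as [d1 H1].
  assert (HC : continuous (fun u => RInt (fun s => F s v0) 0 u) u0).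
  { apply ex_derive_continuous_R.
    exists (F u0 v0).
    apply (is_derive_RInt (V := R_NormedModule) (fun s => F s v0) _ 0 u0).
    - apply filter_forall. intros u. apply (RInt_correct (V := R_CompleteNormedModule)), EI.
    - apply HF1. }
  destruct (HC (ball (RInt (fun s => F s v0) 0 u0) (mkposreal (eps/2) (is_pos_div_2 eps)))
              (locally_ball _ _)) as [d2 H2].
  set (d := Rmin (Rmin d1 d2) 1).
  assert (Hd : (0 < d)%R).
  { unfold d. pose proof (cond_pos d1). pose proof (cond_pos d2).
    repeat apply Rmin_pos; lra. }
  exists (mkposreal d Hd). simpl. intros u v Hu Hv.
  assert (L1 : (d <= d1)%R).
  { unfold d. eapply Rle_trans; [apply Rmin_l | apply Rmin_l]. }
  assert (L2 : (d <= d2)%R).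
  { unfold d. eapply Rle_trans; [apply Rmin_l | apply Rmin_r]. }
  assert (L3 : (d <= 1)%R) by apply Rmin_r.
  assert (Hu2 : (Rabs u <= A)%R).
  { unfold A. replace u with ((u - u0) + u0)%R by ring.
    eapply Rle_trans; [apply Rabs_triang | lra]. }
  assert (B2 : (Rabs (RInt (fun s => F s v0) 0 u - RInt (fun s => F s v0) 0 u0) < eps / 2)%R).
  { apply (H2 u). change (Rabs (u - u0) < d2)%R. lra. }
  assert (B1 : (Rabs (RInt (fun s => F s v) 0 u - RInt (fun s => F s v0) 0 u) <= eps / 2)%R).
  { replace (RInt (fun s => F s v) 0 u - RInt (fun s => F s v0) 0 u)%R
      with (RInt (fun s => F s v - F s v0)%R 0 u)
      by exact (RInt_minus (V := R_CompleteNormedModule) (fun s => F s v)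
           (fun s => F s v0) 0 u (EI v 0 u)%R (EI v0 0 u)%R).
    assert (E : forall a c, ex_RInt (fun s => F s v - F s v0)%R a c).
    { intros. apply (ex_RInt_minus (V := R_NormedModule)); apply EI. }
    assert (Hp : forall t, (Rabs t <= A)%R -> (Rabs (F t v - F t v0) <= eps / (2 * A))%R).
    { intros t Ht. apply Rabs_le_between in Ht.
      apply Rlt_le, (H1 t v0 t v); try lra.
      - apply Rabs_lt_between in Hv. lra.
      - rewrite Rminus_diag, Rabs_R0. apply cond_pos. }
    apply Rabs_le_between in Hu2.
    assert (Hf : (eps / 2 = A * (eps / (2 * A)))%R) by (field; lra).
    rewrite Hf.
    destruct (Rle_dec 0 u) as [P|P].
    - eapply Rle_trans; [apply abs_RInt_le_const with (M := (eps / (2*A))%R)|].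
      + exact P.
      + apply E.
      + intros t Ht. apply Hp. apply Rabs_le_between. lra.
      + apply Rmult_le_compat_r; lra.
    - rewrite <- (opp_RInt_swap (V := R_CompleteNormedModule)) by apply E.
      change (Rabs (- RInt (fun s => F s v - F s v0)%R u 0) <= A * (eps / (2 * A)))%R.
      rewrite Rabs_Ropp.
      eapply Rle_trans; [apply abs_RInt_le_const with (M := (eps / (2*A))%R)|].
      + lra.
      + apply E.
      + intros t Ht. apply Hp. apply Rabs_le_between. lra.
      + apply Rmult_le_compat_r; lra. }
  replace (RInt (fun s => F s v) 0 u - RInt (fun s => F s v0) 0 u0)%R with
    ((RInt (fun s => F s v) 0 u - RInt (fun s => F s v0) 0 u)
     + (RInt (fun s => F s v0) 0 u - RInt (fun s => F s v0) 0 u0))%R by ring.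
  eapply Rle_lt_trans; [apply Rabs_triang | lra].
Qed.

Lemma joint_continuous_swap (F : R -> R -> C) : joint_continuous F -> joint_continuous (fun x y => F y x).
Proof.
  intros H x y. apply (joint_continuous_comp F snd fst); auto.
  - apply continuous_snd.
  - apply continuous_fst.
Qed.

Lemma joint_continuous_l (F : R -> R -> C) (x t : R) : joint_continuous F -> Ccont (fun s => F s t) x.
Proof. intros H. apply (joint_continuous_r _ t x (joint_continuous_swap _ H)). Qed.

Lemma joint_continuous_CInt (F : R -> R -> C) :
  joint_continuous F -> joint_continuous (fun u v => CInt (fun s => F s v) 0 u).
Proof.
  intros HF u v. apply continuous_pair.
  - apply (continuous_ext (fun p : R * R => RInt (fun s => Re (F s (snd p))) 0 (fst p))).
    { intros p. rewrite CInt_pair by (intros; apply (joint_continuous_l F), HF). reflexivity. }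
    refine (proj1 (continuity_2d_pt_filterlim
      (fun u v => RInt (fun s => Re (F s v)) 0 u) u v) _).
    apply (continuous_RInt_param_bound (fun s v => Re (F s v))).
    intros. apply joint_continuous_Re, HF.
  - apply (continuous_ext (fun p : R * R => RInt (fun s => Im (F s (snd p))) 0 (fst p))).
    { intros p. rewrite CInt_pair by (intros; apply (joint_continuous_l F), HF). reflexivity. }
    refine (proj1 (continuity_2d_pt_filterlim
      (fun u v => RInt (fun s => Im (F s v)) 0 u) u v) _).
    apply (continuous_RInt_param_bound (fun s v => Im (F s v))).
    intros. apply joint_continuous_Im, HF.
Qed.

(** ** The derivative relative to a segment *)

Definition clamp (b x : R) : R := Rmax 0 (Rmin b x).

Lemma clamp_seg (b x : R) : (0 < b)%R -> seg b (clamp b x).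
Proof.
  intros Hb. unfold clamp, seg. split; [apply Rmax_l|].
  apply Rmax_lub; [lra | apply Rmin_l].
Qed.

Lemma clamp_id (b x : R) : seg b x -> clamp b x = x.
Proof.
  intros [H1 H2]. unfold clamp. rewrite Rmin_right, Rmax_right; lra.
Qed.

Lemma clamp_lipschitz (b x y : R) : (Rabs (clamp b x - clamp b y) <= Rabs (x - y))%R.
Proof.
  unfold clamp, Rmax, Rmin, Rabs.
  repeat (destruct Rle_dec || destruct Rcase_abs); lra.
Qed.

Lemma clamp_continuous (b x : R) : continuous (clamp b) x.
Proof.
  intros P [eps HP]. exists eps. intros y Hy. apply HP.
  eapply Rle_lt_trans; [apply clamp_lipschitz | exact Hy].
Qed.

Lemma continuous_on_clamp (b : R) (g : R -> C) :
  (0 < b)%R -> continuous_on (seg b) g -> forall x, Ccont (fun y => g (clamp b y)) x.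
Proof.
  intros Hb Hg x P HP.
  specialize (Hg (clamp b x) (clamp_seg b x Hb) P HP).
  unfold filtermap, within in *.
  pose proof (clamp_continuous b x _ Hg) as H. unfold filtermap in H.
  revert H. apply filter_imp. intros y Hy. apply Hy, clamp_seg, Hb.
Qed.

Lemma norm_Cmod (z : C) : norm (z : C_R_NormedModule) = Cmod z.
Proof. symmetry. apply Cmod_norm. Qed.

Lemma RtoC_scal (r : R) (z : C) : scal r (z : C_R_NormedModule) = (r * z)%C.
Proof.
  apply injective_projections; cbn; unfold mult; simpl; ring.
Qed.

Lemma seg_filter_lim (b x y : R) :
  seg b x -> is_filter_lim (within (seg b) (locally x)) y -> y = x.
Proof.
  intros Hx Hy.
  destruct (Req_dec y x) as [E|E]; [exact E|exfalso].
  assert (P : (0 < Rabs (y - x) / 2)%R).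
  { apply Rdiv_lt_0_compat; [apply Rabs_pos_lt; lra | lra]. }
  pose proof (Hy (ball y (mkposreal _ P)) (locally_ball _ _)) as H.
  unfold within in H. apply locally_singleton in H. specialize (H Hx).
  change (Rabs (x - y) < Rabs (y - x) / 2)%R in H.
  rewrite Rabs_minus_sym in H. lra.
Qed.

(** The filter [within (seg b) (locally x)] has no limit but [x], so the
    differential relative to the segment is the usual first-order estimate. *)
Lemma is_deriv_eps (b : R) (u : R -> C) (x : R) (l : C) :
  seg b x ->
  (is_deriv b u x l <->
   forall eps : R, (0 < eps)%R -> exists d : R, (0 < d)%R /\
     forall y, seg b y -> (Rabs (y - x) < d)%R ->
       (Cmod (u y - u x - (y - x)%R * l) <= eps * Rabs (y - x))%R).
Proof.
  intros Hx. split.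
  - intros [_ H] eps He.
    assert (HL : is_filter_lim (within (seg b) (locally x)) x).
    { intros P HP. unfold within. revert HP. apply filter_imp. auto. }
    specialize (H x HL (mkposreal eps He)).
    unfold within in H. destruct H as [d Hd].
    exists d. split; [apply cond_pos|].
    intros y Hy Hyx. specialize (Hd y Hyx Hy).
    rewrite RtoC_scal, norm_Cmod in Hd. exact Hd.
  - intros H. split.
    + exact (is_linear_scal_l (K := R_AbsRing) (V := C_R_NormedModule) l).
    + intros y Hy. apply (seg_filter_lim _ _ _ Hx) in Hy. subst y.
      intros eps. destruct (H eps (cond_pos eps)) as [d [Hd0 Hd]].
      exists (mkposreal d Hd0). intros y Hy Sy.
      specialize (Hd y Sy Hy). rewrite RtoC_scal, norm_Cmod. exact Hd.
Qed.

Lemma is_Cderive_eps (u : R -> C) (x : R) (l : C) :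
  (is_Cderive u x l <->
   forall eps : R, (0 < eps)%R -> exists d : R, (0 < d)%R /\
     forall y, (Rabs (y - x) < d)%R ->
       (Cmod (u y - u x - (y - x)%R * l) <= eps * Rabs (y - x))%R).
Proof.
  split.
  - intros [_ H] eps He.
    specialize (H x (fun P HP => HP) (mkposreal eps He)).
    destruct H as [d Hd].
    exists d. split; [apply cond_pos|].
    intros y Hyx. specialize (Hd y Hyx).
    rewrite RtoC_scal, norm_Cmod in Hd. exact Hd.
  - intros H. split.
    + exact (is_linear_scal_l (K := R_AbsRing) (V := C_R_NormedModule) l).
    + intros y Hy.
      pose proof (is_filter_lim_locally_unique (V := R_NormedModule) x y Hy). subst y.
      intros eps. destruct (H eps (cond_pos eps)) as [d [Hd0 Hd]].
      exists (mkposreal d Hd0). intros y Hz.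
      specialize (Hd y Hz). rewrite RtoC_scal, norm_Cmod. exact Hd.
Qed.

Lemma is_Cderive_is_deriv (b : R) (u v : R -> C) (x : R) (l : C) :
  seg b x -> (forall y, seg b y -> u y = v y) ->
  is_Cderive u x l -> is_deriv b v x l.
Proof.
  intros Hx E H. apply is_deriv_eps; [exact Hx|].
  intros eps He. destruct (proj1 (is_Cderive_eps u x l) H eps He) as [d [Hd0 Hd]].
  exists d. split; [exact Hd0|]. intros y Hy Hyx.
  rewrite <- !E by assumption. auto.
Qed.

(** A segment of positive length contains points at every small distance from
    each of its points, on one side at least. *)
Lemma is_deriv_unique (b : R) (u : R -> C) (x : R) (l m : C) :
  (0 < b)%R -> seg b x -> is_deriv b u x l -> is_deriv b u x m -> l = m.
Proof.
  intros Hb Hx Hl Hm.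
  destruct (Ceq_dec l m) as [E|E]; [exact E|exfalso].
  assert (P : (0 < Cmod (l - m))%R).
  { apply Cmod_gt_0. intros F. apply E. replace l with ((l - m) + m) by ring.
    rewrite F. ring. }
  assert (P4 : (0 < Cmod (l - m) / 4)%R) by lra.
  destruct (proj1 (is_deriv_eps b u x l Hx) Hl _ P4) as [d1 [D1 H1]].
  destruct (proj1 (is_deriv_eps b u x m Hx) Hm _ P4) as [d2 [D2 H2]].
  set (d := (Rmin (Rmin d1 d2) b / 2)%R).
  assert (Hd : (0 < d)%R).
  { unfold d. apply Rdiv_lt_0_compat; [|lra]. repeat apply Rmin_pos; lra. }
  assert (L1 : (d < d1)%R).
  { unfold d in *. pose proof (Rmin_l (Rmin d1 d2) b). pose proof (Rmin_l d1 d2). lra. }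
  assert (L2 : (d < d2)%R).
  { unfold d in *. pose proof (Rmin_l (Rmin d1 d2) b). pose proof (Rmin_r d1 d2). lra. }
  assert (L3 : (d <= b / 2)%R).
  { unfold d in *. pose proof (Rmin_r (Rmin d1 d2) b). lra. }
  assert (Hy : exists y, seg b y /\ Rabs (y - x) = d).
  { destruct Hx as [X1 X2]. destruct (Rle_dec x (b / 2)).
    - exists (x + d)%R. split; [split; lra|].
      replace (x + d - x)%R with d by ring. apply Rabs_pos_eq; lra.
    - exists (x - d)%R. split; [split; lra|].
      replace (x - d - x)%R with (- d)%R by ring. rewrite Rabs_Ropp. apply Rabs_pos_eq; lra. }
  destruct Hy as [y [Sy Ey]].
  specialize (H1 y Sy). specialize (H2 y Sy). rewrite Ey in H1, H2.
  specialize (H1 L1). specialize (H2 L2).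
  assert (T : (Cmod ((y - x)%R * (l - m)) <= Cmod (l - m) / 4 * d + Cmod (l - m) / 4 * d)%R).
  { replace ((y - x)%R * (l - m)) with
      ((u y - u x - (y - x)%R * m) + - (u y - u x - (y - x)%R * l)) by ring.
    eapply Rle_trans; [apply Cmod_triangle|]. rewrite Cmod_opp. lra. }
  rewrite Cmod_mult, Cmod_R, Ey in T. nra.
Qed.

Lemma deriv_eq (b : R) (u : R -> C) (x : R) (l : C) :
  (0 < b)%R -> seg b x -> is_deriv b u x l -> deriv b u x = l.
Proof.
  intros Hb Hx H.
  apply (iota_unique (K := R_AbsRing) (V := C_R_CompleteNormedModule) (is_deriv b u x) l).
  - intros y Hy. apply (is_deriv_unique b u x); assumption.
  - exact H.
Qed.

Lemma is_deriv_continuous_on (b : R) (u du : R -> C) :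
  (forall x, seg b x -> is_deriv b u x (du x)) -> continuous_on (seg b) u.
Proof.
  intros H x Hx. apply filterlim_locally. intros eps.
  destruct (proj1 (is_deriv_eps b u x (du x) Hx) (H x Hx) 1%R Rlt_0_1) as [d [Hd0 Hd]].
  pose proof (cond_pos eps) as He. pose proof (Cmod_ge_0 (du x)) as Hm.
  set (B := (eps / (2 + Cmod (du x)))%R).
  assert (HB : (0 < B)%R) by (apply Rdiv_lt_0_compat; lra).
  assert (Hr : (0 < Rmin d B)%R) by (apply Rmin_pos; assumption).
  exists (mkposreal _ Hr). intros y Hy Sy.
  change (Rabs (y - x) < Rmin d B)%R in Hy.
  pose proof (Rmin_l d B). pose proof (Rmin_r d B).
  specialize (Hd y Sy ltac:(lra)).
  apply (C_NormedModule_mixin_compat1 (u x) (u y) eps).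
  change (Cmod (u y - u x) < eps)%R.
  replace (u y - u x) with ((u y - u x - (y - x)%R * du x) + (y - x)%R * du x) by ring.
  eapply Rle_lt_trans; [apply Cmod_triangle|].
  rewrite Cmod_mult, Cmod_R.
  assert (Rabs (y - x) * (2 + Cmod (du x)) < eps)%R.
  { replace (pos eps) with (B * (2 + Cmod (du x)))%R by (unfold B; field; lra).
    apply Rmult_lt_compat_r; lra. }
  pose proof (Rabs_pos (y - x)). nra.
Qed.

(** Continuation beyond the ends of the segment along the tangents there, which
    makes the relative derivative an ordinary one. *)
Definition tangent_ext (b : R) (u du : R -> C) (x : R) : C :=
  u (clamp b x) + (x - clamp b x)%R * du (clamp b x).

Lemma tangent_ext_seg (b : R) (u du : R -> C) (x : R) :
  seg b x -> tangent_ext b u du x = u x.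
Proof.
  intros H. unfold tangent_ext. rewrite clamp_id by exact H.
  replace (x - x)%R with 0%R by ring. ring.
Qed.

(** The increment splits into the one of [u] between [x] and the clamped point, and a
    piece of tangent whose slope is close to [du x]. *)
Lemma is_Cderive_tangent_ext (b : R) (u du : R -> C) (x : R) :
  (0 < b)%R -> (forall y, seg b y -> is_deriv b u y (du y)) ->
  continuous_on (seg b) du -> seg b x ->
  is_Cderive (tangent_ext b u du) x (du x).
Proof.
  intros Hb Hu Hdu Hx. apply is_Cderive_eps. intros eps He.
  assert (E2 : (0 < eps / 2)%R) by lra.
  destruct (proj1 (is_deriv_eps b u x (du x) Hx) (Hu x Hx) _ E2) as [d1 [D1 H1]].
  pose proof (continuous_on_clamp b du Hb Hdu x) as HC.
  assert (E4 : (0 < eps / 4)%R) by lra.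
  destruct (HC _ (locally_ball _ (mkposreal _ E4))) as [d2 H2].
  exists (Rmin d1 d2). split; [apply Rmin_pos; [exact D1 | apply cond_pos]|].
  intros y Hy. pose proof (Rmin_l d1 d2). pose proof (Rmin_r d1 d2).
  pose proof (clamp_lipschitz b y x) as CL. rewrite (clamp_id b x Hx) in CL.
  assert (B1 := H1 (clamp b y) (clamp_seg b y Hb) ltac:(lra)).
  assert (B2 : (Cmod (du (clamp b y) - du x) <= eps / 2)%R).
  { specialize (H2 y). rewrite (clamp_id b x Hx) in H2.
    assert (Hyb : ball x d2 y) by (change (Rabs (y - x) < d2)%R; lra).
    apply H2 in Hyb. apply C_NormedModule_mixin_compat2 in Hyb.
    change (Cmod (du (clamp b y) - du x) < sqrt 2 * (eps / 4))%R in Hyb.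
    assert (sqrt 2 <= 2)%R.
    { rewrite <- (sqrt_pow2 2) at 2 by lra. apply sqrt_le_1; lra. }
    nra. }
  assert (B3 : (Rabs (y - clamp b y) <= Rabs (y - x))%R).
  { destruct Hx as [X1 X2]. unfold clamp, Rmax, Rmin, Rabs.
    repeat (destruct Rle_dec || destruct Rcase_abs); lra. }
  rewrite (tangent_ext_seg b u du x Hx). unfold tangent_ext.
  replace (u (clamp b y) + (y - clamp b y)%R * du (clamp b y) - u x - (y - x)%R * du x)
    with ((u (clamp b y) - u x - (clamp b y - x)%R * du x)
      + (y - clamp b y)%R * (du (clamp b y) - du x))
    by (rewrite !RtoC_minus; ring).
  eapply Rle_trans; [apply Cmod_triangle|]. rewrite Cmod_mult, Cmod_R.
  pose proof (Rabs_pos (y - clamp b y)). pose proof (Cmod_ge_0 (du (clamp b y) - du x)).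
  assert (Rabs (y - clamp b y) * Cmod (du (clamp b y) - du x) <= Rabs (y - x) * (eps / 2))%R
    by (apply Rmult_le_compat; lra).
  assert (eps / 2 * Rabs (clamp b y - x) <= eps / 2 * Rabs (y - x))%R
    by (apply Rmult_le_compat_l; lra).
  lra.
Qed.

Lemma continuous_Rplus {T : UniformSpace} (u v : T -> R) (x : T) :
  continuous u x -> continuous v x -> continuous (fun y => u y + v y)%R x.
Proof. exact (@continuous_plus T R_AbsRing R_NormedModule u v x). Qed.

Lemma continuous_Rminus {T : UniformSpace} (u v : T -> R) (x : T) :
  continuous u x -> continuous v x -> continuous (fun y => u y - v y)%R x.
Proof. exact (@continuous_minus T R_AbsRing R_NormedModule u v x). Qed.

Lemma continuous_Ropp {T : UniformSpace} (u : T -> R) (x : T) :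
  continuous u x -> continuous (fun y => - u y)%R x.
Proof. exact (@continuous_opp T R_AbsRing R_NormedModule u x). Qed.

Lemma continuous_Rmult {T : UniformSpace} (u v : T -> R) (x : T) :
  continuous u x -> continuous v x -> continuous (fun y => u y * v y)%R x.
Proof. exact (@continuous_mult T R_AbsRing u v x). Qed.

(** Continuity of arithmetic expressions in continuous ingredients.  The lemma to
    apply is chosen by the head symbol: plain [apply] of all of them would make
    unification unfold integrals and complex arithmetic. *)
Ltac cont :=
  repeat match goal with
  | |- forall _, _ => intros ?
  | H : forall x, continuous ?g x |- continuous ?g _ => apply H
  | |- continuous (fun _ => ?c) _ => apply continuous_const
  | |- continuous (fun y => y) _ => apply continuous_id
  | |- continuous (Rmult ?c) _ => apply (continuous_Rmult (fun _ => c) (fun y => y))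
  | |- continuous (Rplus ?c) _ => apply (continuous_Rplus (fun _ => c) (fun y => y))
  | |- continuous (Rminus ?c) _ => apply (continuous_Rminus (fun _ => c) (fun y => y))
  | |- continuous Ropp _ => apply (continuous_Ropp (fun y => y))
  | |- continuous RtoC _ => apply (continuous_RtoC (fun y => y))
  | |- continuous fst _ => apply continuous_fst
  | |- continuous snd _ => apply continuous_snd
  | |- continuous (fun y => fst y) _ => apply continuous_fst
  | |- continuous (fun y => snd y) _ => apply continuous_snd
  | |- continuous (fun y => Cplus _ _) _ => apply continuous_Cplus
  | |- continuous (fun y => Cminus _ _) _ => apply continuous_Cminus
  | |- continuous (fun y => Copp _) _ => apply continuous_Copp
  | |- continuous (fun y => Cmult _ _) _ => apply continuous_Cmult
  | |- continuous (fun y => Cpow _ _) _ => apply continuous_Cpow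
  | |- continuous (fun y => RtoC _) _ => apply continuous_RtoC
  | |- continuous (fun y => Rplus _ _) _ => apply continuous_Rplus
  | |- continuous (fun y => Rminus _ _) _ => apply continuous_Rminus
  | |- continuous (fun y => Ropp _) _ => apply continuous_Ropp
  | |- continuous (fun y => Rmult _ _) _ => apply continuous_Rmult
  | H : joint_continuous ?F |- continuous (?F ?a) _ => apply (joint_continuous_r F a _ H)
  | H : joint_continuous ?F |- continuous (fun y => ?F (@?a y) (@?c y)) _ =>
      apply (joint_continuous_comp F a c _ H)
  | H : forall x, continuous ?g x |- continuous (fun y => ?g (@?a y)) _ =>
      apply (continuous_comp a g); [|apply H]
  end.

(** * The kernel and the operator it defines *)

(** In the characteristic coordinates [u = (x+t)/2], [v = (x-t)/2] the kernel is
    a function of [u] plus the double integral of its mixed derivative [W].  Here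
    [ker_V] and [ker_U] are the partial integrals of [W] in [v] and in [u]. *)
Definition ker_V (W : R -> R -> C) (u v : R) : C := CInt (fun s => W u s) 0 v.
Definition ker_U (W : R -> R -> C) (u v : R) : C := CInt (fun s => W s v) 0 u.
Definition goursat (h : C) (Q : R -> C) (W : R -> R -> C) (u v : R) : C :=
  h / 2 + / 2 * CInt Q 0 u + CInt (fun s => ker_V W s v) 0 u.
(** The kernel and its partial derivatives in the coordinates [x], [t]. *)
Definition kern h Q W (x t : R) : C := goursat h Q W ((x + t) / 2) ((x - t) / 2).
Definition kern_x (Q : R -> C) W (x t : R) : C :=
  / 2 * (/ 2 * Q ((x + t) / 2)%R + ker_V W ((x + t) / 2) ((x - t) / 2)
     + ker_U W ((x + t) / 2) ((x - t) / 2)).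
Definition kern_t (Q : R -> C) W (x t : R) : C :=
  / 2 * (/ 2 * Q ((x + t) / 2)%R + ker_V W ((x + t) / 2) ((x - t) / 2)
     - ker_U W ((x + t) / 2) ((x - t) / 2)).

Lemma joint_continuous_V (W : R -> R -> C) : joint_continuous W -> joint_continuous (ker_V W).
Proof. intros H. apply (joint_continuous_swap _ (joint_continuous_CInt _ (joint_continuous_swap _ H))). Qed.

Lemma joint_continuous_U (W : R -> R -> C) : joint_continuous W -> joint_continuous (ker_U W).
Proof. intros H. apply (joint_continuous_CInt _ H). Qed.

Lemma joint_continuous_goursat (h : C) (Q : R -> C) (W : R -> R -> C) :
  (forall x, Ccont Q x) -> joint_continuous W -> joint_continuous (goursat h Q W).
Proof.
  intros HQ HW u v. unfold goursat.
  apply continuous_Cplus.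
  - apply continuous_Cplus; [apply continuous_const|].
    apply continuous_Cmult; [apply continuous_const|].
    apply (continuous_comp fst (fun u => CInt Q 0 u)); [apply continuous_fst|].
    apply is_Cderive_continuous with (Q u). apply is_Cderive_CInt, HQ.
  - apply (joint_continuous_CInt _ (joint_continuous_V W HW)).
Qed.

Lemma joint_continuous_kern (h : C) (Q : R -> C) (W : R -> R -> C) :
  (forall x, Ccont Q x) -> joint_continuous W -> joint_continuous (kern h Q W).
Proof.
  intros HQ HW x t. pose proof (joint_continuous_goursat h Q W HQ HW). unfold kern, Rdiv. cont.
Qed.

Lemma joint_continuous_kern_x (Q : R -> C) (W : R -> R -> C) :
  (forall x, Ccont Q x) -> joint_continuous W -> joint_continuous (kern_x Q W).
Proof.
  intros HQ HW x t. pose proof (joint_continuous_V W HW). pose proof (joint_continuous_U W HW).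
  unfold kern_x, Rdiv. cont.
Qed.

Lemma joint_continuous_kern_t (Q : R -> C) (W : R -> R -> C) :
  (forall x, Ccont Q x) -> joint_continuous W -> joint_continuous (kern_t Q W).
Proof.
  intros HQ HW x t. pose proof (joint_continuous_V W HW). pose proof (joint_continuous_U W HW).
  unfold kern_t, Rdiv. cont.
Qed.

Lemma is_Cderive_V (W : R -> R -> C) (u v : R) :
  joint_continuous W -> is_Cderive (fun y => ker_V W u y) v (W u v).
Proof.
  intros HW. apply (is_Cderive_CInt (fun s => W u s)). intros; cont.
Qed.

Lemma is_Cderive_U (W : R -> R -> C) (u v : R) :
  joint_continuous W -> is_Cderive (fun y => ker_U W y v) u (W u v).
Proof.
  intros HW. apply (is_Cderive_CInt (fun s => W s v)). intros; cont.
Qed.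

(** Both partial derivatives of [kern] are derivatives of this kind, along lines on
    which [u] and [v] are affine functions. *)
Lemma is_Cderive_goursat (h : C) (Q : R -> C) (W : R -> R -> C)
  (a c : R -> R) (x da dc : R) :
  (forall x, Ccont Q x) -> joint_continuous W ->
  is_derive a x da -> (forall y, is_derive c y dc) ->
  is_Cderive (fun y => goursat h Q W (a y) (c y)) x
    (da * (/ 2 * Q (a x) + ker_V W (a x) (c x)) + dc * ker_U W (a x) (c x)).
Proof.
  intros HQ HW Ha Hc. unfold goursat.
  assert (HV := joint_continuous_V W HW).
  assert (Hcc : forall y, continuous c y).
  { intros y. apply ex_derive_continuous_R.
    exists dc. apply Hc. }
  replace (da * (/ 2 * Q (a x) + ker_V W (a x) (c x)) + dc * ker_U W (a x) (c x))
    with ((0 + / 2 * (da * Q (a x))) +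
     (CInt (fun s => dc * W s (c x)) 0 (a x) + da * ker_V W (a x) (c x))).
  2:{ unfold ker_U. rewrite CInt_scal by (intros; cont). ring. }
  apply is_Cderive_plus; [apply is_Cderive_plus|].
  - apply is_Cderive_const.
  - apply is_Cderive_scal.
    apply (is_Cderive_comp (fun u => CInt Q 0 u) a); [|exact Ha].
    apply is_Cderive_CInt, HQ.
  - apply (is_Cderive_CInt_param (fun y s => ker_V W s (c y))
      (fun y s => dc * W s (c y)) a x da).
    + intros y s. apply (is_Cderive_comp (fun v => ker_V W s v) c); [|apply Hc].
      apply is_Cderive_V, HW.
    + intros y s. cont.
    + intros y s. cont.
    + exact Ha.
Qed.

Lemma is_Cderive_kern_x (h : C) (Q : R -> C) (W : R -> R -> C) (x t : R) :
  (forall x, Ccont Q x) -> joint_continuous W ->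
  is_Cderive (fun y => kern h Q W y t) x (kern_x Q W x t).
Proof.
  intros HQ HW. unfold kern, kern_x.
  replace (/ 2 * _) with
    ((/2)%R * (/ 2 * Q ((x + t) / 2)%R + ker_V W ((x + t) / 2) ((x - t) / 2))
      + (/2)%R * ker_U W ((x + t) / 2) ((x - t) / 2))
    by (rewrite RtoC_inv by lra; ring).
  apply (is_Cderive_goursat h Q W (fun y => (y + t) / 2)%R (fun y => (y - t) / 2)%R);
    auto; intros; auto_derive; auto; field.
Qed.

Lemma is_Cderive_kern_t (h : C) (Q : R -> C) (W : R -> R -> C) (x t : R) :
  (forall x, Ccont Q x) -> joint_continuous W ->
  is_Cderive (fun y => kern h Q W x y) t (kern_t Q W x t).
Proof.
  intros HQ HW. unfold kern, kern_t.
  replace (/ 2 * _) with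
    ((/2)%R * (/ 2 * Q ((x + t) / 2)%R + ker_V W ((x + t) / 2) ((x - t) / 2))
      + (-/2)%R * ker_U W ((x + t) / 2) ((x - t) / 2))
    by (rewrite RtoC_opp, RtoC_inv by lra; ring).
  apply (is_Cderive_goursat h Q W (fun y => (x + y) / 2)%R (fun y => (x - y) / 2)%R);
    auto; intros; auto_derive; auto; field.
Qed.

Lemma kern_diag (h : C) (Q : R -> C) (W : R -> R -> C) (x : R) :
  kern h Q W x x = h / 2 + / 2 * CInt Q 0 x.
Proof.
  unfold kern, goursat.
  replace ((x + x) / 2)%R with x by field. replace ((x - x) / 2)%R with 0%R by field.
  rewrite (CInt_ext (fun s => ker_V W s 0) (fun _ => 0 * 0)).
  - rewrite CInt_scal by (intros; cont). ring.
  - intros. unfold ker_V. rewrite CInt_point. ring.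
Qed.

Lemma kern_antidiag (h : C) (Q : R -> C) (W : R -> R -> C) (x : R) :
  kern h Q W x (- x) = h / 2.
Proof.
  unfold kern, goursat.
  replace ((x + - x) / 2)%R with 0%R by field. rewrite !CInt_point. ring.
Qed.

Lemma CInt_sym (g : R -> C) (x : R) :
  (forall t, Ccont g t) ->
  CInt g (- x) x = CInt g 0 x + CInt (fun t => g (- t)%R) 0 x.
Proof.
  intros Hg. rewrite <- (CInt_Chasles g (- x) 0 x) by exact Hg.
  replace (CInt g (- x) 0) with (CInt (fun t => g (- t)%R) 0 x); [ring|].
  assert (E := CInt_affine g (- 1) 0 0 x Hg).
  replace (-1 * 0 + 0)%R with 0%R in E by ring.
  replace (-1 * x + 0)%R with (- x)%R in E by ring.
  rewrite (CInt_opp_bounds g 0 (- x) Hg), <- E.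
  rewrite CInt_scal.
  - rewrite (CInt_ext (fun t => g (- t)%R) (fun x => g (-1 * x + 0)%R)).
    + ring.
    + intros. f_equal. ring.
  - intros. cont.
Qed.

(** With [u = (x+t)/2], respectively [v = (x-t)/2], as variable of integration,
    the range of integration is [0,x]. *)
Lemma CInt_char_u (F : R -> R -> R -> C) (x : R) :
  (forall t : R, Ccont (fun t : R => F ((x + t) / 2)%R ((x - t) / 2)%R t) t) ->
  CInt (fun t => F ((x + t) / 2)%R ((x - t) / 2)%R t) (- x) x
  = 2 * CInt (fun u => F u (x - u)%R (2 * u - x)%R) 0 x.
Proof.
  intros HF. assert (E := CInt_affine _ 2 (- x) 0 x HF).
  replace (2 * 0 + - x)%R with (- x)%R in E by ring.
  replace (2 * x + - x)%R with x in E by ring.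
  rewrite <- E, CInt_scal by (intros; apply (continuous_comp (fun u : R => 2 * u + - x)%R
    (fun t => F ((x + t) / 2)%R ((x - t) / 2)%R t)); [cont | apply HF]).
  apply (f_equal (Cmult _)), CInt_ext. intros u _. f_equal; field.
Qed.

Lemma CInt_char_v (F : R -> R -> R -> C) (x : R) :
  (forall t : R, Ccont (fun t : R => F ((x + t) / 2)%R ((x - t) / 2)%R t) t) ->
  CInt (fun t => F ((x + t) / 2)%R ((x - t) / 2)%R t) (- x) x
  = 2 * CInt (fun v => F (x - v)%R v (x - 2 * v)%R) 0 x.
Proof.
  intros HF. assert (E := CInt_affine _ (-2) x 0 x HF).
  replace (-2 * 0 + x)%R with x in E by ring.
  replace (-2 * x + x)%R with (- x)%R in E by ring.
  rewrite CInt_opp_bounds by exact HF.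
  rewrite <- E, CInt_scal by (intros; apply (continuous_comp (fun u : R => -2 * u + x)%R
    (fun t => F ((x + t) / 2)%R ((x - t) / 2)%R t)); [cont | apply HF]).
  replace (CInt (fun v => F (x - v)%R v (x - 2 * v)%R) 0 x) with
    (CInt (fun s => F ((x + (-2 * s + x)) / 2)%R ((x - (-2 * s + x)) / 2)%R
       (-2 * s + x)%R) 0 x); [ring|].
  apply CInt_ext. intros u _. f_equal; field.
Qed.

Definition transmute h Q W (g : R -> C) (x : R) : C :=
  g x + CInt (fun t => kern h Q W x t * g t) (- x) x.

(** The derivative of [transmute h Q W g], with [dg] the derivative of [g]; the values
    of the kernel on the two characteristics [t = x] and [t = -x] are inserted. *)
Definition transmute_d h Q W (g dg : R -> C) (x : R) : C :=
  dg x + (h / 2 + / 2 * CInt Q 0 x) * g x + h / 2 * g (- x)%R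
  + CInt (fun t => kern_x Q W x t * g t) (- x) x.

Lemma is_Cderive_transmute h Q W (g dg : R -> C) (x : R) :
  (forall x, Ccont Q x) -> joint_continuous W ->
  (forall t, is_Cderive g t (dg t)) ->
  is_Cderive (transmute h Q W g) x (transmute_d h Q W g dg x).
Proof.
  intros HQ HW Hg. unfold transmute, transmute_d.
  assert (Cg : forall t, Ccont g t) by (intros t; exact (is_Cderive_continuous _ _ _ (Hg t))).
  assert (Ck := joint_continuous_kern h Q W HQ HW). assert (Ckx := joint_continuous_kern_x Q W HQ HW).
  assert (Did : forall y : R, is_derive (fun z : R => z) y 1%R)
    by (intros; exact (is_derive_id (K := R_AbsRing) _)).
  replace (dg x + _ + _ + _) with
    (dg x + ((CInt (fun t => kern_x Q W x t * g t) 0 x + 1%R * (kern h Q W x x * g x))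
       + (CInt (fun t => kern_x Q W x (- t) * g (- t)%R) 0 x
            + 1%R * (kern h Q W x (- x) * g (- x)%R)))).
  2:{ rewrite (CInt_sym (fun t => kern_x Q W x t * g t)) by (intros; cont).
      rewrite kern_diag, kern_antidiag. ring. }
  apply is_Cderive_plus; [apply Hg|].
  apply (is_derive_ext (V := C_R_NormedModule) (fun y =>
     CInt (fun t => kern h Q W y t * g t) 0 y
     + CInt (fun t => kern h Q W y (- t) * g (- t)%R) 0 y)).
  { intros y. symmetry. apply (CInt_sym (fun t => kern h Q W y t * g t)). intros; cont. }
  apply is_Cderive_plus.
  - apply (is_Cderive_CInt_param (fun y t => kern h Q W y t * g t)
       (fun y t => kern_x Q W y t * g t) (fun y => y) x 1).
    + intros y t.
      replace (kern_x Q W y t * g t) with (kern_x Q W y t * g t + kern h Q W y t * 0) by ring.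
      apply (is_Cderive_mult (fun z => kern h Q W z t) (fun _ => g t));
        [apply is_Cderive_kern_x; assumption | apply is_Cderive_const].
    + intros y t. cont.
    + intros y t. cont.
    + apply Did.
  - apply (is_Cderive_CInt_param (fun y t => kern h Q W y (- t) * g (- t)%R)
       (fun y t => kern_x Q W y (- t) * g (- t)%R) (fun y => y) x 1).
    + intros y t.
      replace (kern_x Q W y (- t) * g (- t)%R)
        with (kern_x Q W y (- t) * g (- t)%R + kern h Q W y (- t) * 0) by ring.
      apply (is_Cderive_mult (fun z => kern h Q W z (- t)) (fun _ => g (- t)%R));
        [apply is_Cderive_kern_x; assumption | apply is_Cderive_const].
    + intros y t. cont.
    + intros y t. cont.
    + apply Did.
Qed.

(** The transmutation identity [T[g]'' = q T[g] + T[g'']].  The kernel need not have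
    second derivatives, but its [x]-derivative is the sum of a part that is
    differentiable in [v] and a part that is differentiable in [u].  With [u],
    respectively [v], as variable of integration each part can be differentiated
    under the integral sign.  The terms with [dg] combine to the integral of
    [kern_t] times [dg], which is integrated by parts. *)
Lemma is_Cderive_transmute_d h Q W (g dg ddg : R -> C) (x : R) :
  (forall x, Ccont Q x) -> joint_continuous W ->
  (forall t, is_Cderive g t (dg t)) -> (forall t, is_Cderive dg t (ddg t)) ->
  (forall t, Ccont ddg t) -> (0 <= x)%R ->
  (forall t, (- x <= t <= x)%R ->
     W ((x + t) / 2)%R ((x - t) / 2)%R = Q x * kern h Q W x t) ->
  is_Cderive (transmute_d h Q W g dg) x
    (Q x * transmute h Q W g x + transmute h Q W ddg x).
Proof.
  intros HQ HW Hg Hdg Cddg Hx HWK.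
  assert (Cg : forall t, Ccont g t) by (intros t; exact (is_Cderive_continuous _ _ _ (Hg t))).
  assert (Cdg : forall t, Ccont dg t) by (intros t; exact (is_Cderive_continuous _ _ _ (Hdg t))).
  assert (Ck := joint_continuous_kern h Q W HQ HW). assert (Ckx := joint_continuous_kern_x Q W HQ HW).
  assert (Ckt := joint_continuous_kern_t Q W HQ HW).
  assert (CV := joint_continuous_V W HW). assert (CU := joint_continuous_U W HW).
  assert (Did : forall y : R, is_derive (fun z : R => z) y 1%R)
    by (intros; exact (is_derive_id (K := R_AbsRing) _)).
  (* the integral of kern_x g is S1 + S2 *)
  set (S1 := fun y => CInt (fun u => (/ 2 * Q u + ker_V W u (y - u)) * g (2 * u - y)%R) 0 y).
  set (S2 := fun y => CInt (fun v => ker_U W (y - v) v * g (y - 2 * v)%R) 0 y).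
  assert (ES : forall y, CInt (fun t => kern_x Q W y t * g t) (- y) y = S1 y + S2 y).
  { intros y.
    rewrite (CInt_ext _ (fun t => / 2 *
       ((/ 2 * Q ((y + t) / 2)%R + ker_V W ((y + t) / 2) ((y - t) / 2)) * g t)
       + / 2 * (ker_U W ((y + t) / 2) ((y - t) / 2) * g t)))
      by (intros; unfold kern_x; ring).
    rewrite CInt_plus by (intros; unfold Rdiv; cont).
    rewrite !CInt_scal by (intros; unfold Rdiv; cont).
    rewrite (CInt_char_u (fun u v t => (/ 2 * Q u + ker_V W u v) * g t))
      by (intros; unfold Rdiv; cont).
    rewrite (CInt_char_v (fun u v t => ker_U W u v * g t)) by (intros; unfold Rdiv; cont).
    unfold S1, S2. field. }
  set (A1 := CInt (fun u => W u (x - u)%R * g (2 * u - x)%R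
     - (/ 2 * Q u + ker_V W u (x - u)) * dg (2 * u - x)%R) 0 x).
  set (A2 := CInt (fun v => W (x - v)%R v * g (x - 2 * v)%R
     + ker_U W (x - v) v * dg (x - 2 * v)%R) 0 x).
  assert (D1 : is_Cderive S1 x (A1 + / 2 * Q x * g x)).
  { replace (A1 + / 2 * Q x * g x) with
      (A1 + 1%R * ((/ 2 * Q x + ker_V W x (x - x)) * g (2 * x - x)%R)).
    2:{ replace (x - x)%R with 0%R by ring. replace (2 * x - x)%R with x by ring.
        unfold ker_V. rewrite CInt_point. ring. }
    apply (is_Cderive_CInt_param
      (fun y u => (/ 2 * Q u + ker_V W u (y - u)) * g (2 * u - y)%R)
      (fun y u => W u (y - u)%R * g (2 * u - y)%R
         - (/ 2 * Q u + ker_V W u (y - u)) * dg (2 * u - y)%R) (fun y => y) x 1).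
    - intros y u.
      replace (W u (y - u)%R * g (2 * u - y)%R
         - (/ 2 * Q u + ker_V W u (y - u)) * dg (2 * u - y)%R) with
        ((0 + 1%R * W u (y - u)%R) * g (2 * u - y)%R
           + (/ 2 * Q u + ker_V W u (y - u)) * ((-1)%R * dg (2 * u - y)%R))
        by ring.
      apply (is_Cderive_mult (fun y => / 2 * Q u + ker_V W u (y - u))
        (fun y => g (2 * u - y)%R)); [apply is_Cderive_plus; [apply is_Cderive_const|]|].
      + apply (is_Cderive_comp (fun v => ker_V W u v) (fun y => y - u)%R).
        * apply is_Cderive_V, HW.
        * auto_derive; [exact I | ring].
      + apply (is_Cderive_comp g (fun y => 2 * u - y)%R); [apply Hg|].
        auto_derive; [exact I | ring].
    - intros y t. cont.
    - intros y t. cont.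
    - apply Did. }
  assert (D2 : is_Cderive S2 x A2).
  { replace A2 with (A2 + 1%R * (ker_U W (x - x) x * g (x - 2 * x)%R)).
    2:{ replace (x - x)%R with 0%R by ring. unfold ker_U. rewrite CInt_point. ring. }
    apply (is_Cderive_CInt_param
      (fun y v => ker_U W (y - v) v * g (y - 2 * v)%R)
      (fun y v => W (y - v)%R v * g (y - 2 * v)%R
        + ker_U W (y - v) v * dg (y - 2 * v)%R) (fun y => y) x 1).
    - intros y v.
      replace (W (y - v)%R v * g (y - 2 * v)%R + ker_U W (y - v) v * dg (y - 2 * v)%R)
        with ((1%R * W (y - v)%R v) * g (y - 2 * v)%R
           + ker_U W (y - v) v * (1%R * dg (y - 2 * v)%R)) by ring.
      apply (is_Cderive_mult (fun y => ker_U W (y - v) v) (fun y => g (y - 2 * v)%R)).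
      + apply (is_Cderive_comp (fun u => ker_U W u v) (fun y => y - v)%R).
        * apply is_Cderive_U, HW.
        * auto_derive; [exact I | ring].
      + apply (is_Cderive_comp g (fun y => y - 2 * v)%R); [apply Hg|].
        auto_derive; [exact I | ring].
    - intros y t. cont.
    - intros y t. cont.
    - apply Did. }
  assert (EA : A1 + A2 = Q x * CInt (fun t => kern h Q W x t * g t) (- x) x
     - CInt (fun t => kern_t Q W x t * dg t) (- x) x).
  { unfold A1, A2.
    rewrite CInt_minus, CInt_plus by (intros; cont).
    rewrite (CInt_ext (fun t => kern_t Q W x t * dg t) (fun t => / 2 *
       ((/ 2 * Q ((x + t) / 2)%R + ker_V W ((x + t) / 2) ((x - t) / 2)) * dg t)
       - / 2 * (ker_U W ((x + t) / 2) ((x - t) / 2) * dg t)))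
      by (intros; unfold kern_t; ring).
    rewrite CInt_minus by (intros; unfold Rdiv; cont).
    rewrite !CInt_scal by (intros; unfold Rdiv; cont).
    rewrite (CInt_char_u (fun u v t => (/ 2 * Q u + ker_V W u v) * dg t))
      by (intros; unfold Rdiv; cont).
    rewrite (CInt_char_v (fun u v t => ker_U W u v * dg t)) by (intros; unfold Rdiv; cont).
    assert (E0 : CInt (fun t => W ((x + t) / 2)%R ((x - t) / 2)%R * g t) (- x) x
      = Q x * CInt (fun t => kern h Q W x t * g t) (- x) x).
    { rewrite <- CInt_scal by (intros; cont). apply CInt_ext. intros t Ht.
      rewrite Rmin_left, Rmax_right in Ht by lra. rewrite HWK by lra. ring. }
    assert (E1 : CInt (fun u => W u (x - u)%R * g (2 * u - x)%R) 0 x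
      = / 2 * (Q x * CInt (fun t => kern h Q W x t * g t) (- x) x)).
    { rewrite <- E0, (CInt_char_u (fun u v t => W u v * g t)) by (intros; unfold Rdiv; cont).
      field. }
    assert (E2 : CInt (fun v => W (x - v)%R v * g (x - 2 * v)%R) 0 x
      = / 2 * (Q x * CInt (fun t => kern h Q W x t * g t) (- x) x)).
    { rewrite <- E0, (CInt_char_v (fun u v t => W u v * g t)) by (intros; unfold Rdiv; cont).
      field. }
    rewrite E1, E2. field. }
  assert (EP : CInt (fun t => kern_t Q W x t * dg t) (- x) x
     = (h / 2 + / 2 * CInt Q 0 x) * dg x - h / 2 * dg (- x)%R
       - CInt (fun t => kern h Q W x t * ddg t) (- x) x).
  { assert (E := CInt_derive (fun t => kern h Q W x t * dg t)
      (fun t => kern_t Q W x t * dg t + kern h Q W x t * ddg t) (- x) x).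
    rewrite CInt_plus, kern_diag, kern_antidiag in E by (intros; cont).
    rewrite <- E.
    - ring.
    - intros t. apply is_Cderive_mult; [apply is_Cderive_kern_t; assumption | apply Hdg].
    - intros t. cont. }
  apply (is_derive_ext (V := C_R_NormedModule) (fun y =>
    dg y + (h / 2 + / 2 * CInt Q 0 y) * g y + h / 2 * g (- y)%R + (S1 y + S2 y))).
  { intros y. unfold transmute_d. rewrite ES. reflexivity. }
  replace (Q x * transmute h Q W g x + transmute h Q W ddg x)
   with (ddg x + ((0 + / 2 * Q x) * g x + (h / 2 + / 2 * CInt Q 0 x) * dg x)
     + h / 2 * ((-1)%R * dg (- x)%R) + ((A1 + / 2 * Q x * g x) + A2)).
  2:{ replace (A1 + / 2 * Q x * g x + A2) with ((A1 + A2) + / 2 * Q x * g x) by ring.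
      rewrite EA, EP. unfold transmute. field. }
  apply is_Cderive_plus; [apply is_Cderive_plus; [apply is_Cderive_plus|]|].
  - apply Hdg.
  - apply is_Cderive_mult; [|apply Hg].
    apply is_Cderive_plus; [apply is_Cderive_const|].
    apply is_Cderive_scal, is_Cderive_CInt, HQ.
  - apply is_Cderive_scal.
    apply (is_Cderive_comp g (fun y => - y)%R); [apply Hg|].
    auto_derive; [exact I | ring].
  - apply is_Cderive_plus; assumption.
Qed.

Definition sym_clamp (r t : R) : R := Rmax (- r) (Rmin r t).

Lemma sym_clamp_id (r t : R) : (Rabs t <= r)%R -> sym_clamp r t = t.
Proof.
  intros H. apply Rabs_le_between in H. unfold sym_clamp.
  rewrite Rmin_right, Rmax_right; lra.
Qed.

Lemma sym_clamp_bound (r t : R) : (0 <= r)%R -> (Rabs (sym_clamp r t) <= r)%R.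
Proof.
  intros H. unfold sym_clamp, Rmax, Rmin, Rabs.
  repeat (destruct Rle_dec || destruct Rcase_abs); lra.
Qed.

Lemma sym_clamp_lipschitz (r s x y : R) :
  (0 <= r)%R -> (0 <= s)%R ->
  (Rabs (sym_clamp r x - sym_clamp s y) <= Rabs (r - s) + Rabs (x - y))%R.
Proof.
  intros H1 H2. unfold sym_clamp, Rmax, Rmin, Rabs.
  repeat (destruct Rle_dec || destruct Rcase_abs); lra.
Qed.

Lemma joint_continuous_clamped (b : R) (K : R -> R -> C) :
  (0 < b)%R ->
  continuous_on (Defs.triangle b) (fun p : R * R => K (fst p) (snd p)) ->
  joint_continuous (fun x t => K (clamp b x) (sym_clamp (clamp b x) t)).
Proof.
  intros Hb HK x t P HP.
  assert (T : forall x t, Defs.triangle b (clamp b x, sym_clamp (clamp b x) t)).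
  { intros x' t'. pose proof (clamp_seg b x' Hb) as S. split; [exact S|].
    apply sym_clamp_bound, S. }
  destruct (HK _ (T x t) P HP) as [d Hd].
  assert (Hd2 : (0 < d / 2)%R) by (pose proof (cond_pos d); lra).
  exists (mkposreal _ Hd2). intros [y s] [Hy Hs].
  change (Rabs (y - x) < d / 2)%R in Hy. change (Rabs (s - t) < d / 2)%R in Hs.
  apply (Hd (clamp b y, sym_clamp (clamp b y) s)); [|apply T].
  pose proof (clamp_lipschitz b y x) as L1.
  pose proof (sym_clamp_lipschitz (clamp b y) (clamp b x) s t
    (proj1 (clamp_seg b y Hb)) (proj1 (clamp_seg b x Hb))) as L2.
  pose proof (Rabs_pos (s - t)).
  split.
  - change (Rabs (clamp b y - clamp b x) < d)%R. lra.
  - change (Rabs (sym_clamp (clamp b y) s - sym_clamp (clamp b x) t) < d)%R. lra.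
Qed.

(** Outside the triangle the data are continued by clamping, which keeps them
    continuous; the integral equation then extends the kernel to the plane. *)
Lemma kernel_extension (b : R) (q : R -> C) (h : C) (K : R -> R -> C) :
  (0 < b)%R -> continuous_on (seg b) q -> is_kernel b q h K ->
  exists (Q : R -> C) (W : R -> R -> C),
    (forall x, Ccont Q x) /\ joint_continuous W /\
    (forall x, seg b x -> Q x = q x) /\
    (forall x t, Defs.triangle b (x, t) -> kern h Q W x t = K x t) /\
    (forall x t, Defs.triangle b (x, t) ->
       W ((x + t) / 2)%R ((x - t) / 2)%R = Q x * kern h Q W x t).
Proof.
  intros Hb Hq [HKc HK].
  set (Q := fun x => q (clamp b x)).
  set (Kc := fun x t => K (clamp b x) (sym_clamp (clamp b x) t)).
  set (W := fun u v : R => Q (u + v)%R * Kc (u + v)%R (u - v)%R).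
  assert (CQ : forall x, Ccont Q x) by (exact (continuous_on_clamp b q Hb Hq)).
  assert (CK : joint_continuous Kc) by (apply joint_continuous_clamped; assumption).
  assert (CW : joint_continuous W) by (unfold W; intros x t; cont).
  assert (EQ : forall x, seg b x -> Q x = q x).
  { intros x Hx. unfold Q. rewrite clamp_id by exact Hx. reflexivity. }
  assert (EK : forall x t, Defs.triangle b (x, t) -> Kc x t = K x t).
  { intros x t [H1 H2]. simpl in H1, H2. unfold Kc.
    rewrite clamp_id, sym_clamp_id by assumption. reflexivity. }
  assert (EG : forall x t, Defs.triangle b (x, t) -> kern h Q W x t = K x t).
  { intros x t Hxt. rewrite (HK x t Hxt). destruct Hxt as [H1 H2]. simpl in H1, H2.
    apply Rabs_le_between in H2.
    unfold kern, goursat.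
    assert (E1 : CInt Q 0 ((x + t) / 2) = CInt q 0 ((x + t) / 2)).
    { apply CInt_ext. intros s Hs. rewrite Rmin_left, Rmax_right in Hs by lra.
      apply EQ. split; lra. }
    rewrite E1. apply (f_equal (Cplus _)).
    apply CInt_ext. intros u Hu. rewrite Rmin_left, Rmax_right in Hu by lra.
    apply CInt_ext. intros v Hv. rewrite Rmin_left, Rmax_right in Hv by lra.
    unfold W. rewrite EQ, EK; [reflexivity| |split; lra].
    split; simpl; [lra|]. apply Rabs_le_between. lra. }
  exists Q, W. repeat split; auto.
  intros x t Hxt. rewrite EG by exact Hxt. unfold W.
  replace ((x + t) / 2 + (x - t) / 2)%R with x by field.
  replace ((x + t) / 2 - (x - t) / 2)%R with t by field.
  rewrite EK by exact Hxt. reflexivity.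
Qed.

(** * The formal powers are the images of the powers *)

Lemma is_derive_inv_Re (p s : R -> R) (x dp ds : R) :
  is_derive p x dp -> is_derive s x ds -> (p x ^ 2 + s x ^ 2)%R <> 0%R ->
  is_derive (fun y => p y / (p y ^ 2 + s y ^ 2))%R x
    ((dp * (s x ^ 2 - p x ^ 2) - 2 * p x * s x * ds) / (p x ^ 2 + s x ^ 2) ^ 2)%R.
Proof.
  intros H1 H2 N.
  assert (X1 : ex_derive p x) by (exists dp; exact H1).
  assert (X2 : ex_derive s x) by (exists ds; exact H2).
  apply is_derive_unique in H1. apply is_derive_unique in H2.
  auto_derive; [repeat split; auto |
    change (Derive (fun y => p y) x = dp) in H1;
    change (Derive (fun y => s y) x = ds) in H2;
    rewrite H1, H2; field; auto].
Qed.

Lemma is_derive_inv_Im (p s : R -> R) (x dp ds : R) :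
  is_derive p x dp -> is_derive s x ds -> (p x ^ 2 + s x ^ 2)%R <> 0%R ->
  is_derive (fun y => - s y / (p y ^ 2 + s y ^ 2))%R x
    ((ds * (s x ^ 2 - p x ^ 2) + 2 * p x * s x * dp) / (p x ^ 2 + s x ^ 2) ^ 2)%R.
Proof.
  intros H1 H2 N.
  assert (X1 : ex_derive p x) by (exists dp; exact H1).
  assert (X2 : ex_derive s x) by (exists ds; exact H2).
  apply is_derive_unique in H1. apply is_derive_unique in H2.
  auto_derive; [repeat split; auto |
    change (Derive (fun y => p y) x = dp) in H1;
    change (Derive (fun y => s y) x = ds) in H2;
    rewrite H1, H2; field; auto].
Qed.

Lemma is_Cderive_inv (u : R -> C) (x : R) (l : C) :
  is_Cderive u x l -> u x <> 0 -> is_Cderive (fun y => / u y) x (- l / (u x) ^ 2).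
Proof.
  intros Hu H0.
  pose proof (is_Cderive_Re _ _ _ Hu) as H1. pose proof (is_Cderive_Im _ _ _ Hu) as H2.
  assert (N : (Re (u x) ^ 2 + Im (u x) ^ 2)%R <> 0%R).
  { intros E. apply H0.
    assert (Re (u x) = 0%R) by nra. assert (Im (u x) = 0%R) by nra.
    apply injective_projections; assumption. }
  assert (N2 : u x * u x <> 0) by (apply Cmult_neq_0; assumption).
  assert (E : - l / u x ^ 2 = - l * (Cconj (u x)) ^ 2 / (RtoC (Re (u x) ^ 2 + Im (u x) ^ 2)%R ^ 2)).
  { assert (E1 : RtoC (Re (u x) ^ 2 + Im (u x) ^ 2)%R = u x * Cconj (u x)).
    { apply injective_projections; unfold Re, Im; simpl; ring. }
    rewrite E1. field. split; [|exact H0].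
    intros F. apply N. apply (f_equal (fun z => Re (u x * z))) in F.
    revert F. unfold Re, Im; simpl. intros F. nra. }
  rewrite E. rewrite <- RtoC_pow.
  assert (N3 : ((Re (u x) ^ 2 + Im (u x) ^ 2) ^ 2)%R <> 0%R) by (apply pow_nonzero, N).
  unfold Cdiv. rewrite <- RtoC_inv by exact N3.
  apply is_Cderive_pair.
  - eapply eq_ind; [exact (is_derive_inv_Re _ _ x _ _ H1 H2 N)|].
    unfold Re, Im; simpl; field.
    contradict N; rewrite <- N; unfold Re, Im; ring.
  - eapply eq_ind; [exact (is_derive_inv_Im _ _ x _ _ H1 H2 N)|].
    unfold Re, Im; simpl; field.
    contradict N; rewrite <- N; unfold Re, Im; ring.
Qed.

Lemma Xpow_ext (b : R) (f F : R -> C) (n : nat) (x : R) :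
  (forall y, seg b y -> f y = F y) -> seg b x -> Xpow f n x = Xpow F n x.
Proof.
  intros E. revert x. induction n as [|n IH]; intros x Hx; [reflexivity|].
  simpl. f_equal. destruct Hx as [X1 X2]. apply CInt_ext. intros s Hs.
  rewrite Rmin_left, Rmax_right in Hs by exact X1.
  rewrite IH, E by (split; lra). reflexivity.
Qed.

Lemma Xtpow_ext (b : R) (f F : R -> C) (n : nat) (x : R) :
  (forall y, seg b y -> f y = F y) -> seg b x -> Xtpow f n x = Xtpow F n x.
Proof.
  intros E. revert x. induction n as [|n IH]; intros x Hx; [reflexivity|].
  simpl. f_equal. destruct Hx as [X1 X2]. apply CInt_ext. intros s Hs.
  rewrite Rmin_left, Rmax_right in Hs by exact X1.
  rewrite IH, E by (split; lra). reflexivity.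
Qed.

Lemma continuous_alt_pow (F : R -> C) (n : nat) (x : R) :
  (forall x, Ccont F x) -> (forall x, F x <> 0) ->
  Ccont (fun y => alt_pow (F y ^ 2) n) x.
Proof.
  intros CF NF. unfold alt_pow. destruct (Nat.even n).
  - cont.
  - apply continuous_Cinv; [cont|].
    apply Cpow_nz, NF.
Qed.

Lemma is_Cderive_Xpow (F : R -> C) (n : nat) (x : R) :
  (forall x, Ccont F x) -> (forall x, F x <> 0) ->
  is_Cderive (Xpow F n) x
    (INR n * (Xpow F (pred n) x * alt_pow (F x ^ 2) n)).
Proof.
  intros CF NF. revert x. induction n as [|n IH]; intros x.
  - simpl. replace (RtoC 0 * (1 * alt_pow (F x * (F x * 1)) 0)) with (RtoC 0) by ring.
    apply is_Cderive_const.
  - simpl pred. apply (is_Cderive_scal (INR (S n))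
      (fun x => CInt (fun s => Xpow F n s * alt_pow (F s ^ 2) (S n)) 0 x)).
    apply (is_Cderive_CInt (fun s => Xpow F n s * alt_pow (F s ^ 2) (S n))).
    intros y. apply continuous_Cmult.
    + eapply is_Cderive_continuous. apply IH.
    + apply continuous_alt_pow; assumption.
Qed.

Lemma is_Cderive_Xtpow (F : R -> C) (n : nat) (x : R) :
  (forall x, Ccont F x) -> (forall x, F x <> 0) ->
  is_Cderive (Xtpow F n) x
    (INR n * (Xtpow F (pred n) x * alt_pow (F x ^ 2) (pred n))).
Proof.
  intros CF NF. revert x. induction n as [|n IH]; intros x.
  - simpl. replace (RtoC 0 * (1 * alt_pow (F x * (F x * 1)) 0)) with (RtoC 0) by ring.
    apply is_Cderive_const.
  - simpl pred. apply (is_Cderive_scal (INR (S n))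
      (fun x => CInt (fun s => Xtpow F n s * alt_pow (F s ^ 2) n) 0 x)).
    apply (is_Cderive_CInt (fun s => Xtpow F n s * alt_pow (F s ^ 2) n)).
    intros y. apply continuous_Cmult.
    + eapply is_Cderive_continuous. apply IH.
    + apply continuous_alt_pow; assumption.
Qed.

(** [phi f k = f * formal_power f k], and [formal_power_pred f k] is the formal power that
    precedes [formal_power f k] in its own family, of index [k - 1]. *)
Definition formal_power (f : R -> C) (k : nat) (x : R) : C :=
  if Nat.odd k then Xpow f k x else Xtpow f k x.
Definition formal_power_pred (f : R -> C) (k : nat) (x : R) : C :=
  if Nat.odd k then Xpow f (pred k) x else Xtpow f (pred k) x.

Lemma is_Cderive_formal_power (F : R -> C) (k : nat) (x : R) :
  (forall x, Ccont F x) -> (forall x, F x <> 0) ->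
  is_Cderive (formal_power F k) x (INR k * formal_power_pred F k x / F x ^ 2).
Proof.
  intros CF NF. unfold formal_power, formal_power_pred.
  destruct (Nat.odd k) eqn:E.
  - replace (INR k * Xpow F (pred k) x / F x ^ 2)
      with (INR k * (Xpow F (pred k) x * alt_pow (F x ^ 2) k)).
    + apply is_Cderive_Xpow; assumption.
    + unfold alt_pow. rewrite <- Nat.negb_odd, E. simpl negb. cbv iota.
      unfold Cdiv. ring.
  - replace (INR k * Xtpow F (pred k) x / F x ^ 2)
      with (INR k * (Xtpow F (pred k) x * alt_pow (F x ^ 2) (pred k))).
    + apply is_Cderive_Xtpow; assumption.
    + destruct k as [|k].
      * simpl INR. unfold Cdiv. ring.
      * unfold alt_pow. simpl pred.
        rewrite Nat.odd_succ in E. rewrite E. unfold Cdiv. ring.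
Qed.

Lemma is_Cderive_formal_power_pred (F : R -> C) (k : nat) (x : R) :
  (forall x, Ccont F x) -> (forall x, F x <> 0) ->
  is_Cderive (formal_power_pred F (S (S k))) x (INR (S k) * (formal_power F k x * F x ^ 2)).
Proof.
  intros CF NF. unfold formal_power, formal_power_pred. simpl pred.
  replace (Nat.odd (S (S k))) with (Nat.odd k) by reflexivity.
  destruct (Nat.odd k) eqn:E.
  - replace (Xpow F k x * F x ^ 2) with (Xpow F (pred (S k)) x * alt_pow (F x ^ 2) (S k)).
    + apply is_Cderive_Xpow; assumption.
    + unfold alt_pow. rewrite Nat.even_succ, E. reflexivity.
  - replace (Xtpow F k x * F x ^ 2)
      with (Xtpow F (pred (S k)) x * alt_pow (F x ^ 2) (pred (S k))).
    + apply is_Cderive_Xtpow; assumption.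
    + unfold alt_pow. simpl pred. rewrite <- Nat.negb_odd, E. reflexivity.
Qed.

Lemma formal_power_0 (F : R -> C) (k : nat) : (0 < k)%nat -> formal_power F k 0 = 0.
Proof.
  intros Hk. unfold formal_power. destruct k as [|k]; [lia|].
  destruct (Nat.odd (S k)); simpl Xpow; simpl Xtpow; rewrite CInt_point; ring.
Qed.

Lemma formal_power_pred_0 (F : R -> C) (k : nat) : formal_power_pred F (S (S k)) 0 = 0.
Proof.
  unfold formal_power_pred. simpl pred.
  destruct (Nat.odd (S (S k))); simpl Xpow; simpl Xtpow; rewrite CInt_point; ring.
Qed.

Lemma transmute_0 h Q W (g : R -> C) : transmute h Q W g 0 = g 0%R.
Proof. unfold transmute. rewrite Ropp_0, CInt_point. ring. Qed.

Lemma transmute_d_0 h Q W (g dg : R -> C) :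
  transmute_d h Q W g dg 0 = dg 0%R + h * g 0%R.
Proof. unfold transmute_d. rewrite Ropp_0, !CInt_point. field. Qed.

(** If [T'' = q T + r] and [f'' = q f], then the Wronskian [f T' - f' T] has the derivative
    [f r], so it is [v], and then [T / f] has the derivative [v / f^2]. *)
Lemma reduction_of_order (b : R) (q f df T dT r v Y : R -> C) :
  (0 < b)%R ->
  (forall x, seg b x -> is_deriv b f x (df x)) ->
  (forall x, seg b x -> is_deriv b df x (q x * f x)) ->
  continuous_on (seg b) q ->
  (forall x, seg b x -> f x <> 0) ->
  f 0%R = 1 ->
  (forall x, seg b x -> is_Cderive T x (dT x)) ->
  (forall x, seg b x -> is_Cderive dT x (q x * T x + r x)) ->
  (forall x, seg b x -> is_Cderive v x (f x * r x)) ->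
  dT 0%R - df 0%R * T 0%R = v 0%R ->
  (forall x, seg b x -> is_Cderive Y x (v x / f x ^ 2)) ->
  T 0%R = Y 0%R ->
  forall x, seg b x -> T x = f x * Y x.
Proof.
  intros Hb Hf Hdf Hq Hf0 Hf1 HT HdT Hv Hv0 HY HY0.
  assert (S0 : seg b 0) by (split; lra).
  set (F := tangent_ext b f df). set (G := tangent_ext b df (fun x => q x * f x)).
  assert (Cdf := is_deriv_continuous_on b df _ Hdf).
  assert (Cf := is_deriv_continuous_on b f _ Hf).
  assert (Cqf : continuous_on (seg b) (fun x => q x * f x)).
  { intros x Hx. eapply filterlim_comp_2; [exact (Hq x Hx) | exact (Cf x Hx)|].
    assert (Z : @continuous (prod_UniformSpace C_UniformSpace C_UniformSpace) C_UniformSpace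
       (fun p : C * C => fst p * snd p) (q x, f x)) by cont.
    intros P HP. specialize (Z P HP). unfold filtermap in *.
    destruct Z as [d Hd].
    apply (Filter_prod _ _ _ (ball (q x) d) (ball (f x) d));
      [apply locally_ball | apply locally_ball|].
    intros y z Hy Hz. apply (Hd (y, z)). split; assumption. }
  assert (HF : forall x, seg b x -> is_Cderive F x (df x)).
  { intros x Hx. apply is_Cderive_tangent_ext; assumption. }
  assert (HG : forall x, seg b x -> is_Cderive G x (q x * f x)).
  { intros x Hx. apply (is_Cderive_tangent_ext b df (fun x => q x * f x)); assumption. }
  assert (EF : forall x, seg b x -> F x = f x) by (intros; apply tangent_ext_seg; auto).
  assert (EG : forall x, seg b x -> G x = df x) by (intros; apply tangent_ext_seg; auto).
  assert (HW : forall x, seg b x -> f x * dT x - df x * T x = v x).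
  { intros x Hx.
    assert (E : F x * dT x - G x * T x - v x = F 0%R * dT 0%R - G 0%R * T 0%R - v 0%R).
    { apply (is_Cderive_zero_const (fun x => F x * dT x - G x * T x - v x) 0 x).
      - apply Hx.
      - intros t Ht. assert (St : seg b t) by (destruct Hx; split; lra).
        replace (RtoC 0) with ((df t * dT t + F t * (q t * T t + r t))
          - (q t * f t * T t + G t * dT t) - f t * r t)
          by (rewrite EF, EG by exact St; ring).
        apply is_Cderive_minus; [apply is_Cderive_minus|].
        + apply is_Cderive_mult; auto.
        + apply is_Cderive_mult; auto.
        + auto. }
    rewrite EF, EG, (EF 0%R S0), (EG 0%R S0), Hf1, <- Hv0 in E by exact Hx.
    replace (f x * dT x - df x * T x) with ((f x * dT x - df x * T x - v x) + v x) by ring.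
    rewrite E. ring. }
  intros x Hx.
  assert (E : T x * / F x - Y x = T 0%R * / F 0%R - Y 0%R).
  { apply (is_Cderive_zero_const (fun x => T x * / F x - Y x) 0 x).
    - apply Hx.
    - intros t Ht. assert (St : seg b t) by (destruct Hx; split; lra).
      replace (RtoC 0) with (dT t * / F t + T t * (- df t / F t ^ 2) - v t / f t ^ 2).
      2:{ rewrite EF by exact St. rewrite <- HW by exact St. field. apply Hf0, St. }
      apply is_Cderive_minus; [apply is_Cderive_mult|].
      + auto.
      + apply is_Cderive_inv; [auto|]. rewrite EF by exact St. auto.
      + auto. }
  rewrite (EF 0%R S0), Hf1, HY0, EF in E by exact Hx.
  replace (Y 0%R * / 1 - Y 0%R) with (RtoC 0) in E by field.
  replace (T x) with (f x * (T x * / f x - Y x) + f x * Y x) by (field; auto).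
  rewrite E. ring.
Qed.

Lemma transmute_scal h Q W (c : C) (g : R -> C) (x : R) :
  (forall x, Ccont Q x) -> joint_continuous W -> (forall t, Ccont g t) ->
  transmute h Q W (fun t => c * g t) x = c * transmute h Q W g x.
Proof.
  intros HQ HW Hg. pose proof (joint_continuous_kern h Q W HQ HW). unfold transmute.
  rewrite (CInt_ext _ (fun t => c * (kern h Q W x t * g t))) by (intros; ring).
  rewrite CInt_scal by (intros; cont). ring.
Qed.

(** Induction in steps of two: with [r = k (k-1) phi_(k-2)] the two integrations of
    [reduction_of_order] are the two steps from [X^(k-2)] to [X^(k)]. *)
Lemma transmute_pow (b : R) (q f df Q : R -> C) (h : C) (W : R -> R -> C) (k : nat) :
  (0 < b)%R ->
  (forall x, seg b x -> is_deriv b f x (df x)) ->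
  (forall x, seg b x -> is_deriv b df x (q x * f x)) ->
  continuous_on (seg b) q ->
  (forall x, seg b x -> f x <> 0) ->
  f 0%R = 1 -> df 0%R = h ->
  (forall x, Ccont Q x) -> joint_continuous W ->
  (forall x, seg b x -> Q x = q x) ->
  (forall x t, Defs.triangle b (x, t) ->
     W ((x + t) / 2)%R ((x - t) / 2)%R = Q x * kern h Q W x t) ->
  forall x, seg b x -> transmute h Q W (fun t => RtoC t ^ k) x = phi f k x.
Proof.
  intros Hb Hf Hdf Hq Hf0 Hf1 Hh HQ HW EQ HWK.
  set (F := fun x => f (clamp b x)).
  assert (CF : forall x, Ccont F x).
  { exact (continuous_on_clamp b f Hb (is_deriv_continuous_on b f df Hf)). }
  assert (NF : forall x, F x <> 0) by (intros x; apply Hf0, clamp_seg, Hb).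
  assert (EF : forall x, seg b x -> f x = F x).
  { intros x Hx. unfold F. rewrite clamp_id by exact Hx. reflexivity. }
  assert (EP : forall k x, seg b x -> phi f k x = f x * formal_power F k x).
  { intros j x Hx. unfold phi, formal_power.
    destruct (Nat.odd j); f_equal;
      [apply (Xpow_ext b) | apply (Xtpow_ext b)]; assumption. }
  assert (Cp : forall j t, Ccont (fun t => RtoC t ^ j) t) by (intros; cont).
  assert (H1 : forall j x, is_Cderive (transmute h Q W (fun t => RtoC t ^ j)) x
     (transmute_d h Q W (fun t => RtoC t ^ j) (fun t => INR j * RtoC t ^ pred j) x)).
  { intros j x. apply is_Cderive_transmute; auto. intros. apply is_Cderive_pow. }
  assert (H2 : forall j x, seg b x ->
     is_Cderive (transmute_d h Q W (fun t => RtoC t ^ j) (fun t => INR j * RtoC t ^ pred j)) x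
     (q x * transmute h Q W (fun t => RtoC t ^ j) x
       + INR j * (INR (pred j) * transmute h Q W (fun t => RtoC t ^ pred (pred j)) x))).
  { intros j x Hx. rewrite <- EQ by exact Hx.
    rewrite <- (transmute_scal h Q W (INR (pred j))) by (try assumption; intros; cont).
    rewrite <- (transmute_scal h Q W (INR j)) by (try assumption; intros; cont).
    apply is_Cderive_transmute_d; auto.
    - intros. apply is_Cderive_pow.
    - intros. apply is_Cderive_scal, is_Cderive_pow.
    - intros. cont.
    - apply Hx.
    - intros t Ht. apply HWK. split; [exact Hx|]. apply Rabs_le_between, Ht. }
  assert (H0 : forall x, seg b x ->
     transmute h Q W (fun t => RtoC t ^ k) x = f x * formal_power F k x /\
     transmute h Q W (fun t => RtoC t ^ S k) x = f x * formal_power F (S k) x).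
  2:{ intros x Hx. rewrite EP by exact Hx. apply H0, Hx. }
  clear EP. induction k as [|k IH].
  - intros x Hx. split.
    + apply (reduction_of_order b q f df _ _ (fun _ => 0) (fun _ => 0) (formal_power F 0) Hb Hf Hdf
        Hq Hf0 Hf1 (fun x _ => H1 0%nat x)); auto.
      * intros y Hy. eapply eq_ind; [exact (H2 0%nat y Hy)|]. simpl INR. ring.
      * intros y Hy. replace (f y * 0) with (RtoC 0) by ring. apply is_Cderive_const.
      * rewrite transmute_d_0, transmute_0, Hh. simpl. ring.
      * intros y Hy. replace (0 / f y ^ 2) with (INR 0 * formal_power_pred F 0 y / F y ^ 2)
          by (simpl INR; unfold Cdiv; ring).
        apply is_Cderive_formal_power; assumption.
      * rewrite transmute_0. reflexivity.
    + apply (reduction_of_order b q f df _ _ (fun _ => 0) (fun _ => 1) (formal_power F 1) Hb Hf Hdf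
        Hq Hf0 Hf1 (fun x _ => H1 1%nat x)); auto.
      * intros y Hy. eapply eq_ind; [exact (H2 1%nat y Hy)|]. simpl INR. ring.
      * intros y Hy. replace (f y * 0) with (RtoC 0) by ring. apply is_Cderive_const.
      * rewrite transmute_d_0, transmute_0, Hh. simpl. ring.
      * intros y Hy. replace (1 / f y ^ 2) with (INR 1 * formal_power_pred F 1 y / F y ^ 2)
          by (rewrite EF by exact Hy; unfold formal_power_pred; simpl; unfold Cdiv; ring).
        apply is_Cderive_formal_power; assumption.
      * rewrite transmute_0, formal_power_0 by lia. simpl. ring.
  - intros x Hx. split; [apply IH, Hx|].
    apply (reduction_of_order b q f df _ _
      (fun y => INR (S (S k)) * (INR (S k) * (f y * formal_power F k y)))
      (fun y => INR (S (S k)) * formal_power_pred F (S (S k)) y) (formal_power F (S (S k))) Hb Hf Hdf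
        Hq Hf0 Hf1 (fun x _ => H1 (S (S k)) x)); auto.
    + intros y Hy. eapply eq_ind; [exact (H2 (S (S k)) y Hy)|].
      simpl pred. rewrite (proj1 (IH y Hy)). reflexivity.
    + intros y Hy. replace (f y * (INR (S (S k)) * (INR (S k) * (f y * formal_power F k y))))
        with (INR (S (S k)) * (INR (S k) * (formal_power F k y * F y ^ 2)))
        by (rewrite <- EF by exact Hy; ring).
      apply is_Cderive_scal, is_Cderive_formal_power_pred; assumption.
    + rewrite transmute_d_0, transmute_0, formal_power_pred_0. simpl. ring.
    + intros y Hy. rewrite (EF y Hy). apply is_Cderive_formal_power; assumption.
    + rewrite transmute_0, formal_power_0 by lia. simpl. ring.
Qed.

(** * The Gamma function at half-integers *)

Lemma exp_ge_pow_div_fact (x : R) (n : nat) :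
  (0 <= x)%R -> (x ^ n / INR (Factorial.fact n) <= exp x)%R.
Proof.
  intros Hx. eapply Rle_trans; [|apply (exp_ge_taylor x n Hx)].
  assert (P : forall k, (0 <= x ^ k / INR (Factorial.fact k))%R).
  { intros k. apply Rdiv_le_0_compat; [apply pow_le, Hx | apply INR_fact_lt_0]. }
  destruct n as [|n]; simpl sum_f_R0; [apply Rle_refl|].
  assert (0 <= sum_f_R0 (fun k => x ^ k / INR (Factorial.fact k)) n)%R
    by (apply cond_pos_sum; exact P).
  simpl in *; lra.
Qed.

Definition gauss_int (x : R) : R := RInt (fun u => exp (- u ^ 2))%R 0 x.

Lemma continuous_gauss (x : R) : continuous (fun u => exp (- u ^ 2))%R x.
Proof.
  apply ex_derive_continuous_R.
  auto_derive. exact I.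
Qed.

Lemma is_derive_gauss_int (x : R) : is_derive gauss_int x (exp (- x ^ 2))%R.
Proof.
  apply (is_derive_RInt (V := R_NormedModule) (fun u => exp (- u ^ 2))%R gauss_int 0 x).
  - apply filter_forall. intros y. apply (RInt_correct (V := R_CompleteNormedModule)).
    apply ex_RInt_continuous_R. intros.
    apply continuous_gauss.
  - apply continuous_gauss.
Qed.

Lemma gauss_int_0 : gauss_int 0 = 0%R.
Proof. exact (RInt_point (V := R_CompleteNormedModule) 0%R _). Qed.

Lemma gauss_int_ge_0 (x : R) : (0 <= x)%R -> (0 <= gauss_int x)%R.
Proof.
  intros Hx. apply RInt_ge_0; [exact Hx| |].
  - apply ex_RInt_continuous_R. intros.
    apply continuous_gauss.
  - intros. apply Rlt_le, exp_pos.
Qed.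

(** Its derivative is opposite to that of the square of [gauss_int], and it tends to 0
    at infinity; this evaluates the Gaussian integral. *)
Definition gauss_rest (x : R) : R :=
  RInt (fun t => exp (- (x ^ 2 * (1 + t ^ 2))) / (1 + t ^ 2))%R 0 1.

Lemma one_plus_sq_pos (t : R) : (0 < 1 + t ^ 2)%R.
Proof. nra. Qed.

Lemma continuous_gauss_rest (x t : R) :
  continuous (fun t => exp (- (x ^ 2 * (1 + t ^ 2))) / (1 + t ^ 2))%R t.
Proof.
  apply ex_derive_continuous_R.
  auto_derive. pose proof (one_plus_sq_pos t). simpl in *. lra.
Qed.

Lemma RInt_gauss_scaled (x : R) :
  RInt (fun t => x * exp (- (x * t) ^ 2))%R 0 1 = gauss_int x.
Proof.
  replace (gauss_int x) with (minus (gauss_int (x * 1)) (gauss_int (x * 0)) : R).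
  2:{ rewrite Rmult_1_r, Rmult_0_r, gauss_int_0. cbn. unfold plus; simpl. ring. }
  apply is_RInt_unique.
  apply (is_RInt_derive (V := R_CompleteNormedModule) (fun t => gauss_int (x * t))).
  - intros t _.
    eapply eq_ind; [|reflexivity].
    apply (is_derive_comp (K := R_AbsRing) (V := R_NormedModule) gauss_int
      (fun t => x * t)%R t (exp (- (x * t) ^ 2)) x).
    + apply is_derive_gauss_int.
    + auto_derive; [exact I | ring].
  - intros t _. apply ex_derive_continuous_R.
    auto_derive. exact I.
Qed.

Lemma is_derive_gauss_rest (x : R) :
  is_derive gauss_rest x (- 2 * exp (- x ^ 2) * gauss_int x)%R.
Proof.
  replace (- 2 * exp (- x ^ 2) * gauss_int x)%R with
    (RInt (fun t => - 2 * x * exp (- (x ^ 2 * (1 + t ^ 2))))%R 0 1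
     + 0 * (exp (- (x ^ 2 * (1 + 1 ^ 2))) / (1 + 1 ^ 2)))%R.
  - apply (is_derive_RInt_param_bound_r
      (fun x t => exp (- (x ^ 2 * (1 + t ^ 2))) / (1 + t ^ 2))%R
      (fun x t => - 2 * x * exp (- (x ^ 2 * (1 + t ^ 2))))%R (fun _ => 1%R) x 0).
    + intros y t. pose proof (one_plus_sq_pos t).
      auto_derive; [exact I|]. simpl in *; field; lra.
    + intros y t. apply continuity_2d_pt_filterlim. simpl pow.
      apply (continuous_Rmult (fun z : R * R => - 2 * fst z)%R
        (fun z : R * R => exp (- (fst z * (fst z * 1) * (1 + snd z * (snd z * 1)))))%R).
      * cont.
      * apply (continuous_comp (fun z : R * R =>
          - (fst z * (fst z * 1) * (1 + snd z * (snd z * 1))))%R exp);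
          [cont | apply continuous_exp].
    + intros y t. apply continuous_gauss_rest.
    + exact (is_derive_const (K := R_AbsRing) (V := R_NormedModule) 1%R x).
  - rewrite <- RInt_gauss_scaled.
    rewrite Rmult_0_l, Rplus_0_r.
    rewrite (RInt_ext _ (fun t => scal (- 2 * exp (- x ^ 2)) (x * exp (- (x * t) ^ 2)))%R).
    + rewrite (RInt_scal (V := R_CompleteNormedModule)); [reflexivity|].
      apply ex_RInt_continuous_R. intros.
      apply ex_derive_continuous_R.
      auto_derive. exact I.
    + intros t _. cbn. unfold mult; simpl.
      replace (- (x * (x * 1) * (1 + t * (t * 1))))%R
        with (- (x * (x * 1)) + - (x * t * (x * t * 1)))%R by ring.
      rewrite exp_plus. ring.
Qed.

(** At 0 the sum is the integral of [1 / (1 + t^2)] over [0,1]. *)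
Lemma gauss_int_sq (x : R) : (0 <= x)%R -> (gauss_int x ^ 2 + gauss_rest x = PI / 4)%R.
Proof.
  intros Hx.
  assert (E0 : (gauss_int 0 ^ 2 + gauss_rest 0 = PI / 4)%R).
  { rewrite gauss_int_0. unfold gauss_rest.
    rewrite (RInt_ext _ (fun t => / (1 + Rsqr t))%R).
    - assert (HI : is_RInt (fun t => / (1 + Rsqr t))%R 0 1 (minus (atan 1) (atan 0))).
      { apply (is_RInt_derive (V := R_CompleteNormedModule) atan).
        - intros. apply is_derive_atan.
        - intros t _. apply ex_derive_continuous_R.
          unfold Rsqr. auto_derive. pose proof (one_plus_sq_pos t). simpl in *. lra. }
      pose proof (is_RInt_unique (V := R_CompleteNormedModule) _ _ _ _ HI) as HI2. 
      rewrite HI2, atan_1, atan_0. cbn. unfold plus; simpl. ring.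
    - intros t _. unfold Rsqr.
      replace (- (0 ^ 2 * (1 + t ^ 2)))%R with 0%R by ring.
      rewrite exp_0. unfold Rdiv. rewrite Rmult_1_l. f_equal. ring. }
  destruct Hx as [Hx|<-]; [|exact E0]. rewrite <- E0. symmetry.
  apply (eq_is_derive (V := R_NormedModule) (fun x => gauss_int x ^ 2 + gauss_rest x)%R 0 x);
    [|exact Hx].
  intros t _.
  eapply eq_ind.
  - apply (is_derive_plus (K := R_AbsRing) (V := R_NormedModule)
      (fun t => gauss_int t ^ 2)%R gauss_rest).
    + apply (is_derive_pow gauss_int 2). apply is_derive_gauss_int.
    + apply is_derive_gauss_rest.
  - cbn. unfold plus; simpl. unfold zero; simpl. ring.
Qed.

Lemma gauss_rest_bounds (x : R) : (0 <= gauss_rest x <= exp (- x ^ 2))%R.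
Proof.
  assert (EX : ex_RInt (fun t => exp (- (x ^ 2 * (1 + t ^ 2))) / (1 + t ^ 2))%R 0 1).
  { apply ex_RInt_continuous_R. intros.
    apply continuous_gauss_rest. }
  assert (B : forall t, (0 <= exp (- (x ^ 2 * (1 + t ^ 2))) / (1 + t ^ 2)
     <= exp (- x ^ 2))%R).
  { intros t. pose proof (one_plus_sq_pos t).
    split; [apply Rdiv_le_0_compat; [apply Rlt_le, exp_pos | assumption]|].
    apply Rle_div_l; [assumption|].
    assert (exp (- (x ^ 2 * (1 + t ^ 2))) <= exp (- x ^ 2))%R.
    { assert (L : (- (x ^ 2 * (1 + t ^ 2)) <= - x ^ 2)%R) by nra.
      apply exp_le, L. }
    pose proof (exp_pos (- x ^ 2)). nra. }
  split.
  - apply RInt_ge_0; [lra | exact EX|]. intros. apply B.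
  - replace (exp (- x ^ 2)) with (RInt (fun _ => exp (- x ^ 2)) 0 1).
    + apply RInt_le; [lra | exact EX | apply ex_RInt_const|]. intros. apply B.
    + rewrite RInt_const. cbn. unfold mult; simpl. ring.
Qed.

(** [e^t] dominates one more power of [t]. *)
Lemma is_lim_pow_mult_exp_opp (n : nat) :
  is_lim (fun t => t ^ n * exp (- t))%R p_infty 0.
Proof.
  set (c := INR (Factorial.fact (S n))).
  apply (is_lim_le_le_loc (fun _ => 0%R) (fun t => c * / t)%R).
  - exists 0%R. intros t Ht.
    assert (B := exp_ge_pow_div_fact t (S n) (Rlt_le _ _ Ht)).
    apply Rle_div_l in B; [|apply INR_fact_lt_0]. fold c in B.
    assert (P : (0 < t ^ n)%R) by (apply pow_lt, Ht).
    pose proof (exp_pos t). pose proof (exp_pos (- t)).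
    assert (E : (exp t * exp (- t) = 1)%R) by (rewrite <- exp_plus, Rplus_opp_r; apply exp_0).
    split; [nra|].
    apply (Rle_div_r _ _ t Ht).
    replace (t ^ n * exp (- t) * t)%R with (t ^ S n * exp (- t))%R by (simpl; ring).
    apply Rle_trans with (exp t * c * exp (- t))%R.
    + apply Rmult_le_compat_r; lra.
    + right. replace (exp t * c * exp (- t))%R with (c * (exp t * exp (- t)))%R by ring.
      rewrite E. ring.
  - apply is_lim_const.
  - replace (Finite 0) with (Rbar_mult c 0) by (simpl; f_equal; ring).
    apply is_lim_scal_l.
    apply (is_lim_ext (fun y => / y)%R); [reflexivity|].
    apply (is_lim_inv (fun y => y) p_infty p_infty); [apply is_lim_id | discriminate].
Qed.

Lemma is_lim_gauss_int_sqrt : is_lim (fun t => 2 * gauss_int (sqrt t))%R p_infty (sqrt PI).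
Proof.
  assert (L : is_lim (fun t => gauss_int (sqrt t) ^ 2)%R p_infty (PI / 4)%R).
  { apply (is_lim_le_le_loc (fun t => PI / 4 - t ^ 0 * exp (- t))%R (fun _ => PI / 4)%R).
    - exists 0%R. intros t Ht.
      pose proof (gauss_int_sq (sqrt t) (sqrt_pos t)) as E.
      pose proof (gauss_rest_bounds (sqrt t)) as B.
      rewrite pow2_sqrt in B by lra. simpl pow at 1. lra.
    - replace (Finite (PI / 4)) with (Finite (PI / 4 - 0)) by (f_equal; ring).
      apply (is_lim_minus' (fun _ => PI / 4)%R _ p_infty); [apply is_lim_const|].
      apply is_lim_pow_mult_exp_opp.
    - apply is_lim_const. }
  replace (sqrt PI) with (2 * sqrt (PI / 4))%R.
  2:{ rewrite sqrt_div_alt by lra. replace 4%R with (2 ^ 2)%R by ring.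
      rewrite sqrt_pow2 by lra. field. }
  apply (is_lim_ext_loc (fun t => 2 * sqrt (gauss_int (sqrt t) ^ 2))%R).
  { exists 0%R. intros t _. rewrite sqrt_pow2; [reflexivity|].
    apply gauss_int_ge_0, sqrt_pos. }
  apply (is_lim_scal_l _ 2 p_infty (sqrt (PI / 4))).
  apply (is_lim_comp_continuous (fun t => gauss_int (sqrt t) ^ 2)%R sqrt p_infty (PI / 4)%R L).
  apply continuous_sqrt.
Qed.

(** An antiderivative of [t^(j-1/2) e^(-t)] on the positive half-line, by
    repeated integration by parts. *)
Fixpoint gamma_primitive (j : nat) (t : R) : R :=
  match j with
  | O => 2 * gauss_int (sqrt t)
  | S i => - (Rpower t (INR i + / 2) * exp (- t)) + (INR i + / 2) * gamma_primitive i t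
  end.

(** Limit at infinity of the primitive: the value of the Gamma function at [j + 1/2]. *)
Fixpoint gamma_half (j : nat) : R :=
  match j with
  | O => sqrt PI
  | S i => (INR i + / 2) * gamma_half i
  end.

Lemma is_derive_Rpower_exp (a t : R) : (0 < t)%R ->
  is_derive (fun t => Rpower t a * exp (- t))%R t
    (a * Rpower t (a - 1) * exp (- t) - Rpower t a * exp (- t))%R.
Proof.
  intros Ht.
  eapply eq_ind.
  - apply (is_derive_mult (K := R_AbsRing) (fun t => Rpower t a) (fun t => exp (- t))).
    + apply is_derive_Reals, derivable_pt_lim_power, Ht.
    + apply (is_derive_comp (K := R_AbsRing) (V := R_NormedModule) exp Ropp t
        (exp (- t)) (-1)%R).
      * apply is_derive_exp.
      * auto_derive; [exact I | ring].
    + intros; apply Rmult_comm.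
  - cbn. unfold plus, mult; simpl. unfold mult; simpl. ring.
Qed.

Lemma is_derive_gamma_primitive (j : nat) (t : R) : (0 < t)%R ->
  is_derive (gamma_primitive j) t (Rpower t (INR j - / 2) * exp (- t))%R.
Proof.
  intros Ht. induction j as [|j IH].
  - simpl gamma_primitive. assert (St := sqrt_lt_R0 t Ht).
    replace (Rpower t (INR 0 - / 2) * exp (- t))%R
      with (2 * (/ (2 * sqrt t) * exp (- sqrt t ^ 2)))%R.
    + apply (is_derive_scal (fun t => gauss_int (sqrt t)) t 2).
      apply (is_derive_comp (K := R_AbsRing) (V := R_NormedModule) gauss_int sqrt t).
      * apply is_derive_gauss_int.
      * apply is_derive_Reals, derivable_pt_lim_sqrt, Ht.
    + rewrite pow2_sqrt by lra. simpl INR.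
      replace (0 - / 2)%R with (- / 2)%R by ring.
      rewrite Rpower_Ropp, Rpower_sqrt by exact Ht. field. lra.
  - simpl gamma_primitive.
    replace (Rpower t (INR (S j) - / 2) * exp (- t))%R with
      (- ((INR j + / 2) * Rpower t (INR j + / 2 - 1) * exp (- t)
         - Rpower t (INR j + / 2) * exp (- t))
       + (INR j + / 2) * (Rpower t (INR j - / 2) * exp (- t)))%R.
    + apply (is_derive_plus (K := R_AbsRing) (V := R_NormedModule)
        (fun t => - (Rpower t (INR j + / 2) * exp (- t)))%R
        (fun t => (INR j + / 2) * gamma_primitive j t)%R).
      * apply (is_derive_opp (K := R_AbsRing) (V := R_NormedModule)
          (fun t => Rpower t (INR j + / 2) * exp (- t))%R).
        apply is_derive_Rpower_exp, Ht.
      * apply is_derive_scal, IH.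
    + rewrite S_INR. replace (INR j + / 2 - 1)%R with (INR j - / 2)%R by field.
      replace (INR j + 1 - / 2)%R with (INR j + / 2)%R by field. ring.
Qed.

Lemma Rpower_half_le_1 (t : R) (j : nat) :
  (0 < t < 1)%R -> (0 <= Rpower t (INR j + / 2) <= sqrt t)%R.
Proof.
  intros Ht. split; [unfold Rpower; apply Rlt_le, exp_pos|].
  rewrite Rpower_plus, Rpower_pow, Rpower_sqrt by lra.
  assert (t ^ j <= 1)%R.
  { rewrite <- (pow1 j). apply pow_incr. lra. }
  pose proof (sqrt_pos t). nra.
Qed.

Lemma Rpower_half_ge_1 (t : R) (j : nat) :
  (1 < t)%R -> (0 <= Rpower t (INR j + / 2) <= t ^ S j)%R.
Proof.
  intros Ht. split; [unfold Rpower; apply Rlt_le, exp_pos|].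
  rewrite <- Rpower_pow by lra. apply Rle_Rpower; [lra|].
  rewrite S_INR. lra.
Qed.

Lemma gamma_primitive_lim_0 (j : nat) :
  filterlim (gamma_primitive j) (at_right 0) (locally 0%R).
Proof.
  assert (S : filterlim sqrt (at_right 0) (locally 0%R)).
  { apply (filterlim_filter_le_1 (F := locally 0%R)).
    - intros P HP. unfold at_right, within. revert HP. apply filter_imp. auto.
    - rewrite <- sqrt_0 at 2. apply continuous_sqrt. }
  induction j as [|j IH].
  - simpl. apply (filterlim_comp _ _ _ sqrt (fun s => 2 * gauss_int s)%R _ _ _ S).
    assert (H : continuous (fun s => 2 * gauss_int s)%R 0).
    { apply ex_derive_continuous_R.
      eexists. apply (is_derive_scal gauss_int 0 2). apply is_derive_gauss_int. }
    unfold continuous in H. rewrite gauss_int_0, Rmult_0_r in H. exact H.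
  - simpl.
    replace 0%R with (plus (opp 0) (scal (INR j + / 2) 0))%R at 2
      by (cbn; unfold mult, plus; simpl; ring).
    eapply filterlim_comp_2.
    + eapply filterlim_comp; [|apply (filterlim_opp (K := R_AbsRing) (V := R_NormedModule))].
      apply (filterlim_le_le (fun _ => 0%R) (fun t => Rpower t (INR j + / 2) * exp (- t))%R
        sqrt (Finite 0)).
      * exists (mkposreal 1 Rlt_0_1). intros t Hb Ht.
        change (Rabs (t - 0) < 1)%R in Hb. rewrite Rminus_0_r, Rabs_pos_eq in Hb by lra.
        pose proof (Rpower_half_le_1 t j (conj Ht Hb)).
        assert (exp (- t) <= 1)%R.
        { rewrite <- exp_0. left. apply exp_increasing. lra. }
        pose proof (exp_pos (- t)). nra.
      * apply filterlim_const.
      * exact S.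
    + eapply filterlim_comp; [exact IH|].
      apply (filterlim_scal_r (K := R_AbsRing) (V := R_NormedModule) (INR j + / 2)%R 0%R).
    + apply (filterlim_plus (K := R_AbsRing) (V := R_NormedModule)).
Qed.

Lemma gamma_primitive_lim_infty (j : nat) :
  is_lim (gamma_primitive j) p_infty (gamma_half j).
Proof.
  induction j as [|j IH].
  - exact is_lim_gauss_int_sqrt.
  - simpl.
    replace (Finite ((INR j + / 2) * gamma_half j))
      with (Finite (- 0 + (INR j + / 2) * gamma_half j)) by (f_equal; ring).
    apply (is_lim_plus' (fun t => - (Rpower t (INR j + / 2) * exp (- t)))%R
      (fun t => (INR j + / 2) * gamma_primitive j t)%R).
    + apply (is_lim_opp (fun t => Rpower t (INR j + / 2) * exp (- t))%R p_infty 0).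
      apply (is_lim_le_le_loc (fun _ => 0%R) (fun t => t ^ S j * exp (- t))%R).
      * exists 1%R. intros t Ht.
        pose proof (Rpower_half_ge_1 t j Ht). pose proof (exp_pos (- t)). nra.
      * apply is_lim_const.
      * apply is_lim_pow_mult_exp_opp.
    + apply (is_lim_scal_l (gamma_primitive j) (INR j + / 2) p_infty (gamma_half j) IH).
Qed.

Lemma Gamma_half (j : nat) : Gamma (INR j + / 2) = gamma_half j.
Proof.
  unfold Gamma. apply is_RInt_gen_unique.
  assert (P : filter_prod (at_right 0) (Rbar_locally p_infty) (fun ab : R * R =>
    forall x, (Rmin (fst ab) (snd ab) <= x <= Rmax (fst ab) (snd ab))%R -> (0 < x)%R)).
  { apply (Filter_prod _ _ _ (fun a => 0 < a)%R (fun c => 0 < c)%R).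
    - exists (mkposreal 1 Rlt_0_1). auto.
    - exists 0%R. auto.
    - intros a c Ha Hc x [Hx _]. simpl in Hx.
      eapply Rlt_le_trans; [|exact Hx]. apply Rmin_pos; assumption. }
  assert (D : forall t, (0 < t)%R ->
     Derive (gamma_primitive j) t = (Rpower t (INR j - / 2) * exp (- t))%R).
  { intros t Ht. apply is_derive_unique, is_derive_gamma_primitive, Ht. }
  replace (gamma_half j) with (gamma_half j - 0)%R by ring.
  apply (is_RInt_gen_ext (Derive (gamma_primitive j))).
  - revert P. apply filter_imp. intros [a c] H x Hx. simpl in *.
    rewrite D by (apply H; lra).
    replace (INR j + / 2 - 1)%R with (INR j - / 2)%R by field. reflexivity.
  - apply is_RInt_gen_Derive.
    + revert P. apply filter_imp. intros [a c] H x Hx.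
      eexists. apply is_derive_gamma_primitive. apply H, Hx.
    + revert P. apply filter_imp. intros [a c] H x Hx.
      assert (Px : (0 < x)%R) by (apply H, Hx).
      apply (continuous_ext_loc _ (fun t => Rpower t (INR j - / 2) * exp (- t))%R).
      * exists (mkposreal x Px). intros y Hy. symmetry. apply D.
        change (Rabs (y - x) < x)%R in Hy. apply Rabs_lt_between in Hy. lra.
      * apply ex_derive_continuous_R.
        eexists. apply is_derive_Rpower_exp, Px.
    + apply gamma_primitive_lim_0.
    + apply gamma_primitive_lim_infty.
Qed.

Lemma gamma_half_fact (j : nat) :
  gamma_half j = (sqrt PI * INR (Factorial.fact (2 * j))
     / (4 ^ j * INR (Factorial.fact j)))%R.
Proof.
  induction j as [|j IH].
  - simpl. field.
  - simpl gamma_half. rewrite IH.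
    replace (2 * S j)%nat with (S (S (2 * j))) by lia.
    rewrite !fact_simpl, !mult_INR, !S_INR, mult_INR. simpl pow. simpl (INR 2).
    field. repeat split; try apply INR_fact_neq_0; try (apply pow_nonzero; lra).
    pose proof (pos_INR j). lra.
Qed.

(** * Finite sums and series of complex numbers *)

Lemma Csum_0 (a : nat -> C) : Csum a 0 = a 0%nat.
Proof. exact (sum_O (G := C_AbelianMonoid) a). Qed.

Lemma Csum_S (a : nat -> C) (n : nat) : Csum a (S n) = Csum a n + a (S n).
Proof. exact (sum_Sn (G := C_AbelianMonoid) a n). Qed.

Lemma Csum_ext (a c : nat -> C) (n : nat) :
  (forall k, (k <= n)%nat -> a k = c k) -> Csum a n = Csum c n.
Proof. exact (sum_n_ext_loc (G := C_AbelianMonoid) a c n). Qed.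

Lemma Csum_scal (z : C) (a : nat -> C) (n : nat) :
  Csum (fun k => z * a k) n = z * Csum a n.
Proof.
  induction n as [|n IH]; [rewrite !Csum_0 | rewrite !Csum_S, IH]; ring.
Qed.

Lemma Csum_plus (a c : nat -> C) (n : nat) :
  Csum (fun k => a k + c k) n = Csum a n + Csum c n.
Proof.
  induction n as [|n IH]; [rewrite !Csum_0 | rewrite !Csum_S, IH]; ring.
Qed.

Lemma Csum_minus (a c : nat -> C) (n : nat) :
  Csum (fun k => a k - c k) n = Csum a n - Csum c n.
Proof.
  induction n as [|n IH]; [rewrite !Csum_0 | rewrite !Csum_S, IH]; ring.
Qed.

Lemma Csum_RtoC (a : nat -> R) (n : nat) :
  RtoC (sum_f_R0 a n) = Csum (fun k => RtoC (a k)) n.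
Proof.
  induction n as [|n IH]; [symmetry; apply Csum_0|].
  rewrite Csum_S, <- IH. simpl. apply RtoC_plus.
Qed.

Lemma Cmod_Csum_le (a : nat -> C) (r : nat -> R) (n : nat) :
  (forall k, (k <= n)%nat -> (Cmod (a k) <= r k)%R) ->
  (Cmod (Csum a n) <= sum_f_R0 r n)%R.
Proof.
  intros H. induction n as [|n IH].
  - rewrite Csum_0. apply H. lia.
  - rewrite Csum_S. eapply Rle_trans; [apply Cmod_triangle|]. simpl.
    apply Rplus_le_compat; [apply IH; intros; apply H; lia | apply H; lia].
Qed.

Lemma Csum_triangle (g : nat -> nat -> C) (N : nat) :
  Csum (fun m => Csum (fun n => g n (m - n)%nat) m) N =
  Csum (fun n => Csum (g n) (N - n)) N.
Proof.
  induction N as [|N IH].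
  - rewrite !Csum_0. reflexivity.
  - rewrite (Csum_S _ N), IH, !(Csum_S _ N).
    replace (S N - S N)%nat with 0%nat by lia. rewrite Csum_0.
    rewrite (Csum_ext (fun n => Csum (g n) (S N - n))
      (fun n => Csum (g n) (N - n) + g n (S N - n)%nat)).
    + rewrite Csum_plus. ring.
    + intros n Hn. replace (S N - n)%nat with (S (N - n)) by lia. apply Csum_S.
Qed.

Definition is_Cseries (a : nat -> C) (l : C) : Prop :=
  is_series (K := C_AbsRing) (V := C_NormedModule) a l.

Lemma is_Cseries_eps (a : nat -> C) (l : C) :
  is_Cseries a l <-> forall eps, (0 < eps)%R -> exists N, forall n, (N <= n)%nat ->
    (Cmod (Csum a n - l) < eps)%R.
Proof.
  split.
  - intros H eps He.
    assert (He2 : (0 < eps / 2)%R) by lra.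
    destruct (H _ (locally_ball l (mkposreal _ He2))) as [N HN].
    exists N. intros n Hn. specialize (HN n Hn).
    apply C_NormedModule_mixin_compat2 in HN.
    change (Cmod (Csum a n - l) < sqrt 2 * (eps / 2))%R in HN.
    assert (sqrt 2 <= 2)%R.
    { rewrite <- (sqrt_pow2 2) at 2 by lra. apply sqrt_le_1; lra. }
    nra.
  - intros H P [eps HP]. destruct (H eps (cond_pos eps)) as [N HN].
    exists N. intros n Hn. apply HP.
    apply (C_NormedModule_mixin_compat1 l (Csum a n)). apply HN, Hn.
Qed.

Lemma is_Cseries_unique (a : nat -> C) (l m : C) :
  is_Cseries a l -> is_Cseries a m -> l = m.
Proof.
  intros Hl Hm.
  exact (filterlim_locally_unique (K := C_AbsRing) (V := C_NormedModule)
    (F := eventually) (sum_n a) l m Hl Hm).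
Qed.

Lemma CSeries_eq (a : nat -> C) (l : C) : is_Cseries a l -> CSeries a = l.
Proof.
  intros H.
  apply (iota_unique (K := R_AbsRing) (V := C_R_CompleteNormedModule)).
  - intros y Hy. apply (is_Cseries_unique a); assumption.
  - exact H.
Qed.

Lemma is_Cseries_scal (z : C) (a : nat -> C) (l : C) :
  is_Cseries a l -> is_Cseries (fun n => z * a n) (z * l).
Proof. exact (is_series_scal (K := C_AbsRing) (V := C_NormedModule) z a l). Qed.

Lemma is_Cseries_ext (a c : nat -> C) (l : C) :
  (forall n, a n = c n) -> is_Cseries a l -> is_Cseries c l.
Proof. exact (is_series_ext (K := C_AbsRing) (V := C_NormedModule) a c l). Qed.

Lemma Cseries_geom_cv (a : nat -> C) (M r : R) :
  (Rabs r < 1)%R -> (forall n, (Cmod (a n) <= M * r ^ n)%R) -> exists l, is_Cseries a l.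
Proof.
  intros Hr H.
  apply (ex_series_le (K := C_AbsRing) (V := C_CompleteNormedModule) a (fun n => M * r ^ n)%R).
  - exact H.
  - apply (ex_series_scal (K := R_AbsRing) (V := R_NormedModule) M (fun n => r ^ n)%R).
    exists (/ (1 - r))%R. apply is_series_geom, Hr.
Qed.

(** For [r <= 1/2] the sum of the [r^n] with [n > N] is at most [r^N]. *)
Lemma Cseries_geom_tail (a : nat -> C) (l : C) (M r : R) (N : nat) :
  (0 <= r <= / 2)%R -> (forall n, (Cmod (a n) <= M * r ^ n)%R) -> is_Cseries a l ->
  (Cmod (l - Csum a N) <= M * r ^ N)%R.
Proof.
  intros Hr Ha Hl.
  assert (HM : (0 <= M)%R).
  { specialize (Ha 0%nat). simpl in Ha. pose proof (Cmod_ge_0 (a 0%nat)). lra. }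
  assert (P : forall n, (0 <= M * r ^ n)%R).
  { intros n. apply Rmult_le_pos; [exact HM | apply pow_le; lra]. }
  assert (B : forall n, (Cmod (Csum a (N + n) - Csum a N) <= M * r ^ N - M * r ^ (N + n))%R).
  { induction n as [|n IH].
    - rewrite Nat.add_0_r. replace (Csum a N - Csum a N) with (RtoC 0) by ring.
      rewrite Cmod_0. lra.
    - rewrite Nat.add_succ_r, Csum_S.
      replace (Csum a (N + n) + a (S (N + n)) - Csum a N)
        with ((Csum a (N + n) - Csum a N) + a (S (N + n))) by ring.
      eapply Rle_trans; [apply Cmod_triangle|].
      specialize (Ha (S (N + n))). simpl pow in *.
      pose proof (P (N + n)%nat).
      assert (M * (r * r ^ (N + n)) <= / 2 * (M * r ^ (N + n)))%R by nra.
      lra. }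
  apply le_epsilon. intros eps He.
  destruct (proj1 (is_Cseries_eps a l) Hl eps He) as [N' HN'].
  specialize (HN' (N + N')%nat ltac:(lia)). specialize (B N').
  replace (l - Csum a N)
    with (- (Csum a (N + N') - l) + (Csum a (N + N') - Csum a N)) by ring.
  eapply Rle_trans; [apply Cmod_triangle|]. rewrite Cmod_opp.
  pose proof (P (N + N')%nat). lra.
Qed.

(** This is one term of the exponential series at [6 x].  The ratio 1/6 is small enough to
    beat the bound [3^n] for [P_n]. *)
Lemma pow_div_fact_geom (x : R) (n : nat) :
  (0 <= x)%R -> (x ^ n / rfact n <= exp (6 * x) * (/ 6) ^ n)%R.
Proof.
  intros Hx. assert (H := exp_ge_pow_div_fact (6 * x) n ltac:(lra)).
  rewrite Rpow_mult_distr in H. rewrite pow_inv.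
  apply (Rmult_le_reg_l (6 ^ n)); [apply pow_lt; lra|].
  replace (6 ^ n * (exp (6 * x) * / 6 ^ n))%R with (exp (6 * x)).
  - unfold Rdiv in *. lra.
  - field. apply pow_nonzero; lra.
Qed.

(** * Taylor expansion of the complex exponential *)

Lemma Cmod_Cexp_le (z : C) : (Cmod (Cexp z) <= exp (Cmod z))%R.
Proof.
  unfold Cexp, Cmod at 1. simpl fst. simpl snd.
  replace ((exp (Re z) * cos (Im z)) ^ 2 + (exp (Re z) * sin (Im z)) ^ 2)%R
    with (exp (Re z) ^ 2)%R.
  - rewrite sqrt_pow2 by (apply Rlt_le, exp_pos).
    pose proof (re_le_Cmod z). pose proof (Rle_abs (Re z)).
    destruct (Rle_lt_or_eq_dec (Re z) (Cmod z)) as [L|L]; [lra | |].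
    + left. apply exp_increasing, L.
    + rewrite L. lra.
  - pose proof (sin2_cos2 (Im z)) as E. unfold Rsqr in E.
    replace (exp (Re z) ^ 2)%R with (exp (Re z) ^ 2 * 1)%R by ring. rewrite <- E. ring.
Qed.

Lemma is_Cderive_Cexp (z : C) (s : R) :
  is_Cderive (fun s : R => Cexp (s * z)) s (z * Cexp (s * z)).
Proof.
  destruct z as [x y].
  assert (E : forall r : R, Cexp (r * (x, y))
     = (exp (r * x) * cos (r * y), exp (r * x) * sin (r * y))%R).
  { intros r. unfold Cexp. simpl.
    replace (r * x - 0 * y)%R with (r * x)%R by ring.
    replace (r * y + 0 * x)%R with (r * y)%R by ring. reflexivity. }
  rewrite E.
  apply (is_derive_ext (V := C_R_NormedModule)
    (fun r => (exp (r * x) * cos (r * y), exp (r * x) * sin (r * y))%R)).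
  { intros r. symmetry. apply E. }
  apply is_Cderive_pair; unfold Re, Im; simpl.
  - auto_derive; [exact I | ring].
  - auto_derive; [exact I | ring].
Qed.

(** The remainder of order [n], that is, after the first [n] terms. *)
Fixpoint exp_rem (n : nat) (z : C) : C :=
  match n with
  | O => Cexp z
  | S k => exp_rem k z - z ^ k / rfact k
  end.

Lemma is_Cderive_exp_rem (n : nat) (z : C) (s : R) :
  is_Cderive (fun s : R => exp_rem (S n) (s * z)) s (z * exp_rem n (s * z)).
Proof.
  induction n as [|n IH].
  - simpl. replace (z * Cexp (s * z)) with (z * Cexp (s * z) - 0) by ring.
    apply is_Cderive_minus; [apply is_Cderive_Cexp | apply is_Cderive_const].
  - change (is_Cderive (fun s : R => exp_rem (S n) (s * z) - (s * z) ^ S n / rfact (S n)) s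
      (z * (exp_rem n (s * z) - (s * z) ^ n / rfact n))).
    replace (z * (exp_rem n (s * z) - (s * z) ^ n / rfact n)) with
      (z * exp_rem n (s * z) - (z ^ S n / rfact (S n)) * (INR (S n) * RtoC s ^ n)).
    + apply is_Cderive_minus; [exact IH|].
      apply (is_derive_ext (V := C_R_NormedModule)
        (fun s : R => (z ^ S n / rfact (S n)) * RtoC s ^ S n)).
      { intros t. rewrite (Cpow_mult_l t z). unfold Cdiv.
        change (z ^ S n * / rfact (S n) * RtoC t ^ S n
          = RtoC t ^ S n * z ^ S n * / rfact (S n)). ring. }
      apply is_Cderive_scal. apply (is_Cderive_pow (S n)).
    + rewrite Cpow_mult_l, rfact_S, S_INR, RtoC_mult. simpl Cpow. field.
      assert (RtoC (rfact n) <> 0) by (apply RtoC_neq_0, rfact_neq_0).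
      assert (RtoC (INR n + 1)%R <> 0).
      { intros H1. apply RtoC_inj in H1. pose proof (pos_INR n). lra. }
      split; assumption.
Qed.

Lemma exp_rem_0 (n : nat) : exp_rem (S n) 0 = 0.
Proof.
  induction n as [|n IH].
  - simpl. unfold Cexp. simpl. rewrite exp_0, cos_0, sin_0.
    apply injective_projections; simpl; field.
  - change (exp_rem (S n) 0 - 0 ^ S n / rfact (S n) = 0). rewrite IH.
    simpl Cpow. unfold Cdiv. ring.
Qed.

(** Along the ray through [z] each remainder is the integral of [z] times the preceding
    one, so the bound follows by induction. *)
Lemma exp_rem_bound_seg (n : nat) (z : C) (s : R) : (0 <= s <= 1)%R ->
  (Cmod (exp_rem n (s * z)) <= exp (Cmod z) * ((Cmod z * s) ^ n / rfact n))%R.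
Proof.
  revert s. induction n as [|n IH]; intros s Hs.
  - simpl. eapply Rle_trans; [apply Cmod_Cexp_le|].
    rewrite Cmod_mult, Cmod_R, Rabs_pos_eq by lra.
    replace (exp (Cmod z) * (1 / 1))%R with (exp (Cmod z)) by field.
    destruct (Rle_lt_or_eq_dec (s * Cmod z) (Cmod z)) as [L|L].
    + pose proof (Cmod_ge_0 z). nra.
    + left. apply exp_increasing, L.
    + rewrite L. lra.
  - assert (D : forall t, is_Cderive (fun s : R => exp_rem n (s * z)) t
       (match n with O => z * Cexp (t * z) | S k => z * exp_rem k (t * z) end)).
    { intros t. destruct n; [apply is_Cderive_Cexp | apply is_Cderive_exp_rem]. }
    assert (Cn : forall t : R, Ccont (fun s : R => exp_rem n (s * z)) t)
      by (intros t; exact (is_Cderive_continuous _ _ _ (D t))).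
    assert (E : exp_rem (S n) (s * z) = CInt (fun t : R => z * exp_rem n (t * z)) 0 s).
    { rewrite (CInt_derive (fun s : R => exp_rem (S n) (s * z))).
      - replace (RtoC 0 * z) with (RtoC 0) by ring. rewrite exp_rem_0. ring.
      - intros. apply is_Cderive_exp_rem.
      - intros. apply continuous_Cmult; [apply continuous_const | apply Cn]. }
    rewrite E.
    apply (Cmod_CInt_le_fun _ (fun t => Cmod z * (exp (Cmod z) * ((Cmod z * t) ^ n / rfact n)))%R).
    + apply Hs.
    + intros. apply continuous_Cmult; [apply continuous_const | apply Cn].
    + intros t Ht. rewrite Cmod_mult.
      apply Rmult_le_compat_l; [apply Cmod_ge_0 | apply IH; lra].
    + replace (exp (Cmod z) * ((Cmod z * s) ^ S n / rfact (S n)))%R with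
        (minus (exp (Cmod z) * ((Cmod z * s) ^ S n / rfact (S n)))%R
               (exp (Cmod z) * ((Cmod z * 0) ^ S n / rfact (S n)))%R : R).
      2:{ cbn. unfold plus; simpl. unfold Rdiv. ring. }
      apply (is_RInt_derive (V := R_CompleteNormedModule)
        (fun t => exp (Cmod z) * ((Cmod z * t) ^ S n / rfact (S n)))%R).
      * intros t _. rewrite rfact_S.
        pose proof (rfact_neq_0 n). pose proof (pos_INR n).
        auto_derive; [exact I|].
        change (match n with O => 1%R | S _ => (INR n + 1)%R end) with (INR (S n)).
        rewrite S_INR. field. split; [assumption | lra].
      * intros t _. apply ex_derive_continuous_R.
        auto_derive. exact I.
Qed.

Lemma exp_rem_bound (n : nat) (z : C) :
  (Cmod (exp_rem n z) <= exp (Cmod z) * (Cmod z ^ n / rfact n))%R.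
Proof.
  pose proof (exp_rem_bound_seg n z 1 ltac:(lra)) as H.
  rewrite Rmult_1_r in H. replace (1%R * z) with z in H by ring. exact H.
Qed.

(** Cosine and sine are treated together, as the even and odd parts [p = 0] and
    [p = 1]. *)
Definition trig (p : nat) (z : C) : C := if Nat.eqb p 0 then Ccos z else Csin z.
Definition trig_term (p : nat) (z : C) (m : nat) : C :=
  (-1) ^ m * z ^ (2 * m + p) / rfact (2 * m + p).

Lemma Ci_pow_even (z : C) (m : nat) : (Ci * z) ^ (2 * m) = (-1) ^ m * z ^ (2 * m).
Proof.
  assert (E : (Ci * z) ^ 2 = -1 * z ^ 2).
  { apply injective_projections; simpl; ring. }
  rewrite Cpow_mult_r, E, Cpow_mult_l, <- Cpow_mult_r. reflexivity.
Qed.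

Lemma mCi_pow_even (z : C) (m : nat) : (- (Ci * z)) ^ (2 * m) = (-1) ^ m * z ^ (2 * m).
Proof.
  replace (- (Ci * z)) with (Ci * - z) by ring. rewrite Ci_pow_even. f_equal.
  rewrite !Cpow_mult_r. f_equal. ring.
Qed.

Lemma Ccos_rem (z : C) (m : nat) :
  Ccos z - Csum (trig_term 0 z) m
  = (exp_rem (2 * m + 2) (Ci * z) + exp_rem (2 * m + 2) (- (Ci * z))) / 2.
Proof.
  induction m as [|m IH].
  - rewrite Csum_0. unfold trig_term, Ccos. simpl. field.
  - rewrite Csum_S.
    replace (Ccos z - (Csum (trig_term 0 z) m + trig_term 0 z (S m)))
      with (Ccos z - Csum (trig_term 0 z) m - trig_term 0 z (S m)) by ring.
    rewrite IH. unfold trig_term. rewrite Nat.add_0_r.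
    replace (2 * S m + 2)%nat with (S (S (2 * S m))) by lia.
    replace (2 * m + 2)%nat with (2 * S m)%nat by lia.
    change (exp_rem (S (S (2 * S m))) (Ci * z)) with
      (exp_rem (2 * S m) (Ci * z) - (Ci * z) ^ (2 * S m) / rfact (2 * S m)
        - (Ci * z) * (Ci * z) ^ (2 * S m) / rfact (S (2 * S m))).
    change (exp_rem (S (S (2 * S m))) (- (Ci * z))) with
      (exp_rem (2 * S m) (- (Ci * z)) - (- (Ci * z)) ^ (2 * S m) / rfact (2 * S m)
        - (- (Ci * z)) * (- (Ci * z)) ^ (2 * S m) / rfact (S (2 * S m))).
    rewrite Ci_pow_even, mCi_pow_even.
    unfold Cdiv. set (i1 := / RtoC (rfact (2 * S m))). set (i2 := / RtoC (rfact (S (2 * S m)))).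
    field.
Qed.

Lemma Csin_rem (z : C) (m : nat) :
  Csin z - Csum (trig_term 1 z) m
  = (exp_rem (2 * m + 3) (Ci * z) - exp_rem (2 * m + 3) (- (Ci * z))) / (2 * Ci).
Proof.
  assert (NCi : Ci <> 0) by (intros H; apply (f_equal Im) in H; simpl in H; lra).
  induction m as [|m IH].
  - rewrite Csum_0. unfold trig_term, Csin. simpl. field.
    split; [apply RtoC_neq_0; lra | exact NCi].
  - rewrite Csum_S.
    replace (Csin z - (Csum (trig_term 1 z) m + trig_term 1 z (S m)))
      with (Csin z - Csum (trig_term 1 z) m - trig_term 1 z (S m)) by ring.
    rewrite IH. unfold trig_term.
    replace (2 * S m + 3)%nat with (S (S (S (2 * S m)))) by lia.
    replace (2 * m + 3)%nat with (S (2 * S m))%nat by lia.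
    replace (2 * S m + 1)%nat with (S (2 * S m)) by lia.
    change (exp_rem (S (S (S (2 * S m)))) (Ci * z)) with
      (exp_rem (S (2 * S m)) (Ci * z) - (Ci * z) * (Ci * z) ^ (2 * S m) / rfact (S (2 * S m))
        - (Ci * z) * ((Ci * z) * (Ci * z) ^ (2 * S m)) / rfact (S (S (2 * S m)))).
    change (exp_rem (S (S (S (2 * S m)))) (- (Ci * z))) with
      (exp_rem (S (2 * S m)) (- (Ci * z))
        - (- (Ci * z)) * (- (Ci * z)) ^ (2 * S m) / rfact (S (2 * S m))
        - (- (Ci * z)) * ((- (Ci * z)) * (- (Ci * z)) ^ (2 * S m)) / rfact (S (S (2 * S m)))).
    rewrite Ci_pow_even, mCi_pow_even. change (z ^ S (2 * S m)) with (z * z ^ (2 * S m)).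
    assert (NZ : forall n, RtoC (rfact n) <> 0).
    { intros n H. apply RtoC_inj in H. exact (rfact_neq_0 n H). }
    field. auto.
Qed.

Lemma trig_rem_bound (p : nat) (z : C) (m : nat) : (p <= 1)%nat ->
  (Cmod (trig p z - Csum (trig_term p z) m)
     <= exp (Cmod z) * (Cmod z ^ (2 * m + 2 + p) / rfact (2 * m + 2 + p)))%R.
Proof.
  intros Hp. unfold trig.
  assert (B := fun n => exp_rem_bound n (Ci * z)).
  assert (B' := fun n => exp_rem_bound n (- (Ci * z))).
  assert (E1 : Cmod (Ci * z) = Cmod z) by (rewrite Cmod_mult, Cmod_Ci; ring).
  rewrite E1 in B. rewrite Cmod_opp, E1 in B'.
  destruct p as [|[|p]]; [| |lia]; simpl Nat.eqb; cbv iota.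
  - rewrite Ccos_rem, Nat.add_0_r, Cmod_div by (apply RtoC_neq_0; lra).
    rewrite Cmod_R, Rabs_pos_eq by lra. specialize (B (2 * m + 2)%nat).
    specialize (B' (2 * m + 2)%nat).
    pose proof (Cmod_triangle (exp_rem (2 * m + 2) (Ci * z)) (exp_rem (2 * m + 2) (- (Ci * z)))).
    lra.
  - assert (NCi : Ci <> 0) by (intros H; apply (f_equal Im) in H; simpl in H; lra).
    replace (2 * m + 2 + 1)%nat with (2 * m + 3)%nat by lia.
    rewrite Csin_rem, Cmod_div.
    2:{ apply Cmult_neq_0; [|exact NCi]. apply RtoC_neq_0; lra. }
    rewrite Cmod_mult, Cmod_Ci, Cmod_R, Rabs_pos_eq by lra. specialize (B (2 * m + 3)%nat).
    specialize (B' (2 * m + 3)%nat).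
    pose proof (Cmod_triangle (exp_rem (2 * m + 3) (Ci * z)) (- exp_rem (2 * m + 3) (- (Ci * z)))) as T.
    rewrite Cmod_opp in T. unfold Cminus. lra.
Qed.

(** * Spherical Bessel functions *)

Lemma Carg_scal (c : R) (z : C) : (0 < c)%R -> z <> 0 -> Carg (c * z) = Carg z.
Proof.
  intros Hc Hz. assert (Pz := proj1 (Cmod_gt_0 z) Hz).
  unfold Carg. rewrite Cmod_mult, Cmod_R, Rabs_pos_eq by lra.
  replace (Re (c * z)) with (c * Re z)%R by (unfold Re; simpl; ring).
  replace (Im (c * z)) with (c * Im z)%R by (unfold Im; simpl; ring).
  replace (c * Re z / (c * Cmod z))%R with (Re z / Cmod z)%R by (field; lra).
  destruct (Rle_dec 0 (Im z)); destruct (Rle_dec 0 (c * Im z)); auto; exfalso; nra.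
Qed.

Definition cis (a : R) : C := (cos a, sin a).

Lemma cis_plus (a c : R) : cis (a + c) = cis a * cis c.
Proof.
  unfold cis. rewrite cos_plus, sin_plus. apply injective_projections; simpl; ring.
Qed.

Lemma cis_pow (k : nat) (a : R) : cis (INR k * a) = cis a ^ k.
Proof.
  induction k as [|k IH].
  - simpl. rewrite Rmult_0_l. unfold cis. rewrite cos_0, sin_0. reflexivity.
  - simpl Cpow. rewrite <- IH, <- cis_plus. f_equal. rewrite S_INR. ring.
Qed.

Lemma Cmod_cis_Carg (z : C) : z <> 0 -> Cmod z * cis (Carg z) = z.
Proof.
  intros Hz. assert (Pz := proj1 (Cmod_gt_0 z) Hz).
  set (u := (Re z / Cmod z)%R).
  assert (Hu : (-1 <= u <= 1)%R).
  { pose proof (re_le_Cmod z) as H. apply Rabs_le_between in H.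
    unfold u. split; [apply Rle_div_r | apply Rle_div_l]; lra. }
  assert (E : (Cmod z ^ 2 = Re z ^ 2 + Im z ^ 2)%R) by apply Cmod2_alt.
  assert (Es : sqrt (1 - Rsqr u) = (Rabs (Im z) / Cmod z)%R).
  { assert (E1 : (1 - Rsqr u = (Rabs (Im z) / Cmod z) ^ 2)%R).
    { unfold u, Rsqr.
      replace (1 - Re z / Cmod z * (Re z / Cmod z))%R
        with ((Cmod z ^ 2 - Re z ^ 2) / Cmod z ^ 2)%R by (field; lra).
      replace (Cmod z ^ 2 - Re z ^ 2)%R with (Rabs (Im z) ^ 2)%R
        by (rewrite pow2_abs; lra).
      field. lra. }
    rewrite E1, sqrt_pow2; [reflexivity|].
    apply Rdiv_le_0_compat; [apply Rabs_pos | exact Pz]. }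
  assert (Ec : cos (Carg z) = u).
  { unfold Carg. destruct (Rle_dec 0 (Im z)); [|rewrite cos_neg]; apply cos_acos, Hu. }
  assert (Esn : sin (Carg z) = (Im z / Cmod z)%R).
  { unfold Carg. fold u. destruct (Rle_dec 0 (Im z)) as [H|H].
    - rewrite sin_acos, Es, Rabs_pos_eq by assumption. reflexivity.
    - rewrite sin_neg, sin_acos, Es, Rabs_left by lra. field. lra. }
  unfold cis. rewrite Ec, Esn. unfold u.
  apply injective_projections; unfold Re, Im; simpl; field; lra.
Qed.

Lemma Cpower_scal (c a : R) (z : C) : (0 < c)%R -> z <> 0 ->
  Cpower (c * z) a = Rpower (c * Cmod z) a * cis (a * Carg z).
Proof.
  intros Hc Hz. unfold Cpower. rewrite Carg_scal, Cmod_mult, Cmod_R, Rabs_pos_eq by (auto; lra).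
  reflexivity.
Qed.

(** Both powers are taken on the branch given by [Carg z], since positive factors do
    not change the argument; so the half-integral exponents add up to [k]. *)
Lemma sphj_prefactor (k : nat) (z : C) : z <> 0 ->
  Cpower (2 * z / PI) (- / 2) * Cpower (z / 2) (INR k + / 2)
  = (sqrt PI / 2)%R * (z / 2) ^ k.
Proof.
  intros Hz. assert (Pz := proj1 (Cmod_gt_0 z) Hz). pose proof PI_RGT_0 as HP.
  assert (NP : RtoC PI <> 0) by (apply RtoC_neq_0; lra).
  replace (2 * z / PI) with ((2 / PI)%R * z) by (rewrite RtoC_div by lra; field; exact NP).
  replace (z / 2) with ((/ 2)%R * z) by (rewrite RtoC_inv by lra; field).
  assert (H2P : (0 < 2 / PI)%R) by (apply Rdiv_lt_0_compat; lra).
  rewrite !Cpower_scal by (auto; lra).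
  set (r := Cmod z) in *. set (a := Carg z).
  assert (ER : (Rpower (2 / PI * r) (- / 2) * Rpower (/ 2 * r) (INR k + / 2)
     = sqrt PI / 2 * (/ 2 * r) ^ k)%R).
  { assert (Pr : (0 < / 2 * r)%R) by lra.
    assert (Pq : (0 < 2 / PI * r)%R) by (apply Rmult_lt_0_compat; lra).
    rewrite Rpower_Ropp, Rpower_plus, Rpower_pow, !Rpower_sqrt by assumption.
    assert (E4 : sqrt (/ 2 * r) = (sqrt (2 / PI * r) * (sqrt PI / 2))%R).
    { replace (/ 2 * r)%R with ((2 / PI * r) * (PI / 2 ^ 2))%R by (field; lra).
      rewrite sqrt_mult, sqrt_div_alt, sqrt_pow2 by lra. reflexivity. }
    rewrite E4. pose proof (sqrt_lt_R0 _ Pq). field. lra. }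
  transitivity (RtoC (Rpower (2 / PI * r) (- / 2) * Rpower (/ 2 * r) (INR k + / 2))%R
     * (cis (- / 2 * a) * cis ((INR k + / 2) * a))).
  { rewrite RtoC_mult. ring. }
  rewrite ER, <- cis_plus.
  replace (- / 2 * a + (INR k + / 2) * a)%R with (INR k * a)%R by field.
  rewrite cis_pow, RtoC_mult, RtoC_pow, <- Cmult_assoc, <- Cpow_mult_l.
  f_equal. f_equal. rewrite RtoC_mult, <- Cmult_assoc. f_equal.
  unfold r, a. apply Cmod_cis_Carg, Hz.
Qed.

(** The terms of the series of [(2k+1) j_k(z)], written with the coefficients of
    [P_k] in the expansions of the powers. *)
Definition bessel_term (k : nat) (z : C) (m : nat) : C :=
  (-1) ^ m * z ^ (k + 2 * m) / rfact (k + 2 * m) * expand_coef k m.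

Lemma Cmod_m1_pow (m : nat) : Cmod ((-1) ^ m) = 1%R.
Proof.
  rewrite Cmod_pow, Cmod_R. replace (Rabs (-1)) with 1%R; [apply pow1|].
  rewrite Rabs_left by lra. ring.
Qed.

Lemma RtoC_rfact_neq_0 (n : nat) : RtoC (rfact n) <> 0.
Proof. intros H. apply RtoC_inj in H. exact (rfact_neq_0 n H). Qed.

Lemma bessel_term_bound (k : nat) (z : C) (m : nat) :
  (Cmod (bessel_term k z m) <= exp (6 * Cmod z) * (/ 6) ^ k * (/ 36) ^ m)%R.
Proof.
  unfold bessel_term. rewrite Cmod_mult, Cmod_div, Cmod_mult, Cmod_m1_pow, Cmod_pow, !Cmod_R
    by apply RtoC_rfact_neq_0.
  rewrite (Rabs_pos_eq (expand_coef k m)) by apply expand_coef_nonneg.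
  rewrite Rabs_pos_eq by apply pos_INR. rewrite Rmult_1_l.
  pose proof (pow_div_fact_geom (Cmod z) (k + 2 * m) (Cmod_ge_0 z)) as B.
  rewrite (pow_add (/ 6)), (pow_mult (/ 6)) in B.
  replace ((/ 6) ^ 2)%R with (/ 36)%R in B by field.
  pose proof (expand_coef_le_1 k m). pose proof (expand_coef_nonneg k m).
  assert (0 <= Cmod z ^ (k + 2 * m) / rfact (k + 2 * m))%R.
  { apply Rdiv_le_0_compat; [apply pow_le, Cmod_ge_0 | apply INR_fact_lt_0]. }
  apply Rle_trans with (Cmod z ^ (k + 2 * m) / rfact (k + 2 * m) * 1)%R.
  - apply Rmult_le_compat_l; assumption.
  - rewrite Rmult_1_r. rewrite Rmult_assoc. exact B.
Qed.

Lemma is_Cseries_zero : is_Cseries (fun _ => 0) 0.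
Proof.
  apply is_Cseries_eps. intros eps He. exists 0%nat. intros n _.
  replace (Csum (fun _ => 0) n) with (RtoC 0).
  - replace (0 - 0) with (RtoC 0) by ring. rewrite Cmod_0. exact He.
  - induction n as [|n IH]; [rewrite Csum_0 | rewrite Csum_S, <- IH]; ring.
Qed.

Lemma expand_coef_0 (k : nat) : expand_coef 0 0 = 1%R.
Proof. unfold expand_coef. simpl. field. Qed.

(** The closed form of [Gamma] at half-integers turns the Bessel series, multiplied by
    the prefactor, into the series of the [bessel_term k z]. *)
Lemma sphj_series (k : nat) (z : C) :
  is_Cseries (bessel_term k z) ((2 * INR k + 1)%R * sphj k z).
Proof.
  assert (N2k : RtoC (2 * INR k + 1) <> 0).
  { intros H. apply RtoC_inj in H. pose proof (pos_INR k). lra. }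
  unfold sphj. destruct (Ceq_dec z 0) as [->|Hz].
  - (* at the origin only the first term of the series for k = 0 survives *)
    destruct (Nat.eqb_spec k 0) as [->|Hk].
    + apply is_Cseries_eps. intros eps He. exists 0%nat. intros n _.
      replace (Csum (bessel_term 0 0) n) with (RtoC 1).
      * replace (1 - (2 * INR 0 + 1)%R * 1) with (RtoC 0).
        -- rewrite Cmod_0. exact He.
        -- apply injective_projections; simpl; ring.
      * induction n as [|n IH].
        -- rewrite Csum_0. unfold bessel_term. rewrite expand_coef_0 by exact 0%nat.
           simpl. field.
        -- rewrite Csum_S, <- IH. unfold bessel_term.
           replace (0 + 2 * S n)%nat with (S (S (2 * n))) by lia. simpl Cpow.
           unfold Cdiv. ring.
    + rewrite Cmult_0_r. apply (is_Cseries_ext (fun _ => 0)); [|apply is_Cseries_zero].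
      intros m. unfold bessel_term. destruct k as [|k]; [lia|]. simpl Cpow. unfold Cdiv. ring.
  - destruct (Cseries_geom_cv (bessel_term k z) (exp (6 * Cmod z) * (/ 6) ^ k) (/ 36)) as [l Hl].
    { rewrite Rabs_pos_eq; lra. }
    { apply bessel_term_bound. }
    set (c := RtoC (2 * INR k + 1) * ((sqrt PI / 2)%R * (z / 2) ^ k)).
    pose proof PI_RGT_0 as HP. pose proof (sqrt_lt_R0 _ HP) as HsP.
    assert (NsP : RtoC (sqrt PI) <> 0) by (apply RtoC_neq_0; lra).
    assert (N2 : RtoC 2 <> 0) by (apply RtoC_neq_0; lra).
    assert (Nc : c <> 0).
    { unfold c. apply Cmult_neq_0; [exact N2k|]. apply Cmult_neq_0.
      - intros H. apply RtoC_inj in H. lra.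
      - apply Cpow_nz. intros H. apply Hz. replace z with (z / 2 * 2) by (field; exact N2).
        rewrite H. ring. }
    assert (E : is_Cseries (fun m => (- (z ^ 2 / 4)) ^ m
        / (INR (Factorial.fact m) * Gamma (INR k + / 2 + INR m + 1))%R) (/ c * l)).
    { apply (is_Cseries_ext (fun m => / c * bessel_term k z m)); [|apply is_Cseries_scal, Hl].
      intros m.
      replace (INR k + / 2 + INR m + 1)%R with (INR (k + m + 1) + / 2)%R
        by (rewrite !plus_INR; simpl; ring).
      rewrite Gamma_half, gamma_half_fact.
      match goal with |- _ = ?y => replace y with (/ c * (c * y))
        by (rewrite Cmult_assoc, Cinv_l by exact Nc; ring) end.
      apply (f_equal (Cmult (/ c))).
      unfold c, bessel_term, expand_coef.
      replace (k + m + 1)%nat with (S (k + m)) by lia.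
      replace (2 * S (k + m))%nat with (S (S (2 * (k + m)))) by lia.
      replace (2 * k + 2 * m + 1)%nat with (S (2 * (k + m))) by lia.
      rewrite !rfact_S.
      replace (- (z ^ 2 / 4)) with ((- / 4)%R * z ^ 2).
      2:{ rewrite RtoC_opp, RtoC_inv by lra. field. }
      rewrite Cpow_mult_l, <- (Cpow_mult_r z 2 m), Cpow_add_r.
      replace (z / 2) with ((/ 2)%R * z) by (rewrite RtoC_inv by lra; field).
      rewrite Cpow_mult_l, <- !RtoC_pow. unfold Cdiv.
      rewrite <- !RtoC_inv.
      2:{ apply Rmult_integral_contrapositive_currified; [apply rfact_neq_0|].
          pose proof (pos_INR (k + m)). pose proof (pos_INR (2 * (k + m))).
          unfold Rdiv.
          repeat apply Rmult_integral_contrapositive_currified;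
            try apply rfact_neq_0; try lra.
          - rewrite S_INR. lra.
          - apply Rinv_neq_0_compat.
            repeat apply Rmult_integral_contrapositive_currified;
              try apply rfact_neq_0; try lra. apply pow_nonzero; lra. }
      2:{ apply rfact_neq_0. }
      match goal with |- RtoC ?a' * (?zk * ?zm) * RtoC ?b' * RtoC ?d' =
          RtoC ?a * (RtoC ?b * (RtoC ?d * ?zk)) * (RtoC ?e * ?zm * RtoC ?g) =>
        transitivity (RtoC (a' * b' * d')%R * (zk * zm));
        [rewrite !RtoC_mult; ring|];
        transitivity (RtoC (a * b * d * e * g)%R * (zk * zm));
        [|rewrite !RtoC_mult; ring] end.
      f_equal. f_equal.
      rewrite !S_INR, !mult_INR, !plus_INR. simpl (INR 2).
      replace (- / 4)%R with ((-1) * / 4)%R by ring.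
      rewrite Rpow_mult_distr, !pow_inv. simpl (4 ^ S (k + m))%R.
      rewrite pow_add. replace (4 ^ k)%R with (2 ^ k * 2 ^ k)%R
        by (rewrite <- Rpow_mult_distr; f_equal; ring).
      pose proof (pos_INR k). pose proof (pos_INR m). field.
      repeat split; try apply rfact_neq_0; try (apply pow_nonzero; lra); lra. }
    unfold BesselJ. rewrite (CSeries_eq _ _ E).
    rewrite (Cmult_assoc (Cpower (2 * z / PI) (- / 2))), sphj_prefactor by exact Hz.
    replace (RtoC (2 * INR k + 1) * ((sqrt PI / 2)%R * (z / 2) ^ k * (/ c * l)))
      with (c * / c * l) by (unfold c; ring).
    rewrite Cinv_r, Cmult_1_l by exact Nc. exact Hl.
Qed.

(** * Legendre moments and the Neumann series *)

Lemma is_Cderive_trig (p : nat) (w : C) (x : R) : (p <= 1)%nat ->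
  is_Cderive (fun t : R => trig p (w * t)) x
    (if Nat.eqb p 0 then - (w * Csin (w * x)) else w * Ccos (w * x)).
Proof.
  intros Hp.
  assert (NCi : Ci <> 0) by (intros H; apply (f_equal Im) in H; simpl in H; lra).
  assert (D1 : is_Cderive (fun t : R => Cexp (Ci * (w * t))) x (Ci * w * Cexp (Ci * (w * x)))).
  { replace (Ci * (w * x)) with (x * (Ci * w)) by ring.
    apply (is_derive_ext (V := C_R_NormedModule) (fun t : R => Cexp (t * (Ci * w)))).
    { intros t. f_equal. ring. }
    apply is_Cderive_Cexp. }
  assert (D2 : is_Cderive (fun t : R => Cexp (- (Ci * (w * t)))) x
     (- (Ci * w) * Cexp (- (Ci * (w * x))))).
  { replace (- (Ci * (w * x))) with (x * - (Ci * w)) by ring.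
    apply (is_derive_ext (V := C_R_NormedModule) (fun t : R => Cexp (t * - (Ci * w)))).
    { intros t. f_equal. ring. }
    apply is_Cderive_Cexp. }
  destruct p as [|[|p]]; [| |lia]; unfold trig; simpl Nat.eqb; cbv iota.
  - unfold Ccos, Csin.
    apply (is_derive_ext (V := C_R_NormedModule)
      (fun t : R => / 2 * (Cexp (Ci * (w * t)) + Cexp (- (Ci * (w * t)))))).
    { intros t. unfold Cdiv. apply Cmult_comm. }
    replace (- (w * ((Cexp (Ci * (w * x)) - Cexp (- (Ci * (w * x)))) / (2 * Ci))))
      with (/ 2 * (Ci * w * Cexp (Ci * (w * x)) + - (Ci * w) * Cexp (- (Ci * (w * x))))).
    + apply is_Cderive_scal, is_Cderive_plus; assumption.
    + set (e1 := Cexp (Ci * (w * x))). set (e2 := Cexp (- (Ci * (w * x)))).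
      assert (E : / Ci = - Ci) by (apply injective_projections; simpl; field).
      replace ((e1 - e2) / (2 * Ci)) with ((e1 - e2) * / Ci / 2) by (field; exact NCi).
      rewrite E. field.
  - unfold Ccos, Csin.
    apply (is_derive_ext (V := C_R_NormedModule)
      (fun t : R => / (2 * Ci) * (Cexp (Ci * (w * t)) - Cexp (- (Ci * (w * t)))))).
    { intros t. unfold Cdiv. apply Cmult_comm. }
    replace (w * ((Cexp (Ci * (w * x)) + Cexp (- (Ci * (w * x)))) / 2))
      with (/ (2 * Ci) * (Ci * w * Cexp (Ci * (w * x)) - - (Ci * w) * Cexp (- (Ci * (w * x))))).
    + apply is_Cderive_scal, is_Cderive_minus; assumption.
    + field. exact NCi.
Qed.

Lemma continuous_trig (p : nat) (w : C) (x : R) : (p <= 1)%nat ->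
  Ccont (fun t : R => trig p (w * t)) x.
Proof. intros Hp. exact (is_Cderive_continuous _ _ _ (is_Cderive_trig p w x Hp)). Qed.

Lemma continuous_Csum {T : UniformSpace} (u : nat -> T -> C) (n : nat) (x : T) :
  (forall k, @continuous T C_UniformSpace (u k) x) ->
  @continuous T C_UniformSpace (fun y => Csum (fun k => u k y) n) x.
Proof.
  intros H. induction n as [|n IH].
  - apply (continuous_ext (u 0%nat)); [intros; symmetry; apply Csum_0 | apply H].
  - apply (continuous_ext (fun y => Csum (fun k => u k y) n + u (S n) y)).
    + intros; symmetry; apply (Csum_S (fun k => u k x0)).
    + apply continuous_Cplus; [exact IH | apply H].
Qed.

Lemma CInt_Csum (u : nat -> R -> C) (n : nat) (a c : R) :
  (forall k x, Ccont (u k) x) ->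
  CInt (fun x => Csum (fun k => u k x) n) a c = Csum (fun k => CInt (u k) a c) n.
Proof.
  intros H. induction n as [|n IH].
  - rewrite Csum_0. apply CInt_ext. intros. apply Csum_0.
  - rewrite Csum_S, <- IH, <- CInt_plus.
    + apply CInt_ext. intros. apply Csum_S.
    + intros. apply continuous_Csum. auto.
    + auto.
Qed.

(** Moments of [G] on the interval from [-x] to [x], scaled to the interval from -1 to 1. *)
Definition moment (G : R -> C) (x : R) (j : nat) : C :=
  CInt (fun t => G t * (t / x)%R ^ j) (- x) x.
Definition leg_moment (G : R -> C) (x : R) (n : nat) : C :=
  CInt (fun t => G t * RtoC (leg n (t / x))) (- x) x.

Lemma continuous_div_pow (x : R) (j : nat) (t : R) :
  Ccont (fun t : R => RtoC (t / x)%R ^ j) t.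
Proof. unfold Rdiv. cont. Qed.

Lemma leg_Csum (n : nat) (s : R) :
  RtoC (leg n s) = Csum (fun k => leg_coef k n * RtoC s ^ k) n.
Proof.
  unfold leg, leg_form. rewrite Csum_RtoC. apply Csum_ext. intros k _.
  rewrite RtoC_mult, RtoC_pow. reflexivity.
Qed.

Lemma continuous_leg (x : R) (n : nat) (t : R) :
  Ccont (fun t : R => RtoC (leg n (t / x))) t.
Proof.
  apply (continuous_ext (fun t : R => Csum (fun k => leg_coef k n * RtoC (t / x)%R ^ k) n)).
  - intros. symmetry. apply leg_Csum.
  - apply (continuous_Csum (fun k (t : R) => leg_coef k n * RtoC (t / x)%R ^ k)).
    intros k. apply continuous_Cmult; [apply continuous_const | apply continuous_div_pow].
Qed.

Lemma leg_moment_moment (G : R -> C) (x : R) (n : nat) : (forall t, Ccont G t) ->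
  leg_moment G x n = Csum (fun k => leg_coef k n * moment G x k) n.
Proof.
  intros CG. unfold leg_moment, moment.
  rewrite (CInt_ext _ (fun t => Csum (fun k => leg_coef k n * (G t * RtoC (t / x)%R ^ k)) n)).
  - rewrite (CInt_Csum (fun k t => leg_coef k n * (G t * RtoC (t / x)%R ^ k))).
    + apply Csum_ext. intros k _. apply CInt_scal.
      intros. apply continuous_Cmult; [apply CG | apply continuous_div_pow].
    + intros. apply continuous_Cmult; [apply continuous_const|].
      apply continuous_Cmult; [apply CG | apply continuous_div_pow].
  - intros t _. rewrite leg_Csum, <- Csum_scal. apply Csum_ext. intros; ring.
Qed.

Lemma moment_leg_moment (G : R -> C) (x : R) (p m : nat) : (p <= 1)%nat -> (forall t, Ccont G t) ->
  moment G x (2 * m + p) = Csum (fun n => expand_coef (2 * n + p) (m - n) * leg_moment G x (2 * n + p)) m.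
Proof.
  intros Hp CG. unfold leg_moment, moment.
  rewrite (CInt_ext _ (fun t => Csum (fun n => expand_coef (2 * n + p) (m - n)
     * (G t * RtoC (leg (2 * n + p) (t / x)))) m)).
  - rewrite (CInt_Csum (fun n t => expand_coef (2 * n + p) (m - n)
     * (G t * RtoC (leg (2 * n + p) (t / x))))).
    + apply Csum_ext. intros k _. apply CInt_scal.
      intros. apply continuous_Cmult; [apply CG | apply continuous_leg].
    + intros. apply continuous_Cmult; [apply continuous_const|].
      apply continuous_Cmult; [apply CG | apply continuous_leg].
  - intros t _. rewrite <- RtoC_pow, (pow_expansion p m (t / x) Hp), Csum_RtoC, <- Csum_scal.
    apply Csum_ext. intros. rewrite RtoC_mult. ring.
Qed.

Lemma leg_moment_bound (G : R -> C) (x M : R) (n : nat) : (0 < x)%R ->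
  (forall t, Ccont G t) -> (forall t, (- x <= t <= x)%R -> (Cmod (G t) <= M)%R) ->
  (Cmod (leg_moment G x n) <= 2 * x * M * 3 ^ n)%R.
Proof.
  intros Hx CG HM.
  replace (2 * x * M * 3 ^ n)%R with (M * 3 ^ n * (x - - x))%R by ring.
  apply Cmod_CInt_le; [lra| |].
  - intros. apply continuous_Cmult; [apply CG | apply continuous_leg].
  - intros t Ht. rewrite Cmod_mult, Cmod_R.
    apply Rmult_le_compat; [apply Cmod_ge_0 | apply Rabs_pos | apply HM, Ht |].
    apply leg_bound. unfold Rdiv. rewrite Rabs_mult, Rabs_inv, (Rabs_pos_eq x) by lra.
    apply Rle_div_l; [exact Hx|]. rewrite Rmult_1_l. apply Rabs_le_between. lra.
Qed.

Lemma sum_pow_9 (N : nat) : (sum_f_R0 (fun n => 9 ^ n) N <= 2 * 9 ^ N)%R.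
Proof.
  induction N as [|N IH]; simpl; [lra|].
  assert (0 < 9 ^ N)%R by (apply pow_lt; lra). lra.
Qed.

(** The expansion is compared with the Taylor polynomial of the trigonometric
    factor: for a polynomial the Legendre expansion is finite, and what is
    left are the tails of the Taylor series and of the Bessel series. *)
Lemma neumann_bound (G : R -> C) (x M : R) (w : C) (p N : nat) : (0 < x)%R ->
  (p <= 1)%nat -> (forall t, Ccont G t) ->
  (forall t, (- x <= t <= x)%R -> (Cmod (G t) <= M)%R) ->
  (Cmod (CInt (fun t => G t * trig p (w * t))%C (- x) x
     - Csum (fun n => (-1) ^ n * leg_moment G x (2 * n + p) *
          ((2 * INR (2 * n + p) + 1)%R * sphj (2 * n + p) (w * x)))%C N)
   <= 6 * x * M * exp (7 * Cmod (w * x)) * (/ 4) ^ N)%R.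
Proof.
  intros Hx Hp CG HM. set (z := w * x).
  assert (HM0 : (0 <= M)%R).
  { eapply Rle_trans; [apply (Cmod_ge_0 (G 0%R)) | apply HM; lra]. }
  assert (Hz := Cmod_ge_0 z).
  assert (Ee : forall y, (0 <= y)%R -> (1 <= exp y)%R).
  { intros y Hy. pose proof (exp_ineq1_le y). lra. }
  assert (E7 : (exp (7 * Cmod z) = exp (Cmod z) * exp (6 * Cmod z))%R).
  { rewrite <- exp_plus. f_equal. ring. }
  set (T := Csum (fun m => (-1) ^ m * z ^ (2 * m + p) / rfact (2 * m + p)
     * moment G x (2 * m + p)) N).
  set (I := CInt (fun t => G t * trig p (w * t)) (- x) x).
  assert (B1 : (Cmod (I - T) <= 2 * x * M * exp (7 * Cmod z) * (/ 4) ^ N)%R).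
  { assert (ET : T = CInt (fun t : R => Csum (fun m => G t * trig_term p (w * t) m) N) (- x) x).
    { rewrite (CInt_Csum (fun m (t : R) => G t * trig_term p (w * t) m)).
      - apply Csum_ext. intros m _. unfold moment.
        rewrite <- CInt_scal.
        + apply CInt_ext. intros t _. unfold trig_term, z.
          replace (w * t) with (w * x * RtoC (t / x)%R).
          * rewrite (Cpow_mult_l (w * x) (RtoC (t / x)%R)). unfold Cdiv. ring.
          * rewrite RtoC_div by lra. field. apply RtoC_neq_0; lra.
        + intros. apply continuous_Cmult; [apply CG | apply continuous_div_pow].
      - intros m t. unfold trig_term, Cdiv. cont. }
    assert (CT : forall t : R, Ccont (fun t : R => G t * trig p (w * t)) t).
    { intros. apply continuous_Cmult; [apply CG | apply continuous_trig, Hp]. }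
    assert (CS : forall t : R, Ccont (fun t : R => Csum (fun m => G t * trig_term p (w * t) m) N) t).
    { intros. apply continuous_Csum. intros m. unfold trig_term, Cdiv. cont. }
    unfold I. rewrite ET, <- CInt_minus by assumption.
    replace (2 * x * M * exp (7 * Cmod z) * (/ 4) ^ N)%R
      with (M * (exp (7 * Cmod z) * (/ 4) ^ N) * (x - - x))%R by ring.
    apply Cmod_CInt_le; [lra| |].
    - intros. apply continuous_Cminus; [apply CT | apply CS].
    - intros t Ht. rewrite Csum_scal.
      replace (G t * trig p (w * t) - G t * Csum (trig_term p (w * t)) N)
        with (G t * (trig p (w * t) - Csum (trig_term p (w * t)) N)) by ring.
      rewrite Cmod_mult.
      apply Rmult_le_compat; [apply Cmod_ge_0 | apply Cmod_ge_0 | apply HM, Ht|].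
      eapply Rle_trans; [apply trig_rem_bound, Hp|].
      assert (Hwt : (Cmod (w * t) <= Cmod z)%R).
      { unfold z. rewrite !Cmod_mult, !Cmod_R, (Rabs_pos_eq x) by lra.
        apply Rmult_le_compat_l; [apply Cmod_ge_0 | apply Rabs_le_between; lra]. }
      rewrite E7, Rmult_assoc.
      apply Rmult_le_compat.
      + apply Rlt_le, exp_pos.
      + apply Rdiv_le_0_compat; [apply pow_le, Cmod_ge_0 | apply INR_fact_lt_0].
      + apply exp_le, Hwt.
      + apply Rle_trans with (Cmod z ^ (2 * N + 2 + p) / rfact (2 * N + 2 + p))%R.
        * apply Rmult_le_compat_r; [apply Rlt_le, Rinv_0_lt_compat, INR_fact_lt_0|].
          apply pow_incr. split; [apply Cmod_ge_0 | exact Hwt].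
        * eapply Rle_trans; [apply pow_div_fact_geom, Hz|].
          apply Rmult_le_compat_l; [apply Rlt_le, exp_pos|].
          rewrite !pow_add, pow_mult.
          replace ((/ 6) ^ 2)%R with (/ 36)%R by field.
          assert (P1 : (0 <= (/ 36) ^ N <= (/ 4) ^ N)%R).
          { split; [apply pow_le; lra | apply pow_incr; lra]. }
          assert (P2 : (0 <= (/ 6) ^ p <= 1)%R).
          { split; [apply pow_le; lra|]. rewrite <- (pow1 p). apply pow_incr. lra. }
          nra. }
  set (S := Csum (fun n => (-1) ^ n * leg_moment G x (2 * n + p) *
          ((2 * INR (2 * n + p) + 1)%R * sphj (2 * n + p) z)) N).
  (* summed over m first, the finite expansions give for each n a partial sum of
     the series of (4n+2p+1) j_(2n+p) *)
  assert (ET : T = Csum (fun n => (-1) ^ n * leg_moment G x (2 * n + p)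
     * Csum (bessel_term (2 * n + p) z) (N - n)) N).
  { unfold T.
    rewrite (Csum_ext _ (fun m => Csum (fun n =>
       (-1) ^ n * leg_moment G x (2 * n + p) * bessel_term (2 * n + p) z (m - n)) m)).
    - rewrite (Csum_triangle (fun n j =>
        (-1) ^ n * leg_moment G x (2 * n + p) * bessel_term (2 * n + p) z j)).
      apply Csum_ext. intros n _. apply Csum_scal.
    - intros m _. rewrite (moment_leg_moment G x p m Hp CG), <- Csum_scal.
      apply Csum_ext. intros n Hn. unfold bessel_term.
      replace (2 * n + p + 2 * (m - n))%nat with (2 * m + p)%nat by lia.
      replace ((-1) ^ m) with ((-1) ^ n * (-1) ^ (m - n))
        by (rewrite <- Cpow_add_r; f_equal; lia).
      unfold Cdiv. ring. }
  assert (B2 : (Cmod (S - T) <= 4 * x * M * exp (7 * Cmod z) * (/ 4) ^ N)%R).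
  { unfold S. rewrite ET, <- Csum_minus.
    eapply Rle_trans; [apply Cmod_Csum_le with
      (r := fun n => (9 ^ n * (2 * x * M * exp (6 * Cmod z) * (/ 36) ^ N))%R)|].
    - intros n Hn.
      replace ((-1) ^ n * leg_moment G x (2 * n + p) *
          ((2 * INR (2 * n + p) + 1)%R * sphj (2 * n + p) z)
        - (-1) ^ n * leg_moment G x (2 * n + p) * Csum (bessel_term (2 * n + p) z) (N - n))
        with ((-1) ^ n * (leg_moment G x (2 * n + p) *
          ((2 * INR (2 * n + p) + 1)%R * sphj (2 * n + p) z
            - Csum (bessel_term (2 * n + p) z) (N - n)))) by ring.
      rewrite !Cmod_mult, Cmod_m1_pow, Rmult_1_l.
      pose proof (leg_moment_bound G x M (2 * n + p) Hx CG HM) as L1.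
      pose proof (Cseries_geom_tail _ _ (exp (6 * Cmod z) * (/ 6) ^ (2 * n + p)) (/ 36) (N - n)
        ltac:(lra) (bessel_term_bound (2 * n + p) z) (sphj_series (2 * n + p) z)) as L2.
      apply Rle_trans with ((2 * x * M * 3 ^ (2 * n + p))
        * (exp (6 * Cmod z) * (/ 6) ^ (2 * n + p) * (/ 36) ^ (N - n)))%R.
      + apply Rmult_le_compat; auto using Cmod_ge_0.
      + replace N with (n + (N - n))%nat at 2 by lia.
        rewrite !pow_add, !pow_mult.
        replace ((/ 6) ^ 2)%R with (/ 36)%R by field. replace (3 ^ 2)%R with 9%R by ring.
        set (a := ((/ 36) ^ n)%R). set (c := ((/ 36) ^ (N - n))%R).
        assert (0 <= a)%R by (apply pow_le; lra). assert (0 <= c)%R by (apply pow_le; lra).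
        assert (P : (3 ^ p * (/ 6) ^ p <= 1)%R).
        { rewrite <- Rpow_mult_distr, <- (pow1 p). apply pow_incr. lra. }
        assert (0 <= exp (6 * Cmod z))%R by (apply Rlt_le, exp_pos).
        assert (0 <= 9 ^ n)%R by (apply pow_le; lra).
        assert (P0 : (0 <= 9 ^ n * (2 * x * M * exp (6 * Cmod z) * (a * c)))%R)
          by (repeat apply Rmult_le_pos; lra).
        replace (2 * x * M * (9 ^ n * 3 ^ p) * (exp (6 * Cmod z) * (a * (/ 6) ^ p) * c))%R
          with ((3 ^ p * (/ 6) ^ p) * (9 ^ n * (2 * x * M * exp (6 * Cmod z) * (a * c))))%R by ring.
        nra.
    - rewrite <- scal_sum.
      assert (E36 : ((/ 36) ^ N * 9 ^ N = (/ 4) ^ N)%R).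
      { rewrite <- Rpow_mult_distr. f_equal. field. }
      pose proof (sum_pow_9 N) as S9.
      assert (0 <= 2 * x * M)%R by (repeat apply Rmult_le_pos; lra).
      assert (0 <= exp (6 * Cmod z))%R by (apply Rlt_le, exp_pos).
      assert (0 <= (/ 36) ^ N)%R by (apply pow_le; lra).
      assert (0 <= (/ 4) ^ N)%R by (apply pow_le; lra).
      apply Rle_trans with (2 * x * M * exp (6 * Cmod z) * (/ 36) ^ N * (2 * 9 ^ N))%R.
      + apply Rmult_le_compat_l; [|exact S9]. repeat apply Rmult_le_pos; lra.
      + replace (2 * x * M * exp (6 * Cmod z) * (/ 36) ^ N * (2 * 9 ^ N))%R
          with (4 * x * M * exp (6 * Cmod z) * ((/ 36) ^ N * 9 ^ N))%R by ring.
        rewrite E36. apply Rmult_le_compat_r; [assumption|].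
        apply Rmult_le_compat_l; [repeat apply Rmult_le_pos; lra|].
        rewrite E7. specialize (Ee (Cmod z) Hz). nra. }
  replace (I - S) with ((I - T) + - (S - T)) by ring.
  eapply Rle_trans; [apply Cmod_triangle|]. rewrite Cmod_opp. lra.
Qed.

(** * The coefficients as Legendre moments *)

Lemma leg_m1 (n : nat) : leg n (-1) = ((-1) ^ n)%R.
Proof.
  induction n as [| |n IH1 IH2] using two_step_ind.
  - unfold leg. rewrite leg_form_0. reflexivity.
  - unfold leg. rewrite leg_form_1. reflexivity.
  - pose proof (leg_bonnet n (-1)) as E. rewrite IH1, IH2 in E. simpl in *.
    pose proof (pos_INR n). apply (Rmult_eq_reg_l (INR n + 2)); [|lra].
    rewrite E. ring.
Qed.

(** [phi_k] is [T[x^k]], so its derivative, divided by [x^k], is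
    [k/x + K(x,x) + (-1)^k K(x,-x)] plus the moment of order [k] of [K_x]; it remains to combine
    these with the coefficients of [P_n]. *)
Lemma gamma_formula_leg_moment (b : R) (q f Q : R -> C) (h : C) (W : R -> R -> C)
  (n : nat) (x : R) :
  (0 < b)%R -> (0 < x <= b)%R ->
  (forall y, Ccont Q y) -> joint_continuous W -> (forall y, seg b y -> Q y = q y) ->
  h = deriv b f 0 ->
  (forall k y, seg b y -> transmute h Q W (fun t => RtoC t ^ k) y = phi f k y) ->
  gamma_formula b q f n x
  = (2 * INR n + 1)%R / 2 * leg_moment (fun t => kern_x Q W x t) x n.
Proof.
  intros Hb Hx HQ HW EQ Hh Hphi.
  assert (Sx : seg b x) by (split; lra).
  assert (Nx : RtoC x <> 0) by (apply RtoC_neq_0; lra).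
  assert (Cg := joint_continuous_kern_x Q W HQ HW).
  assert (Eq : CInt q 0 x = CInt Q 0 x).
  { apply CInt_ext. intros s Hs. rewrite Rmin_left, Rmax_right in Hs by lra.
    symmetry. apply EQ. split; lra. }
  assert (ED : forall k, deriv b (phi f k) x / x ^ k =
     INR k / x + (h / 2 + / 2 * CInt Q 0 x) + h / 2 * RtoC ((-1) ^ k)
      + moment (fun t => kern_x Q W x t) x k).
  { intros k.
    rewrite (deriv_eq b (phi f k) x (transmute_d h Q W (fun t => RtoC t ^ k)
      (fun t => INR k * RtoC t ^ pred k) x)).
    - assert (Nxk : RtoC x ^ k <> 0) by (apply Cpow_nz, Nx).
      assert (Em : CInt (fun t => kern_x Q W x t * RtoC t ^ k) (- x) x
        = RtoC x ^ k * moment (fun t => kern_x Q W x t) x k).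
      { unfold moment. rewrite <- CInt_scal by (intros; unfold Rdiv; cont).
        apply CInt_ext. intros t _. rewrite RtoC_div by lra.
        replace (RtoC t) with (RtoC x * (t / x)) at 1 by (field; exact Nx).
        rewrite Cpow_mult_l. ring. }
      unfold transmute_d. rewrite Em.
      replace (RtoC (- x)) with (RtoC (-1) * RtoC x) by (rewrite <- RtoC_mult; f_equal; ring).
      rewrite Cpow_mult_l, <- (RtoC_pow (-1)).
      replace (INR k * RtoC x ^ pred k) with (INR k / x * x ^ k).
      + field. split; assumption.
      + destruct k as [|k]; [simpl INR; unfold Cdiv; ring|].
        rewrite Cpow_S. simpl pred. field. exact Nx.
    - exact Hb.
    - exact Sx.
    - apply (is_Cderive_is_deriv b (transmute h Q W (fun t => RtoC t ^ k))); [exact Sx | |].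
      + intros y Hy. apply Hphi, Hy.
      + apply is_Cderive_transmute; auto. intros. apply is_Cderive_pow. }
  unfold gamma_formula. rewrite <- Hh, Eq.
  rewrite (Csum_ext _ (fun k => / x * RtoC (leg_coef k n * INR k)%R
     + (h / 2 + / 2 * CInt Q 0 x) * RtoC (leg_coef k n * 1 ^ k)%R
     + h / 2 * RtoC (leg_coef k n * (-1) ^ k)%R
     + leg_coef k n * moment (fun t => kern_x Q W x t) x k)).
  - rewrite !Csum_plus, !Csum_scal, <- !Csum_RtoC.
    change (sum_f_R0 (fun k => (leg_coef k n * INR k)%R) n) with (leg_form INR n).
    change (sum_f_R0 (fun k => (leg_coef k n * 1 ^ k)%R) n) with (leg n 1).
    change (sum_f_R0 (fun k => (leg_coef k n * (-1) ^ k)%R) n) with (leg n (-1)).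
    rewrite leg_deriv_1, leg_1, leg_m1.
    rewrite (leg_moment_moment (fun t => kern_x Q W x t) x n) by (intros; cont).
    rewrite <- RtoC_pow, RtoC_div by lra.
    rewrite !RtoC_plus, !RtoC_mult, RtoC_plus. field. exact Nx.
  - intros k Hk. rewrite <- (leg_coef_le k n Hk).
    replace (leg_coef k n * deriv b (phi f k) x / x ^ k)
      with (leg_coef k n * (deriv b (phi f k) x / x ^ k)) by (unfold Cdiv; ring).
    rewrite ED, pow1, !RtoC_mult. unfold Cdiv. ring.
Qed.

Lemma joint_continuous_bounded_R (F : R -> R -> R) (A : R) :
  (0 <= A)%R -> (forall x t, continuity_2d_pt F x t) ->
  exists M, forall x t, (Rabs x <= A)%R -> (Rabs t <= A)%R -> (Rabs (F x t) <= M)%R.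
Proof.
  intros HA HF.
  destruct (uniform_continuity_2d F (- A) A (- A) A (fun x y _ _ => HF x y)
     (mkposreal 1 Rlt_0_1)) as [d Hd].
  pose proof (cond_pos d) as Pd.
  (* walk from the origin in steps shorter than the modulus of continuity *)
  assert (Hn : forall n x t, (Rabs x <= A)%R -> (Rabs t <= A)%R ->
     (Rabs x <= INR n * (d / 2))%R -> (Rabs t <= INR n * (d / 2))%R ->
     (Rabs (F x t - F 0 0) <= INR n)%R).
  { induction n as [|n IH]; intros x t Hx Ht Hxn Htn.
    - simpl in *. rewrite Rmult_0_l in *.
      assert (x = 0%R) by (apply Rabs_eq_0; pose proof (Rabs_pos x); lra).
      assert (t = 0%R) by (apply Rabs_eq_0; pose proof (Rabs_pos t); lra).
      subst. rewrite Rminus_diag, Rabs_R0. lra.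
    - rewrite S_INR in *. pose proof (pos_INR n) as Pn.
      set (c := (INR n / (INR n + 1))%R).
      assert (Hc : (0 <= c <= 1)%R).
      { unfold c. split; [apply Rdiv_le_0_compat; lra | apply Rle_div_l; lra]. }
      assert (Hc1 : ((1 - c) * (INR n + 1) = 1)%R) by (unfold c; field; lra).
      assert (Hc2 : (c * (INR n + 1) = INR n)%R) by (unfold c; field; lra).
      assert (Sm : forall y, (Rabs y <= A)%R -> (Rabs y <= (INR n + 1) * (d / 2))%R ->
         (Rabs (c * y) <= A /\ Rabs (c * y) <= INR n * (d / 2) /\ Rabs (y - c * y) < d)%R).
      { intros y Hy1 Hy2. pose proof (Rabs_pos y).
        replace (y - c * y)%R with ((1 - c) * y)%R by ring.
        rewrite !Rabs_mult, (Rabs_pos_eq c), (Rabs_pos_eq (1 - c)) by lra.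
        repeat split.
        - nra.
        - rewrite <- Hc2. replace (c * (INR n + 1) * (d / 2))%R
            with (c * ((INR n + 1) * (d / 2)))%R by ring.
          apply Rmult_le_compat_l; lra.
        - apply Rle_lt_trans with ((1 - c) * ((INR n + 1) * (d / 2)))%R.
          + apply Rmult_le_compat_l; lra.
          + replace ((1 - c) * ((INR n + 1) * (d / 2)))%R
              with ((1 - c) * (INR n + 1) * (d / 2))%R by ring. rewrite Hc1. lra. }
      destruct (Sm x Hx Hxn) as [X1 [X2 X3]]. destruct (Sm t Ht Htn) as [T1 [T2 T3]].
      specialize (IH (c * x)%R (c * t)%R X1 T1 X2 T2).
      assert (Step : (Rabs (F x t - F (c * x) (c * t)) < 1)%R).
      { apply (Hd (c * x) (c * t) x t)%R; try (apply Rabs_le_between; assumption); assumption. }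
      replace (F x t - F 0 0)%R with
        ((F x t - F (c * x) (c * t)) + (F (c * x) (c * t) - F 0 0))%R by ring.
      eapply Rle_trans; [apply Rabs_triang|]. lra. }
  destruct (nfloor_ex (A / (d / 2))) as [n [_ Hn2]].
  { apply Rdiv_le_0_compat; lra. }
  exists (INR (S n) + Rabs (F 0 0))%R. intros x t Hx Ht.
  assert (HA2 : (A <= INR (S n) * (d / 2))%R).
  { rewrite S_INR. apply Rle_div_l; [lra|]. lra. }
  specialize (Hn (S n) x t Hx Ht ltac:(lra) ltac:(lra)).
  replace (F x t) with ((F x t - F 0 0) + F 0 0)%R by ring.
  eapply Rle_trans; [apply Rabs_triang|]. lra.
Qed.

Lemma joint_continuous_bounded (F : R -> R -> C) (A : R) :
  (0 <= A)%R -> joint_continuous F ->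
  exists M, forall x t, (Rabs x <= A)%R -> (Rabs t <= A)%R -> (Cmod (F x t) <= M)%R.
Proof.
  intros HA HF.
  destruct (joint_continuous_bounded_R (fun x t => Re (F x t)) A HA
    (fun x t => joint_continuous_Re F x t HF)) as [M1 H1].
  destruct (joint_continuous_bounded_R (fun x t => Im (F x t)) A HA
    (fun x t => joint_continuous_Im F x t HF)) as [M2 H2].
  exists (M1 + M2)%R. intros x t Hx Ht.
  specialize (H1 x t Hx Ht). specialize (H2 x t Hx Ht).
  replace (F x t) with (RtoC (Re (F x t)) + Ci * RtoC (Im (F x t))).
  - eapply Rle_trans; [apply Cmod_triangle|].
    rewrite Cmod_mult, Cmod_Ci, !Cmod_R. lra.
  - apply injective_projections; unfold Re, Im; simpl; ring.
Qed.

(** The value at 0 is a limit from the right, and a bound by a multiple of [x]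
    makes it vanish; the moments satisfy such a bound. *)
Lemma gamma_0 (b : R) (q f : R -> C) (n : nat) (B : R) : (0 < b)%R ->
  (forall x, (0 < x <= b)%R -> (Cmod (gamma_formula b q f n x) <= B * x)%R) ->
  gamma b q f n 0 = 0.
Proof.
  intros Hb H. unfold gamma. destruct (Req_EM_T 0 0) as [_|N]; [|contradiction].
  assert (HB : (0 <= B)%R).
  { specialize (H b ltac:(lra)). pose proof (Cmod_ge_0 (gamma_formula b q f n b)). nra. }
  apply (iota_filterlim_locally (K := R_AbsRing) (V := C_R_CompleteNormedModule)
    (F := at_right 0)).
  apply filterlim_locally. intros eps. pose proof (cond_pos eps) as He.
  assert (Pd : (0 < Rmin b (eps / (B + 1)))%R).
  { apply Rmin_pos; [exact Hb | apply Rdiv_lt_0_compat; lra]. }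
  exists (mkposreal _ Pd). intros x Hx Hx0.
  change (Rabs (x - 0) < Rmin b (eps / (B + 1)))%R in Hx.
  rewrite Rminus_0_r, Rabs_pos_eq in Hx by lra.
  pose proof (Rmin_l b (eps / (B + 1))). pose proof (Rmin_r b (eps / (B + 1))).
  apply (C_NormedModule_mixin_compat1 0 (gamma_formula b q f n x)).
  change (Cmod (gamma_formula b q f n x - 0) < eps)%R.
  replace (gamma_formula b q f n x - 0) with (gamma_formula b q f n x) by ring.
  eapply Rle_lt_trans; [apply H; lra|].
  apply Rle_lt_trans with ((B + 1) * x)%R; [nra|].
  replace (pos eps) with ((B + 1) * (eps / (B + 1)))%R by (field; lra).
  apply Rmult_lt_compat_l; lra.
Qed.

(** The discs of integral radius about the origin cover the plane. *)
Lemma compactC_bounded (D : C -> Prop) : compactC D ->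
  exists B, forall z, D z -> (Cmod z <= B)%R.
Proof.
  intros HD.
  destruct (HD nat (fun n z => (Cmod z < INR n)%R)) as [l Hl].
  - intros n z Hz.
    assert (P : (0 < (INR n - Cmod z) / 2)%R) by lra.
    exists (mkposreal _ P). intros y Hy.
    apply C_NormedModule_mixin_compat2 in Hy.
    change (Cmod (y - z) < sqrt 2 * ((INR n - Cmod z) / 2))%R in Hy.
    assert (sqrt 2 <= 2)%R.
    { rewrite <- (sqrt_pow2 2) at 2 by lra. apply sqrt_le_1; lra. }
    replace y with ((y - z) + z) by ring.
    eapply Rle_lt_trans; [apply Cmod_triangle|]. nra.
  - intros z _. destruct (nfloor_ex (Cmod z) (Cmod_ge_0 z)) as [n [_ Hn]].
    exists (S n). rewrite S_INR. exact Hn.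
  - exists (INR (List.list_max l)). intros z Hz.
    destruct (Hl z Hz) as [n [Hn1 Hn2]].
    apply Rle_trans with (INR n); [lra|]. apply le_INR.
    assert (HF := proj1 (List.list_max_le l (List.list_max l)) (Nat.le_refl _)).
    rewrite List.Forall_forall in HF. apply HF, Hn1.
Qed.

(** The terms of the two series: [cterm] for [p = 0] and [sterm] for [p = 1]. *)
Definition neumann_term (p : nat) (b : R) (q f : R -> C) (w : C) (x : R) (n : nat) : C :=
  (-1) ^ n * gamma b q f (2 * n + p) x * sphj (2 * n + p) (w * x).

Lemma geom_bound_series (a : nat -> C) (l : C) (B : R) :
  (forall N, (Cmod (l - Csum a N) <= B * (/ 4) ^ N)%R) -> is_Cseries a l.
Proof.
  intros H. apply is_Cseries_eps. intros eps He.
  assert (HB : (0 <= B)%R).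
  { specialize (H 0%nat). simpl in H. pose proof (Cmod_ge_0 (l - Csum a 0)). lra. }
  destruct (pow_lt_1_zero (/ 4) ltac:(rewrite Rabs_pos_eq; lra) (eps / (B + 1))
    ltac:(apply Rdiv_lt_0_compat; lra)) as [N HN].
  exists N. intros n Hn. specialize (HN n Hn).
  assert (P : (0 <= (/ 4) ^ n)%R) by (apply pow_le; lra).
  rewrite Rabs_pos_eq in HN by exact P.
  replace (Csum a n - l) with (- (l - Csum a n)) by ring. rewrite Cmod_opp.
  eapply Rle_lt_trans; [apply H|].
  apply Rle_lt_trans with ((B + 1) * (/ 4) ^ n)%R; [nra|].
  replace eps with ((B + 1) * (eps / (B + 1)))%R by (field; lra).
  apply Rmult_lt_compat_l; lra.
Qed.

Lemma neumann_term_bound (b : R) (q f Q : R -> C) (h : C) (W : R -> R -> C) :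
  (0 < b)%R ->
  (forall y, Ccont Q y) -> joint_continuous W -> (forall y, seg b y -> Q y = q y) ->
  h = deriv b f 0 ->
  (forall k y, seg b y -> transmute h Q W (fun t => RtoC t ^ k) y = phi f k y) ->
  exists B, (0 <= B)%R /\ forall p w x N, (p <= 1)%nat -> seg b x ->
    (Cmod (/ 2 * CInt (fun t => kern_x Q W x t * trig p (w * t))%C (- x) x
       - Csum (neumann_term p b q f w x) N) <= B * exp (7 * (Cmod w * b)) * (/ 4) ^ N)%R.
Proof.
  intros Hb HQ HW EQ Hh Hphi.
  assert (Cg := joint_continuous_kern_x Q W HQ HW).
  destruct (joint_continuous_bounded (kern_x Q W) b ltac:(lra) Cg) as [M HM].
  assert (HM0 : (0 <= M)%R).
  { eapply Rle_trans; [apply (Cmod_ge_0 (kern_x Q W 0 0))|]. apply HM; rewrite Rabs_R0; lra. }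
  assert (HMx : forall x, (0 < x <= b)%R -> forall t, (- x <= t <= x)%R ->
     (Cmod (kern_x Q W x t) <= M)%R).
  { intros x Hx t Ht. apply HM; apply Rabs_le_between; lra. }
  assert (CG : forall x t, Ccont (fun t => kern_x Q W x t) t) by (intros; cont).
  assert (EG : forall n x, (0 < x <= b)%R -> gamma_formula b q f n x
     = (2 * INR n + 1)%R / 2 * leg_moment (fun t => kern_x Q W x t) x n).
  { intros n x Hx. apply (gamma_formula_leg_moment b q f Q h W n x); assumption. }
  assert (G0 : forall n, gamma b q f n 0 = 0).
  { intros n. apply (gamma_0 b q f n ((2 * INR n + 1) / 2 * (2 * M * 3 ^ n)) Hb).
    intros x Hx. rewrite EG by exact Hx.
    rewrite Cmod_mult, Cmod_div, !Cmod_R by (apply RtoC_neq_0; lra).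
    pose proof (pos_INR n). rewrite !Rabs_pos_eq by lra.
    rewrite Rmult_assoc. apply Rmult_le_compat_l; [lra|].
    replace (2 * M * 3 ^ n * x)%R with (2 * x * M * 3 ^ n)%R by ring.
    apply leg_moment_bound; [lra | apply CG | apply HMx, Hx]. }
  exists (3 * b * M)%R. split; [repeat apply Rmult_le_pos; lra|].
  intros p w x N Hp Hx.
  assert (P4 : (0 <= (/ 4) ^ N)%R) by (apply pow_le; lra).
  assert (Pe : (0 <= exp (7 * (Cmod w * b)))%R) by (apply Rlt_le, exp_pos).
  destruct (Req_dec x 0) as [->|Nx].
  - rewrite Ropp_0, CInt_point.
    replace (Csum (neumann_term p b q f w 0) N) with (RtoC 0).
    + replace (/ 2 * 0 - 0) with (RtoC 0) by ring. rewrite Cmod_0.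
      repeat apply Rmult_le_pos; lra.
    + clear P4. induction N as [|N IH]; [rewrite Csum_0 | rewrite Csum_S, <- IH];
        unfold neumann_term; rewrite G0; ring.
  - assert (Hx' : (0 < x <= b)%R) by (destruct Hx; split; lra).
    pose proof (neumann_bound (fun t => kern_x Q W x t) x M w p N (proj1 Hx') Hp (CG x) (HMx x Hx')) as NB.
    rewrite (Csum_ext (neumann_term p b q f w x) (fun n => / 2 * ((-1) ^ n
      * leg_moment (fun t => kern_x Q W x t) x (2 * n + p) *
          ((2 * INR (2 * n + p) + 1)%R * sphj (2 * n + p) (w * x))))).
    + rewrite Csum_scal.
      match goal with |- (Cmod (Cminus (Cmult (Cinv (RtoC 2)) ?I) (Cmult _ ?S)) <= _)%R =>
        replace (/ 2 * I - / 2 * S) with (/ 2 * (I - S)) by ring end.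
      rewrite Cmod_mult, Cmod_inv, Cmod_R, Rabs_pos_eq
        by (lra || (apply RtoC_neq_0; lra)).
      apply (Rmult_le_reg_l 2); [lra|].
      rewrite <- Rmult_assoc, Rinv_r, Rmult_1_l by lra.
      eapply Rle_trans; [exact NB|].
      assert (Le : (exp (7 * Cmod (w * x)) <= exp (7 * (Cmod w * b)))%R).
      { rewrite Cmod_mult, Cmod_R, Rabs_pos_eq by lra.
        assert (L : (7 * (Cmod w * x) <= 7 * (Cmod w * b))%R).
        { pose proof (Cmod_ge_0 w). nra. }
        apply exp_le, L. }
      replace (2 * (3 * b * M * exp (7 * (Cmod w * b)) * (/ 4) ^ N))%R
        with (6 * b * M * exp (7 * (Cmod w * b)) * (/ 4) ^ N)%R by ring.
      apply Rmult_le_compat_r; [exact P4|].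
      apply Rmult_le_compat; [|apply Rlt_le, exp_pos| |exact Le].
      * repeat apply Rmult_le_pos; lra.
      * apply Rmult_le_compat_r; lra.
    + intros n _. unfold neumann_term, gamma. destruct (Req_EM_T x 0) as [E|_]; [contradiction|].
      rewrite EG by exact Hx'. field.
Qed.

Lemma neumann_term_unif (b : R) (q f : R -> C) (p : nat) (I : C -> R -> C) (B : R) (S : C -> Prop) :
  (0 <= B)%R -> (0 < b)%R ->
  (forall w x N, seg b x ->
    (Cmod (I w x - Csum (neumann_term p b q f w x) N) <= B * exp (7 * (Cmod w * b)) * (/ 4) ^ N)%R) ->
  compactC S -> series_cv_unif S b (neumann_term p b q f).
Proof.
  intros HB Hb H HS. destruct (compactC_bounded S HS) as [D HD].
  intros eps He.
  set (E := (B * exp (7 * (D * b)))%R).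
  assert (HE : (0 <= E)%R) by (apply Rmult_le_pos; [exact HB | apply Rlt_le, exp_pos]).
  destruct (pow_lt_1_zero (/ 4) ltac:(rewrite Rabs_pos_eq; lra) (eps / (E + 1))
    ltac:(apply Rdiv_lt_0_compat; lra)) as [N HN].
  exists N. intros n w x Hn Hw Hx. specialize (HN n Hn).
  assert (P : (0 <= (/ 4) ^ n)%R) by (apply pow_le; lra).
  rewrite Rabs_pos_eq in HN by exact P.
  rewrite (CSeries_eq _ (I w x)) by (eapply geom_bound_series; intros; apply H, Hx).
  replace (Csum (neumann_term p b q f w x) n - I w x)
    with (- (I w x - Csum (neumann_term p b q f w x) n)) by ring.
  rewrite Cmod_opp. eapply Rle_lt_trans; [apply H, Hx|].
  apply Rle_lt_trans with (E * (/ 4) ^ n)%R.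
  - apply Rmult_le_compat_r; [exact P|]. apply Rmult_le_compat_l; [exact HB|].
    specialize (HD w Hw).
    assert (L : (7 * (Cmod w * b) <= 7 * (D * b))%R) by nra.
    apply exp_le, L.
  - apply Rle_lt_trans with ((E + 1) * (/ 4) ^ n)%R; [nra|].
    replace eps with ((E + 1) * (eps / (E + 1)))%R by (field; lra).
    apply Rmult_lt_compat_l; lra.
Qed.

Lemma Ccos_opp (z : C) : Ccos (- z) = Ccos z.
Proof.
  unfold Ccos. replace (Ci * - z) with (- (Ci * z)) by ring.
  replace (- - (Ci * z)) with (Ci * z) by ring. unfold Cdiv. ring.
Qed.

Lemma Csin_opp (z : C) : Csin (- z) = - Csin z.
Proof.
  unfold Csin. replace (Ci * - z) with (- (Ci * z)) by ring.
  replace (- - (Ci * z)) with (Ci * z) by ring. unfold Cdiv. ring.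
Qed.

Theorem proposition5p2 (b : R) (q f : R -> C) (h : C) (K : R -> R -> C)
  (hb : (0 < b)%R)
  (hq : continuous_on (seg b) q)
  (hf : is_solution b q f)
  (hf_neq0 : forall x : R, seg b x -> f x <> 0)
  (hf0 : f 0%R = 1)
  (hh : h = deriv b f 0)
  (hK : is_kernel b q h K) :
  (forall (w : C) (x : R), seg b x ->
     is_deriv b (csol K w) x
       (- (w * Csin (w * x)) + (h + / 2 * CInt q 0 x) * Ccos (w * x)
        + 2 * CSeries (cterm b q f w x)))
  /\
  (forall (w : C) (x : R), seg b x ->
     is_deriv b (ssol K w) x
       (w * Ccos (w * x) + / 2 * CInt q 0 x * Csin (w * x)
        + 2 * CSeries (sterm b q f w x)))
  /\
  (forall S : C -> Prop, compactC S ->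
     series_cv_unif S b (cterm b q f) /\ series_cv_unif S b (sterm b q f)).
Proof.
  destruct hf as [df [Hdf Hddf]].
  destruct (kernel_extension b q h K hb hq hK) as [Q [W [HQ [HW [EQ [EK EW]]]]]].
  assert (S0 : seg b 0) by (split; lra).
  assert (Edf : df 0%R = h).
  { rewrite hh. symmetry. apply deriv_eq; auto. }
  assert (Hphi : forall k y, seg b y ->
     transmute h Q W (fun t => RtoC t ^ k) y = phi f k y).
  { intros k y Hy. apply (transmute_pow b q f df Q h W k); assumption. }
  destruct (neumann_term_bound b q f Q h W hb HQ HW EQ hh Hphi) as [B [HB HN]].
  assert (ES : forall p w x, (p <= 1)%nat -> seg b x ->
     2 * CSeries (neumann_term p b q f w x)
     = CInt (fun t => kern_x Q W x t * trig p (w * t)) (- x) x).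
  { intros p w x Hp Hx.
    rewrite (CSeries_eq _ (/ 2 * CInt (fun t => kern_x Q W x t * trig p (w * t)) (- x) x)).
    - field.
    - eapply geom_bound_series. intros N. apply HN; assumption. }
  assert (EqQ : forall x, seg b x -> CInt q 0 x = CInt Q 0 x).
  { intros x [X1 X2]. apply CInt_ext. intros s Hs.
    rewrite Rmin_left, Rmax_right in Hs by lra. symmetry. apply EQ. split; lra. }
  assert (EI : forall p w x, (p <= 1)%nat -> seg b x ->
     transmute h Q W (fun t => trig p (w * t)) x
     = trig p (w * x) + CInt (fun t => K x t * trig p (w * t)) (- x) x).
  { intros p w x Hp [X1 X2]. unfold transmute. apply (f_equal (Cplus _)).
    apply CInt_ext. intros t Ht.
    rewrite Rmin_left, Rmax_right in Ht by lra. rewrite EK; [reflexivity|].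
    split; simpl; [lra|]. apply Rabs_le_between. lra. }
  assert (Ect : cterm b q f = neumann_term 0 b q f).
  { apply functional_extensionality. intros w. apply functional_extensionality. intros x.
    apply functional_extensionality. intros n.
    unfold neumann_term, cterm. rewrite Nat.add_0_r. reflexivity. }
  split; [|split].
  - intros w x Hx.
    apply (is_Cderive_is_deriv b (transmute h Q W (fun t => trig 0 (w * t)))); [exact Hx| |].
    { intros y Hy. rewrite EI by (auto; lia). reflexivity. }
    rewrite Ect, ES, EqQ by (auto; lia).
    replace (- (w * Csin (w * x)) + (h + / 2 * CInt Q 0 x) * Ccos (w * x)
      + CInt (fun t => kern_x Q W x t * trig 0 (w * t)) (- x) x)
      with (transmute_d h Q W (fun t => trig 0 (w * t))
        (fun t => - (w * Csin (w * t))) x).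
    + apply is_Cderive_transmute; auto. intros t.
      exact (is_Cderive_trig 0 w t (Nat.le_0_l 1)).
    + unfold transmute_d.
      replace (trig 0 (w * (- x)%R)) with (Ccos (w * x)).
      2:{ rewrite RtoC_opp. replace (w * - x) with (- (w * x)) by ring.
          symmetry. apply Ccos_opp. }
      change (trig 0 (w * x)) with (Ccos (w * x)). field.
  - intros w x Hx.
    apply (is_Cderive_is_deriv b (transmute h Q W (fun t => trig 1 (w * t)))); [exact Hx| |].
    { intros y Hy. rewrite EI by (auto; lia). reflexivity. }
    change (sterm b q f w x) with (neumann_term 1 b q f w x).
    rewrite ES, EqQ by (auto; lia).
    replace (w * Ccos (w * x) + / 2 * CInt Q 0 x * Csin (w * x)
      + CInt (fun t => kern_x Q W x t * trig 1 (w * t)) (- x) x)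
      with (transmute_d h Q W (fun t => trig 1 (w * t)) (fun t => w * Ccos (w * t)) x).
    + apply is_Cderive_transmute; auto. intros t.
      exact (is_Cderive_trig 1 w t (Nat.le_refl 1)).
    + unfold transmute_d.
      replace (trig 1 (w * (- x)%R)) with (- Csin (w * x)).
      2:{ rewrite RtoC_opp. replace (w * - x) with (- (w * x)) by ring.
          symmetry. apply Csin_opp. }
      change (trig 1 (w * x)) with (Csin (w * x)). field.
  - intros S HS. rewrite Ect. split.
    + apply (neumann_term_unif b q f 0 (fun w x =>
        / 2 * CInt (fun t => kern_x Q W x t * trig 0 (w * t)) (- x) x) B); auto.
    + apply (neumann_term_unif b q f 1 (fun w x =>
        / 2 * CInt (fun t => kern_x Q W x t * trig 1 (w * t)) (- x) x) B); auto.
Qed.
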